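(* The decision version of SMC-1 (given an instance and an integer $b$, decide whether there is a feasible matching with at most $b$ blocking pairs) is $\mathsf{W}[1]$-hard when parameterized by $b+\Delta_{\mathcal M}$, even when restricted to instances with $\mathcal W^\star=\{s\}$ for a single woman $s$, $\Delta_{\mathcal W}=3$, and $|L(s)|=1$.
   Context: An instance of Stable Marriage with Covering Constraints (SMC) consists of a finite set $\mathcal M$ of men, a finite set $\mathcal W$ of women, for each person $x$ a preference list $L(x)$ strictly ordering a subset of the opposite sex (the persons acceptable to $x$), and subsets $\mathcal W^\star\subseteq\mathcal W$, $\mathcal M^\star\subseteq\mathcal M$ of distinguished persons. A matching is a set of disjoint man–woman pairs $\{m,w\}$ with $m$ and $w$ in each other's lists; $M(x)$ denotes the partner of $x$. A pair $\{m,w\}$ of mutually acceptable persons is blocking for $M$ if $m$ is unmatched or prefers $w$ to $M(m)$, and $w$ is unmatched or prefers $m$ to $M(w)$. A matching is feasible if it matches every person in $\mathcal W^\star\cup\mathcal M^\star$. SMC-1 is the special case $\mathcal M^\star=\emptyset$. $\Delta_{\mathcal M}$ and $\Delta_{\mathcal W}$ denote the maximum length of the preference list of a man and of a woman, respectively. *)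

(* Defs.v *)
(* MathComp world. *)
From mathcomp Require Import all_boot.

Set Implicit Arguments.
Unset Strict Implicit.
Unset Printing Implicit Defensive.

(** * Model of computation

    WHILE programs over binary trees (Jones, "Computability and Complexity from
    a Programming Perspective").  Evaluating an expression costs at least the
    sizes of all the trees read or built on the way, so sharing of subtrees is
    never free and a run of cost [t] only handles trees of size [O(n + t)].
    Such programs and multitape Turing machines simulate one another with
    polynomial overhead: "computable" and "time [f(k) n^O(1)]" have their usual
    meaning. *)

Inductive tree : Type := Leaf | Node of tree & tree.

Fixpoint tree_size (t : tree) : nat :=
  if t is Node l r then (tree_size l + tree_size r).+1 else 1.

Definition thead (t : tree) : tree := if t is Node l _ then l else Leaf.
Definition ttail (t : tree) : tree := if t is Node _ r then r else Leaf.

Inductive expr : Type :=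
  | Var of nat
  | Nil
  | Cons of expr & expr
  | Hd of expr
  | Tl of expr.

Inductive cmd : Type :=
  | Assign of nat & expr
  | Seq of cmd & cmd
  | If of expr & cmd & cmd
  | While of expr & cmd.

Definition store : Type := nat -> tree.

Definition update (s : store) (x : nat) (v : tree) : store :=
  fun y => if y == x then v else s y.

Fixpoint eval (s : store) (e : expr) : tree :=
  match e with
  | Var x => s x
  | Nil => Leaf
  | Cons e1 e2 => Node (eval s e1) (eval s e2)
  | Hd e1 => thead (eval s e1)
  | Tl e1 => ttail (eval s e1)
  end.

Fixpoint cost (s : store) (e : expr) : nat :=
  match e with
  | Var x => tree_size (s x)
  | Nil => 1
  | Cons e1 e2 => (cost s e1 + cost s e2).+1
  | Hd e1 => (cost s e1).+1
  | Tl e1 => (cost s e1).+1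
  end.

(* [Leaf] plays the role of false, every [Node] that of true. *)
Definition truthy (t : tree) : bool := if t is Node _ _ then true else false.

(* [exec p s s' t]: [p] started in [s] halts in store [s'] after time [t]. *)
Inductive exec : cmd -> store -> store -> nat -> Prop :=
  | ExecAssign s x e :
      exec (Assign x e) s (update s x (eval s e)) (cost s e).+1
  | ExecSeq s s1 s2 p q t1 t2 :
      exec p s s1 t1 -> exec q s1 s2 t2 -> exec (Seq p q) s s2 (t1 + t2).+1
  | ExecIfTrue s s1 e p q t1 :
      truthy (eval s e) -> exec p s s1 t1 ->
      exec (If e p q) s s1 (cost s e + t1).+1
  | ExecIfFalse s s1 e p q t1 :
      ~~ truthy (eval s e) -> exec q s s1 t1 ->
      exec (If e p q) s s1 (cost s e + t1).+1
  | ExecWhileTrue s s1 s2 e p t1 t2 :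
      truthy (eval s e) -> exec p s s1 t1 -> exec (While e p) s1 s2 t2 ->
      exec (While e p) s s2 (cost s e + t1 + t2).+1
  | ExecWhileFalse s e p :
      ~~ truthy (eval s e) -> exec (While e p) s s (cost s e).+1.

Definition init (x : tree) : store := fun y => if y == 0 then x else Leaf.

(* Input and output are held by variable 0; all other variables start at
   [Leaf]. *)
Definition runs (p : cmd) (x y : tree) (t : nat) : Prop :=
  exists2 s : store, exec p (init x) s t & s 0 = y.

(** Encodings.  Numbers are written in unary: in the problems below each one is
    bounded by the size of the structure it belongs to, or by the parameter. *)

Fixpoint enc_nat (n : nat) : tree :=
  if n is n'.+1 then Node Leaf (enc_nat n') else Leaf.

Definition enc_seq (T : Type) (f : T -> tree) (s : seq T) : tree :=
  foldr (fun x t => Node (f x) t) Leaf s.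

Definition computable (f : nat -> nat) : Prop :=
  exists p : cmd, forall n, exists t, runs p (enc_nat n) (enc_nat (f n)) t.

(** * Parameterized problems and fpt-reductions *)

(* A language of trees is the case [inst := tree], [enc := id]; problems given
   as sets of pairs (x, k) are the case where [param] reads off a component of
   the instance. *)
Record pproblem : Type := PProblem {
  inst : Type;
  enc : inst -> tree;
  yes : inst -> Prop;
  param : inst -> nat
}.

Definition fpt_reduces (P Q : pproblem) : Prop :=
  exists (p : cmd) (f g : nat -> nat) (c : nat),
    [/\ computable f, computable g &
      forall x : inst P, exists (y : inst Q) (t : nat),
        [/\ runs p (enc x) (enc y) t,
            t <= f (param x) * tree_size (enc x) ^ c,
            yes x <-> yes y &
            param y <= g (param x)]].

Definition restriction (P : pproblem) (C : inst P -> Prop) : pproblem :=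
  {| inst := {x : inst P | C x};
     enc := fun x => enc (sval x);
     yes := fun x => yes (sval x);
     param := fun x => param (sval x) |}.

(** * Boolean circuits and the W-hierarchy *)

(* Gates refer to their in-neighbours by position in the circuit. *)
Inductive gate : Type :=
  | InputGate
  | NotGate of nat
  | AndGate of seq nat
  | OrGate of seq nat.

Definition preds (g : gate) : seq nat :=
  match g with
  | InputGate => [::]
  | NotGate j => [:: j]
  | AndGate js => js
  | OrGate js => js
  end.

Definition is_input (g : gate) : bool := if g is InputGate then true else false.

Record circuit : Type := Circuit { gates : seq gate; output : nat }.

Definition gate_at (c : circuit) (i : nat) : gate := nth InputGate (gates c) i.

(* The gates are listed in a topological order of the underlying DAG. *)
Definition circuit_wf (c : circuit) : bool :=
  (output c < size (gates c)) &&
  all (fun i => let js := preds (gate_at c i) in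
         [&& all (fun j => j < i) js, uniq js &
             is_input (gate_at c i) || (js != [::])])
      (iota 0 (size (gates c))).

(* Computes one value per gate: [f i g vs] is the value of gate [g] at position
   [i] when its in-neighbours have values [vs]. *)
Definition sweep (A : Type) (x0 : A) (f : nat -> gate -> seq A -> A)
    (gs : seq gate) : seq A :=
  foldl (fun vs g => rcons vs (f (size vs) g [seq nth x0 vs j | j <- preds g]))
        [::] gs.

Definition gate_value (a : nat -> bool) (i : nat) (g : gate) (vs : seq bool) :
    bool :=
  match g with
  | InputGate => a i
  | NotGate _ => ~~ head false vs
  | AndGate _ => all id vs
  | OrGate _ => has id vs
  end.

Definition circuit_value (a : nat -> bool) (c : circuit) : bool :=
  nth false (sweep false (gate_value a) (gates c)) (output c).

(* Maximum number of edges on a path from an input gate to the output. *)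
Definition circuit_depth (c : circuit) : nat :=
  nth 0 (sweep 0 (fun _ g ds =>
           if is_input g then 0 else (\max_(d <- ds) d).+1)
           (gates c)) (output c).

(* Maximum number of large gates on a path from an input gate to the output. *)
Definition circuit_weft (c : circuit) : nat :=
  nth 0 (sweep 0 (fun _ g ds => (2 < size (preds g)) + \max_(d <- ds) d)
           (gates c)) (output c).

Definition circuit_inputs (c : circuit) : seq nat :=
  [seq i <- iota 0 (size (gates c)) | is_input (gate_at c i)].

Definition weighted_sat (c : circuit) (k : nat) : Prop :=
  exists a : nat -> bool,
    count a (circuit_inputs c) = k /\ circuit_value a c.

Definition enc_gate (g : gate) : tree :=
  Node (enc_nat (match g with
                 | InputGate => 0
                 | NotGate _ => 1
                 | AndGate _ => 2
                 | OrGate _ => 3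
                 end))
       (enc_seq enc_nat (preds g)).

Definition enc_circuit (c : circuit) : tree :=
  Node (enc_seq enc_gate (gates c)) (enc_nat (output c)).

(* Weighted Circuit Satisfiability, parameterized by the weight. *)
Definition WCS : pproblem :=
  {| inst := {c : circuit | circuit_wf c} * nat;
     enc := fun x => Node (enc_circuit (sval x.1)) (enc_nat x.2);
     yes := fun x => weighted_sat (sval x.1) x.2;
     param := fun x => x.2 |}.

Definition in_W (t : nat) (P : pproblem) : Prop :=
  exists d : nat,
    fpt_reduces P
      (@restriction WCS (fun x => circuit_weft (sval x.1) <= t /\
                                  circuit_depth (sval x.1) <= d)).

Definition W_hard (t : nat) (Q : pproblem) : Prop :=
  forall P : pproblem, in_W t P -> fpt_reduces P Q.

(** * Stable Marriage with Covering Constraints *)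

(* Preference lists start with the most preferred person.  Lists need not be
   symmetric; a pair is acceptable when each member is in the other's list. *)
Record smc : Type := SMC {
  nmen : nat;
  nwomen : nat;
  listM : 'I_nmen -> seq 'I_nwomen;
  listW : 'I_nwomen -> seq 'I_nmen;
  starW : {set 'I_nwomen};
  starM : {set 'I_nmen};
  listM_uniq : forall m, uniq (listM m);
  listW_uniq : forall w, uniq (listW w)
}.

Section Matchings.

Variable I : smc.
Notation man := 'I_(nmen I).
Notation woman := 'I_(nwomen I).
Implicit Types (m : man) (w : woman) (M : {set man * woman}).

Definition acceptable m w : bool := (w \in listM m) && (m \in listW w).

Definition is_matching M : bool :=
  [forall p in M, acceptable p.1 p.2] &&
  [forall p in M, forall q in M, (p != q) ==> (p.1 != q.1) && (p.2 != q.2)].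

Definition wife M m : option woman := [pick w | (m, w) \in M].
Definition husband M w : option man := [pick m | (m, w) \in M].

Definition prefers (T : eqType) (L : seq T) (x y : T) : bool :=
  index x L < index y L.

Definition blocking M m w : bool :=
  [&& acceptable m w,
      if wife M m is Some w' then prefers (listM m) w w' else true &
      if husband M w is Some m' then prefers (listW w) m m' else true].

Definition blocking_pairs M : {set man * woman} := [set p | blocking M p.1 p.2].

Definition feasible M : bool :=
  [forall w in starW I, husband M w != None] &&
  [forall m in starM I, wife M m != None].

Definition DeltaM : nat := \max_(m : man) size (listM m).
Definition DeltaW : nat := \max_(w : woman) size (listW w).

Definition smc_solvable (b : nat) : Prop :=
  exists M, [/\ is_matching M, feasible M & #|blocking_pairs M| <= b].

Definition enc_ord_seq n (s : seq 'I_n) : tree :=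
  enc_seq (fun i : 'I_n => enc_nat i) s.

Definition enc_smc : tree :=
  Node (enc_seq (fun m => enc_ord_seq (listM m)) (enum man))
 (Node (enc_seq (fun w => enc_ord_seq (listW w)) (enum woman))
 (Node (enc_ord_seq (enum (starW I)))
       (enc_ord_seq (enum (starM I))))).

End Matchings.

(* The decision version, parameterized by [b] plus the maximum length of a
   man's preference list. *)
Definition SMC_b_DeltaM : pproblem :=
  {| inst := smc * nat;
     enc := fun x => Node (enc_smc x.1) (enc_nat x.2);
     yes := fun x => smc_solvable x.1 x.2;
     param := fun x => x.2 + DeltaM x.1 |}.

Definition SMC1_b_DeltaM : pproblem :=
  @restriction SMC_b_DeltaM (fun x => starM x.1 = set0).

(* Main.v *)
(* The reduction starts from weighted satisfiability of weft-1 circuits of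
   bounded depth d and passes through constraint satisfaction and a network of
   comparators.

   Circuit to constraints. At most 2^d relevant gates, inputs or large gates,
   reach the output through small gates only; guess their values, which decides
   the output. An in-neighbour of a relevant large gate is a function of at most
   2^d inputs, so the number of true in-neighbours under an input set S is
   the sum, over the subsets A of S of bounded size, of the Moebius transform of
   the count. If S is given by k variables this is a sum over boundedly many
   tuples of indices, with terms depending on boundedly many variables; carrying
   the partial sums modulo a number exceeding all counts in further variables
   makes it a system of constraints whose number depends on k and d only.

   Constraints to network. A lane (j, u) carries a token when variable j takes
   the value u; constraints are variables too, their values being the admissible
   tuples. A comparator sends the disjunction of two lanes to the first and their
   conjunction to the second. Comparing the lane of a value with the lane of an
   option that requires it moves the token of the option there when the choices
   disagree; the variable then has two tokens, and a final scan of its lanes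
   sends a token to one distinguished lane in that case.

   Network to matchings. Each lane is a chain of men and women, in which a token
   is a woman not matched to her own man; two-element preference lists propagate
   it, and a third entry implements one comparator. Every variable is a chain
   with one woman more than it can serve, which forces a blocking pair; the
   position of that pair is the chosen value. With a budget of one blocking pair
   per variable no other pair may block, and the distinguished woman s, whose
   only acceptable man prefers the end of the distinguished lane to her, can be
   matched exactly when no token arrives there. *)

Require Import Defs.
From mathcomp Require Import all_boot zify.
Import Defs.

Set Implicit Arguments.
Unset Strict Implicit.
Unset Printing Implicit Defensive.

(** * Running programs on a part of the store *)

(** Only the number of groups of lanes enters the parameter: it is the budget and, up to two more
    entries, the length of the one long list, that of the man acceptable to [s]. The numbers of
    lanes and comparators may be any polynomial. So the constraint system may have large domains and
    many options, but must have few variables and few constraints. A large gate has unboundedly many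
    in-neighbours and cannot be given a constraint for each of them; counting the true ones by
    inclusion-exclusion replaces them by boundedly many constraints, each reading boundedly many
    variables and hence having polynomially many options. When a matching within the budget is
    analysed, tokens are only a lower bound for vacancies: a token forces a woman away from her own
    man, and no converse is claimed. This suffices, because all that has to be excluded is a token
    at the end of the distinguished lane. Time bounds come from closing the polynomial-time
    functions on encoded data under list operations, folds with controlled growth, and recursion on
    constants such as [d]. *)

Fixpoint evars (e : expr) : nat :=
  match e with
  | Var x => x.+1
  | Nil => 0
  | Cons e1 e2 => maxn (evars e1) (evars e2)
  | Hd e1 | Tl e1 => evars e1
  end.

Fixpoint cvars (p : cmd) : nat :=
  match p with
  | Assign x e => maxn x.+1 (evars e)
  | Seq p q => maxn (cvars p) (cvars q)
  | If e p q => maxn (evars e) (maxn (cvars p) (cvars q))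
  | While e p => maxn (evars e) (cvars p)
  end.

Fixpoint eshift (k : nat) (e : expr) : expr :=
  match e with
  | Var x => Var (k + x)
  | Nil => Nil
  | Cons e1 e2 => Cons (eshift k e1) (eshift k e2)
  | Hd e1 => Hd (eshift k e1)
  | Tl e1 => Tl (eshift k e1)
  end.

Fixpoint cshift (k : nat) (p : cmd) : cmd :=
  match p with
  | Assign x e => Assign (k + x) (eshift k e)
  | Seq p q => Seq (cshift k p) (cshift k q)
  | If e p q => If (eshift k e) (cshift k p) (cshift k q)
  | While e p => While (eshift k e) (cshift k p)
  end.

Lemma eval_shift k N (S s : store) e :
  evars e <= N -> (forall i, i < N -> S (k + i) = s i) ->
  eval S (eshift k e) = eval s e /\ cost S (eshift k e) = cost s e.
Proof.
move=> + HS; elim: e => //= [x Hx|e1 IH1 e2 IH2|e1 IH1|e1 IH1].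
- by rewrite HS.
- by rewrite geq_max => /andP[/IH1[-> ->] /IH2[-> ->]].
- by move=> /IH1[-> ->].
- by move=> /IH1[-> ->].
Qed.

(** No variable from [N] on is read or written, so agreement of the two stores on a window of length
    [N] is an invariant of the run. *)
Lemma exec_shift p s s' t : exec p s s' t ->
  forall k N (S : store), cvars p <= N -> (forall i, i < N -> S (k + i) = s i) ->
  exists2 S', exec (cshift k p) S S' t &
    (forall i, i < N -> S' (k + i) = s' i) /\ (forall j, j < k -> S' j = S j).
Proof.
elim=> {p s s' t} /=.
- move=> s x e k N S; rewrite geq_max => /andP[Hx He] HS.
  have [Ee Ec] := eval_shift He HS.
  exists (update S (k + x) (eval S (eshift k e))).
    by rewrite -Ec; constructor.
  rewrite Ee; split=> [i Hi|j Hj]; rewrite /update.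
    by rewrite eqn_add2l; case: eqP => // _; rewrite HS.
  by case: eqP => // E; move: Hj; rewrite E; lia.
- move=> s s1 s2 p q t1 t2 _ IH1 _ IH2 k N S; rewrite geq_max => /andP[Hp Hq] HS.
  have [S1 X1 [A1 B1]] := IH1 _ _ _ Hp HS.
  have [S2 X2 [A2 B2]] := IH2 _ _ _ Hq A1.
  exists S2; first by econstructor; eauto.
  by split=> // j Hj; rewrite B2 ?B1.
- move=> s s1 e p q t1 He _ IH k N S; rewrite !geq_max => /and3P[H1 H2 H3] HS.
  have [Ee Ec] := eval_shift H1 HS.
  have [S1 X1 [A1 B1]] := IH _ _ _ H2 HS.
  by exists S1 => //; rewrite -Ec; constructor; rewrite ?Ee.
- move=> s s1 e p q t1 He _ IH k N S; rewrite !geq_max => /and3P[H1 H2 H3] HS.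
  have [Ee Ec] := eval_shift H1 HS.
  have [S1 X1 [A1 B1]] := IH _ _ _ H3 HS.
  by exists S1 => //; rewrite -Ec; apply: ExecIfFalse; rewrite ?Ee.
- move=> s s1 s2 e p t1 t2 He _ IH1 _ IH2 k N S Hm HS.
  have /andP[H1 H2] : (evars e <= N) && (cvars p <= N) by rewrite -geq_max.
  have [Ee Ec] := eval_shift H1 HS.
  have [S1 X1 [A1 B1]] := IH1 _ _ _ H2 HS.
  have [S2 X2 [A2 B2]] := IH2 _ _ _ Hm A1.
  exists S2; last by split=> // j Hj; rewrite B2 ?B1.
  by rewrite -Ec; econstructor; rewrite ?Ee //; eauto.
- move=> s e p He k N S; rewrite geq_max => /andP[H1 H2] HS.
  have [Ee Ec] := eval_shift H1 HS.
  by exists S => //; rewrite -Ec; apply: ExecWhileFalse; rewrite Ee.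
Qed.

Lemma tree_size_gt0 t : 0 < tree_size t. Proof. by case: t. Qed.

Lemma size_eval s e : tree_size (eval s e) <= cost s e.
Proof.
elim: e => //= [e1 IH1 e2 IH2|e1 IH1|e1 IH1]; first by rewrite ltnS leq_add.
all: by case: (eval s e1) IH1 => //= l r; lia.
Qed.

Lemma size_exec p s s' t : exec p s s' t -> forall x, tree_size (s' x) <= tree_size (s x) + t.
Proof.
elim=> {p s s' t} //.
- move=> s x e y; rewrite /update; case: eqP => [_|_]; last by lia.
  by have := size_eval s e; lia.
- by move=> s s1 s2 p q t1 t2 _ IH1 _ IH2 x; have := IH1 x; have := IH2 x; lia.
- by move=> s s1 e p q t1 _ _ IH x; have := IH x; lia.
- by move=> s s1 e p q t1 _ _ IH x; have := IH x; lia.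
- by move=> s s1 s2 e p t1 t2 _ _ IH1 _ IH2 x; have := IH1 x; have := IH2 x; lia.
- by move=> s e p _ x; lia.
Qed.

(** * Total-correctness triples with time bounds *)

Definition spec (p : cmd) (S : store) (Q : store -> Prop) (B : nat) : Prop :=
  exists S' t, [/\ exec p S S' t, Q S' & t <= B].

Lemma spec_weaken p S (Q Q' : store -> Prop) B B' :
  spec p S Q B -> (forall S', Q S' -> Q' S') -> B <= B' -> spec p S Q' B'.
Proof. by move=> [S' [t [X HQ Ht]]] HQQ HB; exists S', t; split; eauto; lia. Qed.

Lemma spec_le p S (Q : store -> Prop) B B' :
  spec p S Q B -> B <= B' -> spec p S Q B'.
Proof. by move=> H; apply: spec_weaken H _. Qed.

Lemma spec_assign x e S (Q : store -> Prop) :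
  Q (update S x (eval S e)) -> spec (Assign x e) S Q (cost S e).+1.
Proof. by move=> HQ; do 2!eexists; split; [constructor|exact: HQ|]. Qed.

Lemma spec_seq p q S (Q1 Q2 : store -> Prop) B1 B2 :
  spec p S Q1 B1 -> (forall S1, Q1 S1 -> spec q S1 Q2 B2) ->
  spec (Seq p q) S Q2 (B1 + B2).+1.
Proof.
move=> [S1 [t1 [X1 H1 L1]]] /(_ _ H1) [S2 [t2 [X2 H2 L2]]].
by exists S2, (t1 + t2).+1; split=> //; [econstructor; eauto|lia].
Qed.

Lemma spec_if e p q S (Q : store -> Prop) B :
  (truthy (eval S e) -> spec p S Q B) -> (~~ truthy (eval S e) -> spec q S Q B) ->
  spec (If e p q) S Q (cost S e + B).+1.
Proof.
move=> Hp Hq; case: (boolP (truthy (eval S e))) => He.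
  have [S1 [t1 [X1 H1 L1]]] := Hp He.
  by exists S1, (cost S e + t1).+1; split=> //; [constructor|lia].
have [S1 [t1 [X1 H1 L1]]] := Hq He.
by exists S1, (cost S e + t1).+1; split=> //; [apply: ExecIfFalse|lia].
Qed.

(* A called program uses the variables from [k] on; its input is in [k], and all
   the others must be reset to [Leaf] first. *)
Fixpoint clear (k n : nat) : cmd :=
  if n is n'.+1 then Seq (clear k n') (Assign (k + n) Nil) else Assign k.+1 Nil.

Lemma spec_clear k n S :
  spec (clear k n) S (fun S' => (forall j, j <= k -> S' j = S j) /\
    (forall i, 0 < i <= n -> S' (k + i) = Leaf)) (3 * n + 2).
Proof.
elim: n => [|n IH] /=.
  apply: (@spec_le _ _ _ 2); last by lia.
  apply: (@spec_assign _ Nil) => /=; split=> [j Hj|i Hi]; last by lia.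
  by rewrite /update; case: eqP => // E; lia.
apply: (@spec_le _ _ _ (3 * n + 2 + 2).+1); last by lia.
apply: spec_seq IH _ => S1 [A B].
apply: (@spec_assign _ Nil) => /=; split=> [j Hj|i Hi]; rewrite /update.
  by case: eqP => [E|_]; [move: Hj; rewrite E; lia|exact: A].
by case: eqP => // Hne; apply: B; lia.
Qed.

Definition callc k p := Seq (clear k (cvars p)) (cshift k p).

Lemma spec_call k p (S : store) x y B :
  spec p (init x) (fun S' => S' 0 = y) B -> S k = x ->
  spec (callc k p) S (fun S' => S' k = y /\ forall j, j < k -> S' j = S j)
    (B + (3 * cvars p + 3)).
Proof.
move=> [s' [t [X H0 Ht]]] HS.
apply: (@spec_le _ _ _ (3 * cvars p + 2 + B).+1); last by lia.
apply: spec_seq (spec_clear _ _ _) _ => S1 [A C].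
(* One variable more than [cvars p], so that the result variable [0] certainly lies in the
   window. *)
have HI : forall i, i < (cvars p).+1 -> S1 (k + i) = init x i.
  case=> [|i] Hi; first by rewrite addn0 A // HS.
  by rewrite C.
have [S2 X2 [A2 C2]] := exec_shift X (leqnSn _) HI.
exists S2, t; split=> //; split=> [|j Hj]; first by rewrite -[k in S2 k]addn0 A2.
by rewrite C2 // A //; lia.
Qed.

Lemma spec_while_true e p S Q1 (Q2 : store -> Prop) B1 B2 :
  truthy (eval S e) -> spec p S Q1 B1 ->
  (forall S1, Q1 S1 -> spec (While e p) S1 Q2 B2) ->
  spec (While e p) S Q2 (cost S e + B1 + B2).+1.
Proof.
move=> He [S1 [t1 [X1 H1 L1]]] /(_ _ H1) [S2 [t2 [X2 H2 L2]]].
by exists S2, (cost S e + t1 + t2).+1; split=> //; [econstructor; eauto|lia].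
Qed.

Lemma spec_while_false e p S (Q : store -> Prop) :
  ~~ truthy (eval S e) -> Q S -> spec (While e p) S Q (cost S e).+1.
Proof. by move=> He HQ; do 2!eexists; split; [exact: ExecWhileFalse|exact: HQ|]. Qed.

(** * Functions computable in polynomial time *)

Class coded (T : Type) := code : T -> tree.

#[global] Instance coded_nat : coded nat := enc_nat.
#[global] Instance coded_unit : coded unit := fun _ => Leaf.
#[global] Instance coded_bool : coded bool :=
  fun b => if b then Node Leaf Leaf else Leaf.
#[global] Instance coded_pair T U {cT : coded T} {cU : coded U} : coded (T * U) :=
  fun p => Node (code p.1) (code p.2).
#[global] Instance coded_seq T {cT : coded T} : coded (seq T) := enc_seq code.

Definition sz {T} {cT : coded T} (x : T) : nat := tree_size (code x).

Lemma sz_gt0 T {cT : coded T} (x : T) : 0 < sz x.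
Proof. exact: tree_size_gt0. Qed.

(** One constant serves as factor and exponent; since sizes are positive, two different ones can be
    merged ([pb_mono]). *)
Definition pbounded {T} {cT : coded T} (h : T -> nat) : Prop :=
  exists c, forall x, h x <= c * sz x ^ c.

Section Bounds.
Context {T : Type} {cT : coded T}.
Implicit Types h : T -> nat.

Lemma pb_mono h c e : (forall x, h x <= c * sz x ^ e) -> pbounded h.
Proof.
move=> H; exists (c + e) => x; apply: leq_trans (H x) _.
by rewrite leq_mul ?leq_addr // leq_pexp2l ?leq_addl // sz_gt0.
Qed.

Lemma pb_le h h' : (forall x, h x <= h' x) -> pbounded h' -> pbounded h.
Proof. by move=> H [c Hc]; exists c => x; apply: leq_trans (H x) _. Qed.

Lemma pb_const n : pbounded (fun _ => n).
Proof. by apply: (@pb_mono _ n 0) => x; rewrite expn0 muln1. Qed.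

Lemma pb_sz : pbounded (@sz T _).
Proof. by exists 1 => x; rewrite mul1n expn1. Qed.

Lemma pb_add h1 h2 : pbounded h1 -> pbounded h2 -> pbounded (fun x => h1 x + h2 x).
Proof.
move=> [c1 H1] [c2 H2]; exists (c1 + c2) => x; rewrite mulnDl.
by apply: leq_add; [apply: leq_trans (H1 x) _|apply: leq_trans (H2 x) _];
   rewrite leq_mul // leq_pexp2l ?sz_gt0 ?leq_addl ?leq_addr.
Qed.

Lemma pb_mul h1 h2 : pbounded h1 -> pbounded h2 -> pbounded (fun x => h1 x * h2 x).
Proof.
move=> [c1 H1] [c2 H2]; apply: (@pb_mono _ (c1 * c2) (c1 + c2)) => x.
by rewrite expnD mulnACA leq_mul.
Qed.

Lemma pb_exp h n : pbounded h -> pbounded (fun x => h x ^ n).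
Proof.
move=> H; elim: n => [|n IH]; first exact: pb_const.
by apply: pb_le (pb_mul H IH) => x; rewrite expnS.
Qed.

Lemma pb_succ h : pbounded h -> pbounded (fun x => (h x).+1).
Proof. by move=> H; apply: pb_le (pb_add H (pb_const 1)) => x; rewrite addn1. Qed.

End Bounds.

Lemma pb_comp T U {cT : coded T} {cU : coded U} (h : U -> nat) (f : T -> U) :
  pbounded h -> pbounded (fun x => sz (f x)) -> pbounded (fun x => h (f x)).
Proof.
move=> [c Hc] Hf; apply: pb_le (pb_mul (pb_const c) (pb_exp c Hf)) => x.
exact: Hc.
Qed.

Definition polyf {T U} {cT : coded T} {cU : coded U} (f : T -> U) : Prop :=
  exists p h, pbounded h /\
    forall x, spec p (init (code x)) (fun S => S 0 = code (f x)) (h x).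

Section Combinators.
Context {T : Type} {cT : coded T}.

Lemma polyf_ext U {cU : coded U} (f g : T -> U) :
  (forall x, f x = g x) -> polyf f -> polyf g.
Proof. by move=> H [p [h [Hh Hp]]]; exists p, h; split=> // x; rewrite -H. Qed.

Lemma polyf_sz U {cU : coded U} (f : T -> U) : polyf f -> pbounded (fun x => sz (f x)).
Proof.
move=> [p [h [Hh Hp]]]; apply: pb_le (pb_add pb_sz Hh) => x.
have [S [t [X E Ht]]] := Hp x.
have := size_exec X 0; rewrite E /sz /init /=; lia.
Qed.

End Combinators.

Ltac pb := repeat first [exact: pb_const | exact: pb_sz | assumption
  | apply: pb_succ | apply: pb_add | apply: pb_mul | apply: pb_exp
  | apply: polyf_sz].

Section Programs.
Context {T : Type} {cT : coded T}.

Lemma polyf_cast U {cU : coded U} (f : T -> U) :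
  (forall x, code (f x) = code x) -> polyf f.
Proof.
move=> H; exists (Assign 0 (Var 0)), (fun x => (sz x).+1).
split; first exact: pb_succ pb_sz.
by move=> x; apply: (@spec_assign 0 (Var 0)); rewrite /update /= H.
Qed.

Lemma polyf_comp U V {cU : coded U} {cV : coded V} (g : U -> V) (f : T -> U) :
  polyf g -> polyf f -> polyf (fun x => g (f x)).
Proof.
move=> [q [k [Hk Hq]]] Pf; have [p [h [Hh Hp]]] := Pf.
exists (Seq (callc 0 p) (callc 0 q)).
exists (fun x => (h x + (3 * cvars p + 3) + (k (f x) + (3 * cvars q + 3))).+1).
split.
  apply/pb_succ/pb_add; apply: pb_add (pb_const _) => //.
  exact: pb_comp Hk (polyf_sz Pf).
move=> x; apply: spec_seq; first exact: spec_call (Hp x) _.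
move=> S1 [H0 _]; apply: spec_weaken (spec_call (Hq _) H0) _ _ => //.
by move=> S2 [].
Qed.

Lemma polyf_pair U V {cU : coded U} {cV : coded V} (f : T -> U) (g : T -> V) :
  polyf f -> polyf g -> polyf (fun x => (f x, g x)).
Proof.
move=> Pf Pg; have [p [h [Hh Hp]]] := Pf; have [q [k [Hk Hq]]] := Pg.
(* A call at offset [k] destroys its own window but respects the variables below [k]: the input
   survives in [0], the first result in [1]. *)
exists (Seq (Assign 1 (Var 0)) (Seq (callc 1 p)
       (Seq (Assign 2 (Var 0)) (Seq (callc 2 q) (Assign 0 (Cons (Var 1) (Var 2))))))).
exists (fun x => ((sz x).+1 + ((h x + (3 * cvars p + 3)) + ((sz x).+1 +
   ((k x + (3 * cvars q + 3)) + (sz (f x) + sz (g x)).+2).+1).+1).+1).+1).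
split.
  by pb.
move=> x.
apply: spec_seq; first apply: (@spec_assign 1 (Var 0) _
  (fun S => S 0 = code x /\ S 1 = code x)) => //.
move=> S1 [A1 B1]; apply: spec_seq; first exact: spec_call (Hp x) B1.
move=> S2 [A2 B2]; apply: (@spec_seq _ _ _ (fun S => [/\ S 0 = code x, S 1 = code (f x) & S 2 = code x])).
  apply: (@spec_le _ _ _ (cost S2 (Var 0)).+1); last by rewrite /= B2 // A1.
  by apply: spec_assign; rewrite /update /= B2 // A1.
move=> S3 [A3 B3 C3]; apply: spec_seq; first exact: spec_call (Hq x) C3.
move=> S4 [A4 B4].
apply: (@spec_le _ _ _ (cost S4 (Cons (Var 1) (Var 2))).+1); last first.
  by rewrite /= A4 B4 // B3.
by apply: spec_assign; rewrite /update /= A4 B4 // B3.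
Qed.

Lemma polyf_if U {cU : coded U} (b : T -> bool) (f g : T -> U) :
  polyf b -> polyf f -> polyf g -> polyf (fun x => if b x then f x else g x).
Proof.
move=> Pb Pf Pg; have [r [l [Hl Hr]]] := Pb.
have [p [h [Hh Hp]]] := Pf; have [q [k [Hk Hq]]] := Pg.
exists (Seq (Assign 1 (Var 0)) (Seq (callc 1 r) (If (Var 1) (callc 0 p) (callc 0 q)))).
exists (fun x => ((sz x).+1 + ((l x + (3 * cvars r + 3)) +
   (sz (b x) + ((h x + (3 * cvars p + 3)) + (k x + (3 * cvars q + 3)))).+1).+1).+1).
split.
  by pb.
move=> x.
apply: spec_seq; first apply: (@spec_assign 1 (Var 0) _
  (fun S => S 0 = code x /\ S 1 = code x)) => //.
move=> S1 [A1 B1]; apply: spec_seq; first exact: spec_call (Hr x) B1.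
move=> S2 [A2 B2].
apply: (@spec_le _ _ _ (cost S2 (Var 1) +
  ((h x + (3 * cvars p + 3)) + (k x + (3 * cvars q + 3)))).+1); last by rewrite /= A2.
apply: spec_if; rewrite /= A2.
  case: (b x) => // _; apply: spec_weaken (spec_call (Hp x) _) _ _.
  - by rewrite B2.
  - by move=> S3 [].
  - by lia.
case: (b x) => // _; apply: spec_weaken (spec_call (Hq x) _) _ _.
- by rewrite B2.
- by move=> S3 [].
- by lia.
Qed.

End Programs.

Section Fold.
Context {G A S : Type} {cG : coded G} {cA : coded A} {cS : coded S}.
Variables (l : G -> seq A) (s0 : G -> S) (st : G -> A -> S -> S).

Lemma sz_cons (a : A) m : sz (a :: m) = (sz a + sz m).+1.
Proof. by []. Qed.

Lemma size_le_sz (m : seq A) : size m <= sz m.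
Proof. by elim: m => // a m IH; rewrite sz_cons /=; lia. Qed.

(** Iterating a polynomial-time step could square the accumulator each time; hence the hypothesis
    that all intermediate accumulators are polynomially bounded in [x]. *)
Lemma polyf_foldl :
  polyf l -> polyf s0 -> polyf (fun p : G * A * S => st p.1.1 p.1.2 p.2) ->
  (exists2 h, pbounded h & forall x i,
     sz (foldl (fun s a => st x a s) (s0 x) (take i (l x))) <= h x) ->
  polyf (fun x => foldl (fun s a => st x a s) (s0 x) (l x)).
Proof.
move=> Pl Ps [r [k [[c Hk] Hr]]] [h Hh Bh].
have [pl [hl [Hhl Hl]]] := Pl; have [ps [hs [Hhs Hs]]] := Ps.
(* Variable [0] holds [x], [1] the remaining list, [2] the accumulator, and [3] first the argument
   and then the result of the step. *)
set body := Seq (Assign 3 (Cons (Cons (Var 0) (Hd (Var 1))) (Var 2)))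
  (Seq (callc 3 r) (Seq (Assign 2 (Var 3)) (Assign 1 (Tl (Var 1))))).
(* [K x] bounds the body of the loop at every position of the list, [W x] the whole loop. *)
pose (K := fun x : G => ((sz x + sz (l x) + h x + 4) + (((c * (sz x + sz (l x) + h x + 2) ^ c
   + (3 * cvars r + 3)) + ((h x).+1 + (sz (l x)).+2).+1)).+1).+1).
pose (W := fun x : G => size (l x) * (sz (l x) + K x).+1 + (sz (l x)).+1).
exists (Seq (Assign 1 (Var 0)) (Seq (callc 1 pl) (Seq (Assign 2 (Var 0))
  (Seq (callc 2 ps) (Seq (While (Var 1) body) (Assign 0 (Var 2))))))).
exists (fun x => ((sz x).+1 + ((hl x + (3 * cvars pl + 3)) + ((sz x).+1 +
   ((hs x + (3 * cvars ps + 3)) + (W x + (h x).+1).+1).+1).+1).+1).+1).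
have PW : pbounded W.
  apply: pb_add; last by apply/pb_succ/polyf_sz.
  apply: pb_mul.
    by apply: pb_le (polyf_sz Pl) => x; apply: size_le_sz.
  by rewrite /K; pb.
split.
  by pb.
move=> x.
apply: spec_seq; first apply: (@spec_assign 1 (Var 0) _
  (fun S => S 0 = code x /\ S 1 = code x)) => //.
move=> S1 [A1 B1]; apply: spec_seq; first exact: spec_call (Hl x) B1.
move=> S2 [A2 B2]; apply: (@spec_seq _ _ _ (fun S => [/\ S 0 = code x, S 1 = code (l x) & S 2 = code x])).
  apply: (@spec_le _ _ _ (cost S2 (Var 0)).+1); last by rewrite /= B2 // A1.
  by apply: spec_assign; rewrite /update /= B2 // A1.
move=> S3 [A3 B3 C3]; apply: spec_seq; first exact: spec_call (Hs x) C3.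
move=> S4 [A4 B4].
apply: (@spec_seq _ _ _ (fun S' => S' 2 = code (foldl (fun s a => st x a s) (s0 x) (l x))));
  last first.
  move=> S5 E5; apply: (@spec_le _ _ _ (cost S5 (Var 2)).+1).
    by apply: spec_assign; rewrite /update /= E5.
  by rewrite /= E5 ltnS; have := Bh x (size (l x)); rewrite take_size.
have E0 : S4 0 = code x by rewrite B4.
have E1 : S4 1 = code (l x) by rewrite B4 // B3.
have Hbd := Bh x; rewrite /W; have [Kx EK'] : exists y, y = K x by exists (K x).
rewrite -EK'; move: EK'; rewrite /K; set Lm := sz (l x) => EK.
(* The bound per iteration refers to the full list, so its size is frozen as [Lm] before the
   induction shortens the list. *)
have : sz (l x) <= Lm by [].
move: E1 A4 Hbd; move: (l x) (s0 x) S4 E0 {B4}; clear -Hr Hk EK.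
elim=> [|a m IH] s S4 E0 E1 E2 Hbd HL /=.
  apply: (@spec_le _ _ _ (cost S4 (Var 1)).+1); last by rewrite /= E1 mul0n add0n ltnS.
  by apply: spec_while_false; rewrite ?E2 //= E1.
rewrite sz_cons in HL.
apply: (@spec_le _ _ _ (cost S4 (Var 1) + Kx + (size m * (Lm + Kx).+1 + Lm.+1)).+1); last first.
  rewrite /= E1 mulSn -/(sz (a :: m)) sz_cons; lia.
apply: (@spec_while_true _ _ _ (fun S' => [/\ S' 0 = code x, S' 1 = code m & S' 2 = code (st x a s)])).
- by rewrite /= E1.
  have Hs := Hbd 0; rewrite /= in Hs.
  have Hs1 := Hbd 1; rewrite /= take0 in Hs1.
  rewrite EK.
  apply: (@spec_seq _ _ _ (fun S' => [/\ S' 0 = code x, S' 1 = code (a :: m) & S' 3 = code (x, a, s)])).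
    apply: (@spec_le _ _ _ (cost S4 (Cons (Cons (Var 0) (Hd (Var 1))) (Var 2))).+1).
      by apply: spec_assign; rewrite /update /= E0 E1 E2.
    rewrite /= E0 E1 E2 -!/(sz _) sz_cons; lia.
  move=> S5 [A5 B5 C5]; apply: spec_seq.
    apply: (@spec_le _ _ _ (k (x, a, s) + (3 * cvars r + 3))).
      exact: spec_call (Hr (x, a, s)) C5.
    rewrite leq_add2r; apply: leq_trans (Hk _) _.
    rewrite leq_mul2l; apply/orP; right; case: (c) => [|c'] //.
    rewrite leq_exp2r //.
    have -> : sz (x, a, s) = (sz x + sz a + sz s).+2 by rewrite /sz /=; lia.
    by lia.
  move=> S6 [A6 B6].
  apply: (@spec_seq _ _ _ (fun S' => [/\ S' 0 = code x, S' 1 = code (a :: m) & S' 2 = code (st x a s)])).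
    apply: (@spec_le _ _ _ (cost S6 (Var 3)).+1).
      by apply: spec_assign; rewrite /update /= A6 !B6.
    by rewrite /= A6 ltnS; exact: Hs1.
  move=> S7 [A7 B7 C7].
  apply: (@spec_le _ _ _ (cost S7 (Tl (Var 1))).+1).
    by apply: spec_assign; rewrite /update /= A7 B7 C7.
  by rewrite /= B7 -/(sz (a :: m)) sz_cons; lia.
- move=> S5 [A5 B5 C5]; apply: IH => //; last by lia.
  by move=> i; have := Hbd i.+1.
Qed.

End Fold.

Fixpoint esize (e : expr) : nat :=
  match e with
  | Var _ | Nil => 1
  | Cons e1 e2 => (esize e1 + esize e2).+1
  | Hd e1 | Tl e1 => (esize e1).+1
  end.

Lemma cost_init e t : cost (init t) e <= esize e * (tree_size t).+1.
Proof.
elim: e => [x| |e1 IH1 e2 IH2|e1 IH1|e1 IH1] /=; try lia.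
by rewrite /init; case: eqP => _ /=; lia.
Qed.

Fixpoint tree_expr (t : tree) : expr :=
  if t is Node l r then Cons (tree_expr l) (tree_expr r) else Nil.

Lemma eval_tree_expr s t : eval s (tree_expr t) = t.
Proof. by elim: t => //= l -> r ->. Qed.

Section Basic.
Context {T : Type} {cT : coded T}.

Lemma polyf_expr U {cU : coded U} (f : T -> U) e :
  (forall x, eval (init (code x)) e = code (f x)) -> polyf f.
Proof.
move=> H; exists (Assign 0 e), (fun x => (esize e * (sz x).+1).+1); split; first by pb.
move=> x; apply: spec_le; first by apply: (@spec_assign 0 e _ (fun S => S 0 = code (f x)));
  rewrite /update /= H.
by rewrite ltnS cost_init.
Qed.

Lemma polyf_id : polyf (fun x : T => x).
Proof. exact: (polyf_expr (e := (Var 0))). Qed.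

Lemma polyf_const U {cU : coded U} (u : U) : polyf (fun _ : T => u).
Proof. by apply: (polyf_expr (e := (tree_expr (code u)))) => x; rewrite eval_tree_expr. Qed.

Lemma polyf_castc U V {cU : coded U} {cV : coded V} (h : U -> V) (f : T -> U) :
  (forall u, code (h u) = code u) -> polyf f -> polyf (fun x => h (f x)).
Proof. by move=> H; apply: polyf_comp; apply: polyf_cast. Qed.

End Basic.

Section Basic2.
Context {T : Type} {cT : coded T} {U V : Type} {cU : coded U} {cV : coded V}.

Lemma polyf_fst (f : T -> U * V) : polyf f -> polyf (fun x => (f x).1).
Proof. by apply: (polyf_comp (g := fst)); apply: (polyf_expr (e := Hd (Var 0))). Qed.

Lemma polyf_snd (f : T -> U * V) : polyf f -> polyf (fun x => (f x).2).
Proof. by apply: (polyf_comp (g := snd)); apply: (polyf_expr (e := (Tl (Var 0)))). Qed.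

Lemma polyf_cons (f : T -> U) (g : T -> seq U) :
  polyf f -> polyf g -> polyf (fun x => f x :: g x).
Proof.
move=> Pf Pg.
apply: (polyf_comp (g := fun p : U * seq U => p.1 :: p.2) (f := fun x => (f x, g x))).
  exact: polyf_cast.
exact: polyf_pair.
Qed.

Lemma polyf_S (f : T -> nat) : polyf f -> polyf (fun x => (f x).+1).
Proof.
apply: (polyf_comp (g := S)).
exact: (polyf_expr (e := (Cons Nil (Var 0)))).
Qed.

Lemma polyf_behead (f : T -> seq U) : polyf f -> polyf (fun x => behead (f x)).
Proof.
by apply: (polyf_comp (g := behead)); apply: (polyf_expr (e := (Tl (Var 0)))); case.
Qed.

(** The head of the empty tree is [Leaf], so the default value has to be encoded by it; [0], [false]
    and the empty list are. *)
Lemma polyf_head u0 (f : T -> seq U) : code u0 = Leaf ->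
  polyf f -> polyf (fun x => head u0 (f x)).
Proof.
move=> H0; apply: (polyf_comp (g := head u0)).
by apply: (polyf_expr (e := (Hd (Var 0)))); case=> //=; rewrite H0.
Qed.

Lemma polyf_nilp (f : T -> seq U) : polyf f -> polyf (fun x => nilp (f x)).
Proof.
apply: (polyf_comp (g := @nilp U)).
exists (If (Var 0) (Assign 0 Nil) (Assign 0 (Cons Nil Nil))), (fun x => (sz x + 4).+1).
split=> [|x]; first by pb.
apply: (@spec_le _ _ _ (cost (init (code x)) (Var 0) + 4).+1) => //.
apply: spec_if; case: x => [|u l] //= _.
  by apply: (@spec_le _ _ _ 2) => //; apply: (@spec_assign _ Nil).
by apply: (@spec_le _ _ _ 4) => //; apply: (@spec_assign _ (Cons Nil Nil)).
Qed.

Lemma polyf_pred (f : T -> nat) : polyf f -> polyf (fun x => (f x).-1).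
Proof.
by apply: (polyf_comp (g := predn)); apply: (polyf_expr (e := (Tl (Var 0)))); case.
Qed.

Lemma polyf_negb (f : T -> bool) : polyf f -> polyf (fun x => ~~ f x).
Proof.
move=> Pf; apply: polyf_ext (polyf_if Pf (polyf_const false) (polyf_const true)).
by move=> x; case: (f x).
Qed.

Lemma polyf_andb (f g : T -> bool) : polyf f -> polyf g -> polyf (fun x => f x && g x).
Proof.
move=> Pf Pg; apply: polyf_ext (polyf_if Pf Pg (polyf_const false)).
by move=> x; case: (f x).
Qed.

Lemma polyf_orb (f g : T -> bool) : polyf f -> polyf g -> polyf (fun x => f x || g x).
Proof.
move=> Pf Pg; apply: polyf_ext (polyf_if Pf (polyf_const true) Pg).
by move=> x; case: (f x).
Qed.

Lemma polyf_eqb (f g : T -> bool) : polyf f -> polyf g -> polyf (fun x => f x == g x).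
Proof.
move=> Pf Pg; apply: polyf_ext (polyf_if Pf Pg (polyf_negb Pg)).
by move=> x; case: (f x); case: (g x).
Qed.

End Basic2.

Lemma sz_pair T U {cT : coded T} {cU : coded U} (x : T) (y : U) :
  sz (x, y) = (sz x + sz y).+1.
Proof. by []. Qed.

Lemma sz_take A {cA : coded A} i (m : seq A) : sz (take i m) <= sz m.
Proof.
elim: m i => [|a m IH] [|i]; rewrite ?take0 /= ?sz_cons //.
by rewrite ltnS leq_add2l.
Qed.

Section Folds.
Context {G A S : Type} {cG : coded G} {cA : coded A} {cS : coded S}.
Variables (l : G -> seq A) (s0 : G -> S) (st : G -> A -> S -> S).

(** The increment [h] does not see the accumulator, so the increments only add up and the growth
    condition of [polyf_foldl] follows. *)
Lemma polyf_foldl_incr (h : G * A -> nat) :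
  polyf l -> polyf s0 -> polyf (fun p : G * A * S => st p.1.1 p.1.2 p.2) ->
  pbounded h -> (forall x a s, sz (st x a s) <= sz s + h (x, a)) ->
  polyf (fun x => foldl (fun s a => st x a s) (s0 x) (l x)).
Proof.
move=> Pl Ps Pst [c Hh] Hst; apply: polyf_foldl => //.
exists (fun x => sz (s0 x) + sz (l x) * (c * (sz x + sz (l x)).+1 ^ c)).
  by pb.
move=> x i; set K := _ ^ c.
have H : forall m s, sz m <= sz (l x) ->
    sz (foldl (fun s a => st x a s) s m) <= sz s + size m * (c * K); last first.
  have Ht : sz (take i (l x)) <= sz (l x) by apply: sz_take.
  apply: leq_trans (H _ _ Ht) _.
  by rewrite leq_add2l leq_mul // (leq_trans (size_le_sz _) Ht).
elim=> [|a m IH] s Hm /=; first by rewrite addn0.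
rewrite sz_cons in Hm.
apply: leq_trans (IH _ _) _; first by lia.
rewrite mulSn addnA leq_add2r; apply: leq_trans (Hst _ _ _) _.
rewrite leq_add2l; apply: leq_trans (Hh _) _.
rewrite leq_mul2l; apply/orP; right; rewrite /K.
case: (c) => // c'; rewrite leq_exp2r // sz_pair; lia.
Qed.

End Folds.

(** * List operations *)

Lemma foldl_consE A B (f : A -> B) l acc :
  foldl (fun s a => f a :: s) acc l = catrev (map f l) acc.
Proof. by elim: l acc => //= a l IH acc; rewrite IH. Qed.

Section Lists.
Context {T : Type} {cT : coded T} {A B : Type} {cA : coded A} {cB : coded B}.

Lemma polyf_catrev (f g : T -> seq A) :
  polyf f -> polyf g -> polyf (fun x => catrev (f x) (g x)).
Proof.
move=> Pf Pg.
apply: (@polyf_ext _ _ _ _ (fun x => foldl (fun s a => a :: s) (g x) (f x))).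
  by move=> x; rewrite (foldl_consE id) map_id.
apply: (@polyf_foldl_incr _ _ _ _ _ _ _ _ (fun _ a s => a :: s) (fun p => (sz p.2).+1)) => //.
- apply: polyf_cons; first by apply/polyf_snd/polyf_fst/polyf_id.
  by apply/polyf_snd/polyf_id.
- by apply/pb_succ/polyf_sz/polyf_snd/polyf_id.
- by move=> x a s; rewrite sz_cons /=; lia.
Qed.

Lemma polyf_rev (f : T -> seq A) : polyf f -> polyf (fun x => rev (f x)).
Proof. by move=> Pf; apply: polyf_catrev (polyf_const _). Qed.

End Lists.

Section Lists2.
Context {T : Type} {cT : coded T} {A B : Type} {cA : coded A} {cB : coded B}.

Lemma polyf_cat (f g : T -> seq A) :
  polyf f -> polyf g -> polyf (fun x => f x ++ g x).
Proof.
move=> Pf Pg; apply: (@polyf_ext _ _ _ _ (fun x => catrev (rev (f x)) (g x))).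
  by move=> x; rewrite catrevE revK.
exact/polyf_catrev/Pg/polyf_rev.
Qed.

Lemma polyf_map (f : T -> seq A) (h : T -> A -> B) :
  polyf f -> polyf (fun p : T * A => h p.1 p.2) ->
  polyf (fun x => map (h x) (f x)).
Proof.
move=> Pf Ph.
apply: (@polyf_ext _ _ _ _ (fun x => rev (foldl (fun s a => h x a :: s) [::] (f x)))).
  by move=> x; rewrite foldl_consE catrevE cats0 revK.
apply: polyf_rev.
apply: (@polyf_foldl_incr _ _ _ _ _ _ _ _ (fun x a s => h x a :: s) (fun p => (sz (h p.1 p.2)).+1)) => //.
- exact: polyf_const.
- apply: polyf_cons; last by apply/polyf_snd/polyf_id.
  by apply: (polyf_comp Ph); apply/polyf_fst/polyf_id.
- by apply/pb_succ/polyf_sz.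
- by move=> x a s; rewrite sz_cons /=; lia.
Qed.

Lemma sz_catrev (l m : seq A) : (sz (catrev l m)).+1 = sz l + sz m.
Proof.
elim: l m => [|a l IH] m //=; rewrite IH !sz_cons; lia.
Qed.

Lemma polyf_flatten (f : T -> seq (seq A)) :
  polyf f -> polyf (fun x => flatten (f x)).
Proof.
move=> Pf.
apply: (@polyf_ext _ _ _ _ (fun x => rev (foldl (fun s l => catrev l s) [::] (f x)))).
  move=> x; suff H : forall (l : seq (seq A)) s, foldl (fun s l => catrev l s) s l = catrev (flatten l) s.
    by rewrite H catrevE cats0 revK.
  by elim=> //= a l IH s; rewrite IH !catrevE rev_cat catA.
apply: polyf_rev.
apply: (@polyf_foldl_incr _ _ _ _ _ _ _ _ (fun _ l s => catrev l s) (fun p => (sz p.2))) => //.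
- exact: polyf_const.
- apply: polyf_catrev; first by apply/polyf_snd/polyf_fst/polyf_id.
  by apply/polyf_snd/polyf_id.
- by apply/polyf_sz/polyf_snd/polyf_id.
- by move=> x a s /=; have := sz_catrev a s; lia.
Qed.

End Lists2.

(** A unary number and a list of that many units are the same tree; through this, list programs
    become arithmetic. *)
Lemma code_nseq n : code (nseq n tt) = code n.
Proof. by elim: n => //= n IH; congr Node; exact: IH. Qed.

Lemma sz_nat (n : nat) : sz n = n.+1 + n.
Proof. elim: n => // n IH; have -> : sz n.+1 = (sz n).+2 by []. rewrite IH; lia. Qed.

Lemma polyf_units T {cT : coded T} (f : T -> nat) : polyf f -> polyf (fun x => nseq (f x) tt).
Proof. exact/polyf_castc/code_nseq. Qed.

Lemma polyf_size T {cT : coded T} A {cA : coded A} (l : T -> seq A) :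
  polyf l -> polyf (fun x => size (l x)).
Proof.
move=> Pl; apply: (@polyf_ext _ _ _ _ (fun x => size [seq tt | a <- l x])).
  by move=> x; rewrite size_map.
apply: (polyf_castc (h := @size unit));
  last by apply: (polyf_map (h := fun _ _ => tt)) Pl (polyf_const _).
by elim=> //= -[] u IH; congr Node; exact: IH.
Qed.

Lemma polyf_addn T {cT : coded T} (f g : T -> nat) :
  polyf f -> polyf g -> polyf (fun x => f x + g x).
Proof.
move=> Pf Pg; apply: polyf_ext (polyf_size (polyf_cat (polyf_units Pf) (polyf_units Pg))).
by move=> x; rewrite size_cat !size_nseq.
Qed.

Lemma polyf_sumn T {cT : coded T} (l : T -> seq nat) : polyf l -> polyf (fun x => sumn (l x)).
Proof.
move=> Pl.
have P1 : polyf (fun x => [seq nseq a tt | a <- l x]).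
  by apply: polyf_map => //; apply/polyf_units/polyf_snd/polyf_id.
apply: polyf_ext (polyf_size (polyf_flatten P1)) => x.
by rewrite size_flatten /shape -map_comp; congr sumn; rewrite -[RHS]map_id;
   apply: eq_map => n /=; rewrite size_nseq.
Qed.

Lemma polyf_muln T {cT : coded T} (f g : T -> nat) :
  polyf f -> polyf g -> polyf (fun x => f x * g x).
Proof.
move=> Pf Pg.
have P1 : polyf (fun x => [seq g x | _ <- nseq (f x) tt]).
  apply: polyf_map; first exact: polyf_units.
  by apply: (polyf_comp Pg); apply/polyf_fst/polyf_id.
apply: polyf_ext (polyf_sumn P1) => x.
by elim: (f x) => //= n ->; rewrite mulSn.
Qed.

Lemma polyf_foldl_shrink T {cT : coded T} A S {cA : coded A} {cS : coded S} (l : T -> seq A)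
  (s0 : T -> S) (st : T -> A -> S -> S) :
  polyf l -> polyf s0 -> polyf (fun p : T * A * S => st p.1.1 p.1.2 p.2) ->
  (forall x a s, sz (st x a s) <= sz s) ->
  polyf (fun x => foldl (fun s a => st x a s) (s0 x) (l x)).
Proof.
move=> Pl Ps Pst H; apply: (polyf_foldl_incr (h := fun _ => 0)) => //.
  exact: pb_const.
by move=> x a s; rewrite addn0.
Qed.

Lemma polyf_subn T {cT : coded T} (f g : T -> nat) :
  polyf f -> polyf g -> polyf (fun x => f x - g x).
Proof.
move=> Pf Pg.
apply: (@polyf_ext _ _ _ _ (fun x => foldl (fun s _ => s.-1) (f x) (nseq (g x) tt))).
  move=> x; elim: (g x) (f x) => [|n IH] m /=; first by rewrite subn0.
  by rewrite IH; lia.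
apply: (polyf_foldl_shrink (st := fun _ _ s => s.-1)) => //.
- exact: polyf_units.
- exact/polyf_pred/polyf_snd/polyf_id.
- by move=> _ _ s; rewrite !sz_nat; lia.
Qed.

Lemma polyf_leq T {cT : coded T} (f g : T -> nat) :
  polyf f -> polyf g -> polyf (fun x => f x <= g x).
Proof.
move=> Pf Pg; apply: polyf_ext (polyf_nilp (polyf_units (polyf_subn Pf Pg))).
by move=> x; rewrite /nilp size_nseq.
Qed.

Lemma polyf_eqn T {cT : coded T} (f g : T -> nat) :
  polyf f -> polyf g -> polyf (fun x => f x == g x).
Proof.
move=> Pf Pg; apply: polyf_ext (polyf_andb (polyf_leq Pf Pg) (polyf_leq Pg Pf)).
by move=> x; rewrite eqn_leq.
Qed.

(** Built backwards: the length of the accumulator is the next entry. The increment depends on the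
    accumulator, so the general fold is used, with a quadratic bound. *)
Lemma polyf_iota0 T {cT : coded T} (f : T -> nat) : polyf f -> polyf (fun x => iota 0 (f x)).
Proof.
move=> Pf.
have E m : foldl (fun s _ => size s :: s) [::] (nseq m tt) = rev (iota 0 m).
  suff H k : foldl (fun s _ => size s :: s) (rev (iota 0 k)) (nseq m tt) = rev (iota 0 (k + m)).
    exact: (H 0).
  elim: m k => [|m IH] k; first by rewrite addn0.
  rewrite addnS -addSn -IH.
  suff -> : rev (iota 0 k.+1) = size (rev (iota 0 k)) :: rev (iota 0 k) by [].
  by rewrite -[k.+1]addn1 iotaD rev_cat size_rev size_iota.
apply: (@polyf_ext _ _ _ _ (fun x => rev (foldl (fun s _ => size s :: s) [::] (nseq (f x) tt)))).
  by move=> x; rewrite E revK.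
apply: polyf_rev.
apply: (polyf_foldl (st := fun _ _ s => size s :: s)).
- exact: polyf_units.
- exact: polyf_const.
- by apply: polyf_cons; [apply: polyf_size|]; apply/polyf_snd/polyf_id.
exists (fun x => 1 + sz (f x) * (2 * sz (f x))); first by pb.
move=> x i.
have -> : take i (nseq (f x) tt) = nseq (minn i (f x)) tt.
  by elim: i (f x) => [|i IH] [|m] //=; rewrite IH minnSS.
rewrite E; set m := minn _ _.
have Hm : m <= f x by rewrite /m geq_minr.
have H : forall k (l : seq nat), all (fun y => y < k) l -> sz l <= 1 + size l * (2 * k).
  move=> k; elim=> //= a l IH /andP[Ha /IH]; rewrite sz_cons sz_nat; lia.
apply: leq_trans (H (f x) _ _) _.
  by apply/allP => y; rewrite mem_rev mem_iota; lia.
by rewrite size_rev size_iota leq_add2l leq_mul ?leq_mul // sz_nat; lia.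
Qed.

Lemma polyf_iota T {cT : coded T} (f g : T -> nat) :
  polyf f -> polyf g -> polyf (fun x => iota (f x) (g x)).
Proof.
move=> Pf Pg; apply: (@polyf_ext _ _ _ _ (fun x => [seq f x + i | i <- iota 0 (g x)])).
  by move=> x; rewrite -iotaDl addn0.
apply: polyf_map; first exact: polyf_iota0.
by apply: polyf_addn; [apply: (polyf_comp Pf); apply/polyf_fst/polyf_id|apply/polyf_snd/polyf_id].
Qed.

(** A counter that restarts on reaching [g x]; for [g x = 0] it never restarts, in accordance with
    [modn0]. *)
Lemma polyf_modn T {cT : coded T} (f g : T -> nat) :
  polyf f -> polyf g -> polyf (fun x => f x %% g x).
Proof.
move=> Pf Pg.
apply: (@polyf_ext _ _ _ _
  (fun x => foldl (fun s _ => if s.+1 == g x then 0 else s.+1) 0 (nseq (f x) tt))).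
  move=> x; have [d0|d0] := posnP (g x).
    rewrite d0 modn0; suff H n s : foldl (fun s _ => if s.+1 == 0 then 0 else s.+1) s (nseq n tt) = s + n.
      by rewrite H.
    by elim: n s => [|n IH] s /=; rewrite ?addn0 // IH; lia.
  set d := g x in d0 *.
  suff H n s : s < d -> foldl (fun s _ => if s.+1 == d then 0 else s.+1) s (nseq n tt) = (s + n) %% d.
    by rewrite H.
  elim: n s => [|n IH] s Hs /=; first by rewrite addn0 modn_small.
  case: eqP => E; last by rewrite IH; [congr (_ %% _)|]; lia.
  by rewrite IH // add0n addnS -addSn E modnDl.
apply: (polyf_foldl_incr (st := fun x _ s => if s.+1 == g x then 0 else s.+1) (h := fun _ => 2)).
- exact: polyf_units.
- exact: polyf_const.
- have P2 : polyf (fun p : T * unit * nat => p.2.+1) by apply/polyf_S/polyf_snd/polyf_id.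
  apply: polyf_if => //; last exact: polyf_const.
  by apply: polyf_eqn => //; apply: (polyf_comp Pg); apply/polyf_fst/polyf_fst/polyf_id.
- exact: pb_const.
- by move=> x _ s; case: ifP => _; rewrite !sz_nat; lia.
Qed.

Lemma polyf_expc T {cT : coded T} (f : T -> nat) n : polyf f -> polyf (fun x => f x ^ n).
Proof.
move=> Pf; elim: n => [|n IH]; first exact: polyf_const.
by apply: polyf_ext (polyf_muln Pf IH) => x; rewrite expnS.
Qed.

Lemma polyf_drop T A {cT : coded T} {cA : coded A} (i : T -> nat) (l : T -> seq A) :
  polyf i -> polyf l -> polyf (fun x => drop (i x) (l x)).
Proof.
move=> Pi Pl.
apply: (@polyf_ext _ _ _ _ (fun x => foldl (fun s _ => behead s) (l x) (nseq (i x) tt))).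
  by move=> x; elim: (i x) (l x) => [|n IH] [|a m] //=; rewrite ?drop0 // IH.
apply: (polyf_foldl_shrink (st := fun _ _ s => behead s)) => //.
- exact: polyf_units.
- exact/polyf_behead/polyf_snd/polyf_id.
- by move=> _ _ [|a s] //=; rewrite sz_cons; lia.
Qed.

Lemma polyf_nth T A {cT : coded T} {cA : coded A} d (l : T -> seq A) (i : T -> nat) : code d = Leaf ->
  polyf l -> polyf i -> polyf (fun x => nth d (l x) (i x)).
Proof.
move=> Hd Pl Pi; apply: polyf_ext (polyf_head Hd (polyf_drop Pi Pl)).
by move=> x; elim: (i x) (l x) => [|n IH] [|a m] //=.
Qed.

Lemma polyf_filter T A {cT : coded T} {cA : coded A} (l : T -> seq A) (h : T -> A -> bool) :
  polyf l -> polyf (fun p : T * A => h p.1 p.2) -> polyf (fun x => filter (h x) (l x)).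
Proof.
move=> Pl Ph.
have P1 : polyf (fun x => [seq if h x a then [:: a] else [::] | a <- l x]).
  apply: (polyf_map (h := fun x a => if h x a then [:: a] else [::])) => //.
  apply: polyf_if => //; last exact: polyf_const.
  by apply: polyf_cons; [apply/polyf_snd/polyf_id|exact: polyf_const].
apply: polyf_ext (polyf_flatten P1) => x.
by elim: (l x) => //= a m ->; case: (h x a).
Qed.

Lemma polyf_count T A {cT : coded T} {cA : coded A} (l : T -> seq A) (h : T -> A -> bool) :
  polyf l -> polyf (fun p : T * A => h p.1 p.2) -> polyf (fun x => count (h x) (l x)).
Proof.
by move=> Pl Ph; apply: polyf_ext (polyf_size (polyf_filter Pl Ph)) => x; rewrite size_filter.
Qed.

Lemma polyf_has T A {cT : coded T} {cA : coded A} (l : T -> seq A) (h : T -> A -> bool) :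
  polyf l -> polyf (fun p : T * A => h p.1 p.2) -> polyf (fun x => has (h x) (l x)).
Proof.
move=> Pl Ph; apply: polyf_ext (polyf_negb (polyf_nilp (polyf_filter Pl Ph))) => x.
by rewrite /nilp size_filter has_count lt0n.
Qed.

Lemma polyf_all T A {cT : coded T} {cA : coded A} (l : T -> seq A) (h : T -> A -> bool) :
  polyf l -> polyf (fun p : T * A => h p.1 p.2) -> polyf (fun x => all (h x) (l x)).
Proof.
move=> Pl Ph; apply: polyf_ext (polyf_negb (polyf_has (h := fun x a => ~~ h x a) Pl (polyf_negb Ph))) => x.
by rewrite has_predC negbK.
Qed.

Lemma polyf_mem T {cT : coded T} (f : T -> nat) (g : T -> seq nat) :
  polyf f -> polyf g -> polyf (fun x => f x \in g x).
Proof.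
move=> Pf Pg; apply: (@polyf_ext _ _ _ _ (fun x => has (fun a => a == f x) (g x))).
  by move=> x; rewrite has_pred1.
apply: (polyf_has (h := fun x a => a == f x)) => //; apply: polyf_eqn.
  exact/polyf_snd/polyf_id.
by apply: (polyf_comp Pf); apply/polyf_fst/polyf_id.
Qed.

(** * Reductions computed in polynomial time *)

Lemma computable_comp (f h : nat -> nat) :
  computable f -> polyf h -> computable (fun n => h (f n)).
Proof.
move=> [p Hp] [q [b [_ Hq]]]; exists (Seq p (callc 0 q)) => n.
have [t [s X E]] := Hp n.
have [s' [t' [X' [E' _] _]]] := spec_call (Hq (f n)) E.
by exists (t + t').+1, s' => //; econstructor; eauto.
Qed.

(** The output of the first reduction is no larger than its input plus its running time, so a
    polynomial in that size is again of the form [f k * n ^ c]. *)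
Lemma fpt_reduces_poly (P Q R : pproblem) (p : cmd) (b : nat) (g : nat -> nat) :
  fpt_reduces P Q -> polyf g -> {homo g : m n / m <= n} ->
  (forall y : inst Q, exists z : inst R,
     [/\ spec p (init (enc y)) (fun S => S 0 = enc z) (b * tree_size (enc y) ^ b),
         yes y <-> yes z & param z <= g (param y)]) ->
  fpt_reduces P R.
Proof.
move=> [p1 [f1 [g1 [c [Cf Cg H1]]]]] Pg Mg H2.
pose K := b + (3 * cvars p + 3) + 2.
exists (Seq p1 (callc 0 p)), (fun k => K * (f1 k + 1) ^ b.+1), (fun k => g (g1 k)), (c.+1 * b.+1).
split.
- apply: (@computable_comp f1 (fun m => K * (m + 1) ^ b.+1)) => //.
  apply: polyf_muln; first exact: polyf_const.
  by apply: polyf_expc; apply: polyf_addn; [exact: polyf_id|exact: polyf_const].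
- exact: computable_comp Cg Pg.
move=> x; have [y [t1 [[s1 X1 E1] L1 Y1 G1]]] := H1 x.
have [z [Sp Y2 G2]] := H2 y.
have [s2 [t2 [X2 [E2 _] L2]]] := spec_call Sp E1.
exists z, (t1 + t2).+1; split.
- by exists s2 => //; econstructor; eauto.
- have Sy : tree_size (enc y) <= tree_size (enc x) + t1.
    by have := size_exec X1 0; rewrite E1 /init /=.
  set n := tree_size (enc x) in L1 Sy *.
  have n0 : 0 < n by exact: tree_size_gt0.
  (* [X * N] dominates [n + t1]: the exponent [c.+1] makes [N] exceed both [n] and [n ^ c], and the
     summand [1] in [X] pays for [n]. *)
  set X := f1 (param x) + 1; set N := n ^ c.+1.
  have N1 : n <= N by rewrite /N -{1}(expn1 n) leq_pexp2l.
  have N2 : n ^ c <= N by rewrite leq_pexp2l.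
  have B1 : n + t1 <= X * N.
    rewrite /X mulnDl mul1n addnC leq_add //; apply: leq_trans L1 _.
    by rewrite leq_mul2l N2 orbT.
  have XN : 0 < X * N by lia.
  rewrite expnM -/N -mulnA -expnMn.
  have P1 : X * N <= (X * N) ^ b.+1 by rewrite -{1}(expn1 (X * N)) leq_pexp2l.
  have P2 : (X * N) ^ b <= (X * N) ^ b.+1 by rewrite leq_pexp2l.
  have P3 : tree_size (enc y) ^ b <= (X * N) ^ b.+1.
    apply: leq_trans P2; case: (b) => // b'; rewrite leq_exp2r //; lia.
  move: P1 P3; move: ((X * N) ^ b.+1) => Z P1 P3.
  have P4 : b * tree_size (enc y) ^ b <= b * Z by rewrite leq_mul2l P3 orbT.
  have Z0 : 0 < Z by lia.
  have P5 : 3 * cvars p + 3 <= (3 * cvars p + 3) * Z by rewrite leq_pmulr.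
  by rewrite /K !mulnDl; lia.
- by rewrite Y1.
- by apply: leq_trans G2 _; apply: Mg.
Qed.

(** * Instances given by lists of numbers *)

Definition ords n (s : seq nat) : seq 'I_n := pmap insub s.

Lemma val_ords n s : all (fun x => x < n) s -> map val (ords n s) = s.
Proof.
move=> H; rewrite /ords (pmap_filter (insubK _)).
by apply/all_filterP; apply: sub_all H => x Hx; rewrite insubT.
Qed.

Lemma ords_uniq n s : uniq s -> uniq (ords n s).
Proof. exact: pmap_sub_uniq. Qed.

Lemma enc_seq_map (U V : Type) (f : V -> tree) (g : U -> V) s :
  enc_seq (fun x => f (g x)) s = enc_seq f (map g s).
Proof. by elim: s => //= x s ->. Qed.

Lemma eq_enc_seq (U : eqType) (f g : U -> tree) s :
  {in s, f =1 g} -> enc_seq f s = enc_seq g s.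
Proof.
elim: s => //= x s IH H; rewrite IH => [|y Hy]; last by apply: H; rewrite inE Hy orbT.
by rewrite H // mem_head.
Qed.

Section Lists.
Variables (n : nat) (lm lw : nat -> seq nat) (star : 'I_n).
Hypothesis Bm : forall i, i < n -> all (fun x => x < n) (lm i).
Hypothesis Bw : forall i, i < n -> all (fun x => x < n) (lw i).
Hypothesis Um : forall i, uniq (lm i).
Hypothesis Uw : forall i, uniq (lw i).

Definition mk_smc : smc :=
  @SMC n n (fun i => ords n (lm i)) (fun i => ords n (lw i)) [set star] set0
    (fun i => ords_uniq n (Um i)) (fun i => ords_uniq n (Uw i)).

Lemma enc_mk_smc :
  enc_smc mk_smc = code ([seq lm i | i <- iota 0 n],
    ([seq lw i | i <- iota 0 n], ([:: val star], ([::] : seq nat)))).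
Proof.
have E (l : nat -> seq nat) (B : forall i, i < n -> all (fun x => x < n) (l i)) :
    enc_seq (fun m : 'I_n => enc_ord_seq (ords n (l m))) (enum 'I_n) =
    code [seq l i | i <- iota 0 n].
  rewrite -val_enum_ord -map_comp.
  have -> : code [seq (l \o val) i | i <- enum 'I_n] =
    enc_seq (fun i : 'I_n => code (l i)) (enum 'I_n) by rewrite [RHS]enc_seq_map.
  apply: eq_enc_seq => i _.
  by rewrite /enc_ord_seq (enc_seq_map enc_nat val) val_ords ?B.
rewrite /enc_smc /= !E //.
by rewrite /enc_ord_seq enum_set1 enum_set0.
Qed.

Definition acc (m w : nat) : bool := (w \in lm m) && (m \in lw w).

Definition nblock (wf hf : nat -> option nat) (m w : nat) : bool :=
  [&& acc m w,
      if wf m is Some w' then index w (lm m) < index w' (lm m) else true &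
      if hf w is Some m' then index m (lw w) < index m' (lw w) else true].

Lemma mem_ords i (s : seq nat) (x : 'I_n) : i < n -> all (fun x => x < n) s ->
  (x \in ords n s) = (val x \in s).
Proof. by move=> Hi Hs; rewrite -{2}(val_ords Hs) (mem_map val_inj). Qed.

Lemma acceptable_mk (m w : 'I_n) : @acceptable mk_smc m w = acc m w.
Proof.
rewrite /acceptable /acc /=.
by rewrite (mem_ords _ (ltn_ord m) (Bm (ltn_ord m))) (mem_ords _ (ltn_ord w) (Bw (ltn_ord w))).
Qed.

Lemma prefers_mk (s : seq nat) (x y : 'I_n) : all (fun x => x < n) s ->
  prefers (ords n s) x y = (index (val x) s < index (val y) s).
Proof. by move=> Hs; rewrite /prefers -{3 4}(val_ords Hs) !(index_map val_inj). Qed.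

Lemma wifeP (M : {set 'I_n * 'I_n}) m w : @is_matching mk_smc M ->
  (@wife mk_smc M m == Some w) = ((m, w) \in M).
Proof.
move=> /andP[_ /forall_inP HM]; rewrite /wife; case: pickP => [w' Hw'|N]; last by rewrite N.
apply/eqP/idP => [[<-]//|Hw].
have := HM _ Hw' => /forall_inP/(_ _ Hw); case: eqP => [[->]//|_] /=.
by rewrite eqxx.
Qed.

Lemma husbandP (M : {set 'I_n * 'I_n}) m w : @is_matching mk_smc M ->
  (@husband mk_smc M w == Some m) = ((m, w) \in M).
Proof.
move=> /andP[_ /forall_inP HM]; rewrite /husband; case: pickP => [m' Hm'|N]; last by rewrite N.
apply/eqP/idP => [[<-]//|Hm].
have := HM _ Hm' => /forall_inP/(_ _ Hm); case: eqP => [[->]//|_] /=.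
by rewrite eqxx andbF.
Qed.

(** Ordinals and sets give way to numbers and partial functions. Bounding every duplicate-free list
    of blocking pairs suits both uses: a covering list of faults in one direction, an explicit list
    that is too long in the other. *)
Lemma smc_solvableP b : smc_solvable mk_smc b <->
  exists wf hf : nat -> option nat,
  [/\ forall m w, wf m = Some w -> [/\ m < n, w < n, acc m w & hf w = Some m],
      forall m w, hf w = Some m -> wf m = Some w,
      hf (val star) != None &
      forall F : seq (nat * nat), uniq F ->
        (forall p, p \in F -> p.1 < n /\ p.2 < n /\ nblock wf hf p.1 p.2) -> size F <= b].
Proof.
have PI (x : nat) : x < n -> exists i : 'I_n, val i = x by move=> H; exists (Ordinal H).
split.
  move=> [M [HM HF HB]].
  pose wf m := if (insub m : option 'I_n) is Some i then omap val (@wife mk_smc M i) else None.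
  pose hf w := if (insub w : option 'I_n) is Some i then omap val (@husband mk_smc M i) else None.
  have Ew (i : 'I_n) : wf (val i) = omap val (@wife mk_smc M i) by rewrite /wf valK.
  have Eh (i : 'I_n) : hf (val i) = omap val (@husband mk_smc M i) by rewrite /hf valK.
  exists wf, hf; split.
  - move=> m w; rewrite /wf; case: insubP => // i Hi Ei.
    case E: (@wife mk_smc M i) => [w'|] //= [Ew']; move/eqP: E; rewrite (wifeP _ _ HM) => E.
    have A : acc m w.
      by rewrite -Ei -Ew' -acceptable_mk; case/andP: HM => /forall_inP/(_ _ E).
    split=> //; first by rewrite -Ew' ltn_ord.
    by rewrite -Ew' Eh; move: E; rewrite -(husbandP _ _ HM) => /eqP -> /=; rewrite Ei.
  - move=> m w; rewrite /hf; case: insubP => // i Hi Ei.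
    case E: (@husband mk_smc M i) => [m'|] //= [Em']; move/eqP: E; rewrite (husbandP _ _ HM) => E.
    by rewrite -Em' Ew; move: E; rewrite -(wifeP _ _ HM) => /eqP -> /=; rewrite Ei.
  - case/andP: HF => /forall_inP/(_ star); rewrite inE eqxx => /(_ isT) + _.
    by rewrite Eh; case: husband.
  move=> F UF HFF.
  have BE (m w : 'I_n) : @blocking mk_smc M m w = nblock wf hf m w.
    rewrite /blocking /nblock acceptable_mk Ew Eh.
    congr [&& _, _ & _].
      by case: wife => //= w'; rewrite prefers_mk // Bm.
    by case: husband => //= m'; rewrite prefers_mk // Bw.
  (* The translation back to ordinals by [insubd] needs a default in ['I_n], which a member of [F]
     provides. *)
  have [d|[d0 n0]] : (forall p, p \notin F) \/ (exists p, p \in F).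
    by case: F {UF HFF} => [|p F]; [left|right; exists p; rewrite mem_head].
    by case: F UF HFF d => // p F _ _ /(_ p); rewrite mem_head.
  have [H1 _] := HFF _ n0; have [i0 _] := PI _ H1.
  pose tr (p : nat * nat) : 'I_n * 'I_n := (insubd i0 p.1, insubd i0 p.2).
  have UT : uniq (map tr F).
    rewrite map_inj_in_uniq // => -[a1 a2] [b1 b2] /HFF[/= Ha1 [Ha2 _]] /HFF[/= Hb1 [Hb2 _]].
    move=> [] /(congr1 val) + /(congr1 val); rewrite !val_insubd /= Ha1 Ha2 Hb1 Hb2.
    by move=> -> ->.
  rewrite -(size_map tr); apply: leq_trans HB.
  rewrite cardE; apply: uniq_leq_size => // _ /mapP[p /HFF[H2 [H3 H4]] ->].
  by rewrite mem_enum inE BE /= !val_insubd H2 H3.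
move=> [wf [hf [Hwf Hhf Hs HB]]].
pose M : {set 'I_n * 'I_n} := [set p | wf (val p.1) == Some (val p.2)].
have HM : @is_matching mk_smc M.
  apply/andP; split.
    apply/forall_inP => -[m w]; rewrite inE /= => /eqP /Hwf[_ _ A _].
    by rewrite acceptable_mk.
  apply/forall_inP => -[m w]; rewrite inE /= => /eqP H1.
  apply/forall_inP => -[m' w']; rewrite inE /= => /eqP H2.
  apply/implyP => N; apply/andP; split; apply: contra N => /eqP E.
    by move: H1; rewrite E H2 => -[/val_inj ->].
  have [_ _ _ K1] := Hwf _ _ H1; have [_ _ _ K2] := Hwf _ _ H2.
  by move: K1; rewrite E K2 => -[/val_inj ->].
have Ew (i : 'I_n) : wf (val i) = omap val (@wife mk_smc M i).
  case E: (@wife mk_smc M i) => [w|] /=.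
    by move/eqP: E; rewrite (wifeP _ _ HM) inE => /eqP.
  case E2: (wf i) => [w|] //; have [_ Hw _ _] := Hwf _ _ E2.
  have : (i, Ordinal Hw) \in M by rewrite inE /= E2.
  by rewrite -(wifeP _ _ HM) E.
have Eh (i : 'I_n) : hf (val i) = omap val (@husband mk_smc M i).
  case E: (@husband mk_smc M i) => [w|] /=.
    by move/eqP: E; rewrite (husbandP _ _ HM) inE /= => /eqP /Hwf[].
  case E2: (hf i) => [w|] //; have E3 := Hhf _ _ E2; have [Hw _ _ _] := Hwf _ _ E3.
  have : (Ordinal Hw, i) \in M by rewrite inE /= E3.
  by rewrite -(husbandP _ _ HM) E.
exists M; split=> //.
  apply/andP; split; apply/forall_inP => w; rewrite !inE //.
  by move=> /eqP ->; move: Hs; rewrite Eh; case: husband.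
pose F := [seq (val p.1, val p.2) | p <- enum (@blocking_pairs mk_smc M)].
have <- : size F = #|@blocking_pairs mk_smc M| by rewrite size_map cardE.
apply: HB.
  rewrite map_inj_uniq ?enum_uniq // => -[a1 a2] [b1 b2] /= [] /val_inj -> /val_inj ->.
  by [].
move=> p /mapP[[m w]]; rewrite mem_enum inE /= => HBl ->; split; [|split] => //=.
move: HBl; rewrite /blocking /nblock acceptable_mk Ew Eh => /and3P[-> H1 H2] /=.
apply/andP; split.
  by move: H1; case: wife => //= w'; rewrite prefers_mk // Bm.
by move: H2; case: husband => //= w'; rewrite prefers_mk // Bw.
Qed.

End Lists.

(** * Comparator networks as marriage instances *)

Definition step (s : nat -> bool) (e : nat * nat) : nat -> bool :=
  fun l => if l == e.1 then s e.1 || s e.2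
           else if l == e.2 then s e.1 && s e.2 else s l.

Definition run (es : seq (nat * nat)) (s : nat -> bool) : nat -> bool := foldl step s es.

Lemma run_cat es1 es2 s : run (es1 ++ es2) s = run es2 (run es1 s).
Proof. exact: foldl_cat. Qed.

(** Lane [i * n + v] stands for the value [v] of group [i]. *)
Definition choice_state (n : nat) (c : nat -> nat) : nat -> bool :=
  fun l => c (l %/ n) == l %% n.

(** A certificate of solvability: each mutually acceptable pair is a listed fault or has a member
    whose partner is at least as good. *)
Lemma smc_solvable_of n lm lw (star : 'I_n) Um Uw
    (Bm : forall i, i < n -> all (fun x => x < n) (lm i))
    (Bw : forall i, i < n -> all (fun x => x < n) (lw i))
    (wf : nat -> option nat) (hinv : nat -> nat) (faults : seq (nat * nat)) b :
  (forall m w, wf m = Some w -> [/\ m < n, w < n, acc lm lw m w & hinv w = m]) ->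
  (exists m, wf m = Some (val star)) ->
  (forall m w, m < n -> w < n -> w \in lm m -> m \in lw w -> (m, w) \in faults \/
     (exists2 w', wf m = Some w' & index w' (lm m) <= index w (lm m)) \/
     (exists2 m', wf m' = Some w & index m' (lw w) <= index m (lw w))) ->
  size faults <= b ->
  smc_solvable (@mk_smc n lm lw star Um Uw) b.
Proof.
move=> Hwf [ms Hms] HF Hb; apply/smc_solvableP => //.
pose hf w := if wf (hinv w) == Some w then Some (hinv w) else None.
have Ehf m w : wf m = Some w -> hf w = Some m.
  by move=> H; have [_ _ _ E] := Hwf _ _ H; rewrite /hf E H eqxx.
exists wf, hf; split.
- by move=> m w H; have [? ? ? _] := Hwf _ _ H; split=> //; apply: Ehf.
- by move=> m w; rewrite /hf; case: eqP => // H [<-].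
- by rewrite (Ehf _ _ Hms).
move=> F UF HFF; apply: leq_trans Hb; apply: uniq_leq_size => // -[m w] /HFF[/= Hm [Hw]].
case/and3P => /andP[A1 A2] B1 B2; case: (HF m w Hm Hw A1 A2) => // -[[w' E L]|[m' E L]].
  by move: B1; rewrite E ltnNge L.
by move: B2; rewrite (Ehf _ _ E) ltnNge L.
Qed.

Section Network.
Variables (g n : nat) (E : seq (nat * nat)) (H : nat).
Let L := g * n.
Let T := (size E).+1.
Let N := T.+1 * L.

(* Man and woman number [pid t l] sit on lane [l] at time [t]; the person [N] is
   the distinguished woman, respectively the only man acceptable to her. The
   event number [t] of [E] takes place between the times [t.+1] and [t.+2]: no
   event follows the chains of choices at time [0]. *)
Definition pid (t l : nat) : nat := t * (g * n) + l.

(** The women of time [0] can already have three acceptable men, two in their chain and one at time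
    [1]; the leading empty entry keeps comparators, which cost a further entry, away from them. *)
Definition evl (t : nat) : seq (nat * nat) := nth [::] ([::] :: [seq [:: e] | e <- E]) t.

(** After time [0] a man prefers the women of the preceding time to his own, so a woman set free
    there pulls him away and his own woman becomes free in turn. On an upper lane the woman of the
    lower lane is the second choice: she counts only if the upper lane brings no token. *)
Definition man_row (t l : nat) : seq nat :=
  if t == 0 then
    if l.+1 %% n == 0 then [::] else [:: pid 0 l; pid 0 l.+1]
  else pid t.-1 l :: [seq pid t.-1 p.2 | p <- evl t.-1 & p.1 == l] ++ [:: pid t l].

(** The man [N] closes all chains. The distinguished woman [N] is his last choice, so once bound to
    her he is dissatisfied with every free woman at the end of a chain or of lane [H]. *)
Definition last_man : seq nat :=
  [seq pid 0 (i * n + n.-1) | i <- iota 0 g] ++ [:: pid T H; N].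

(** On a lower lane the man of the upper lane precedes the man of the lane itself: a token stays
    below only if the upper man is already served. *)
Definition woman_row (t l : nat) : seq nat :=
  if t == 0 then
    (if l %% n == 0 then [::] else [:: pid 0 l.-1]) ++
    [:: if l.+1 %% n == 0 then N else pid 0 l; pid 1 l]
  else if t == T then pid T l :: (if l == H then [:: N] else [::])
  else pid t l :: [seq pid t.+1 p.1 | p <- evl t & p.2 == l] ++ [:: pid t.+1 l].

Definition lm (i : nat) : seq nat :=
  if i < N then man_row (i %/ L) (i %% L) else if i == N then last_man else [::].

Definition lw (i : nat) : seq nat :=
  if i < N then woman_row (i %/ L) (i %% L) else if i == N then [:: N] else [::].

Hypothesis n2 : 1 < n.
Hypothesis g0 : 0 < g.
Hypothesis HL : H < L.
Hypothesis EL : forall e, e \in E -> [/\ e.1 < L, e.2 < L & e.1 != e.2].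

Lemma L_gt0 : 0 < L. Proof. by rewrite muln_gt0 g0 ltnW. Qed.

Lemma pidE t l : pid t l = t * L + l. Proof. by []. Qed.

Lemma pid_div t l : l < L -> pid t l %/ L = t.
Proof. by move=> Hl; rewrite pidE divnMDl ?L_gt0 // divn_small ?addn0. Qed.

Lemma pid_mod t l : l < L -> pid t l %% L = l.
Proof. by move=> Hl; rewrite pidE modnMDl modn_small. Qed.

Lemma pid_inj t t' l l' : l < L -> l' < L -> pid t l = pid t' l' -> t = t' /\ l = l'.
Proof.
move=> H1 H2 EE; have := pid_div t H1; have := pid_mod t H1.
by rewrite EE pid_div // pid_mod // => -> ->.
Qed.

Lemma pid_eq t t' l l' : l < L -> l' < L -> (pid t l == pid t' l') = (t == t') && (l == l').
Proof.
move=> H1 H2; apply/eqP/andP => [/(pid_inj H1 H2)[-> ->]//|[/eqP-> /eqP->]//].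
Qed.

Lemma pid_lt t l : l < L -> t <= T -> pid t l < N.
Proof.
move=> Hl Ht; rewrite pidE /N mulSn; have H1 : t * L <= T * L by rewrite leq_mul2r Ht orbT.
lia.
Qed.

Lemma pid_ltS t l : l < L -> t <= T -> pid t l < N.+1.
Proof. by move=> Hl Ht; rewrite ltnW // ltnS pid_lt. Qed.

Lemma pid_neqN t l : l < L -> t <= T -> (pid t l == N) = false.
Proof. by move=> H1 H2; apply: ltn_eqF; apply: pid_lt. Qed.

Lemma pidP i : i < N -> exists t l, [/\ t <= T, l < L & i = pid t l].
Proof.
move=> Hi; exists (i %/ L), (i %% L); split; last by rewrite pidE -divn_eq.
  by rewrite -ltnS ltn_divLR // L_gt0.
by rewrite ltn_pmod // L_gt0.
Qed.

Lemma lm_pid t l : l < L -> t <= T -> lm (pid t l) = man_row t l.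
Proof. by move=> H1 H2; rewrite /lm pid_lt // pid_div // pid_mod. Qed.

Lemma lw_pid t l : l < L -> t <= T -> lw (pid t l) = woman_row t l.
Proof. by move=> H1 H2; rewrite /lw pid_lt // pid_div // pid_mod. Qed.

Lemma lmN : lm N = last_man. Proof. by rewrite /lm ltnn eqxx. Qed.

Lemma lwN : lw N = [:: N]. Proof. by rewrite /lw ltnn eqxx. Qed.

Lemma evlP t : (evl t = [::]) \/ (exists2 e, e \in E & [/\ evl t = [:: e], 0 < t & t < T]).
Proof.
rewrite /evl; case: t => [|t] /=; first by left.
case: (ltnP t (size E)) => Ht; last by left; rewrite nth_default ?size_map.
right; exists (nth (0, 0) E t); first exact: mem_nth.
by rewrite (nth_map (0, 0)).
Qed.

Lemma evl_mem t e : e \in evl t -> [/\ evl t = [:: e], e.1 < L, e.2 < L, e.1 != e.2 & 0 < t < T].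
Proof.
case: (evlP t) => [->//|[e' /EL[H1 H2 H3] [-> t0 t1]]]; rewrite inE => /eqP ->.
by rewrite t0 t1.
Qed.

Lemma succ_lt l : l < L -> l.+1 %% n != 0 -> l.+1 < L.
Proof.
move=> Hl; apply: contraR; rewrite -leqNgt => Hl'.
have -> : l.+1 = g * n by apply/eqP; rewrite eqn_leq Hl' Hl.
by rewrite modnMl.
Qed.

Lemma pred_lt l : l < L -> l.-1 < L. Proof. by move=> Hl; apply: leq_ltn_trans Hl;
  apply: leq_pred. Qed.

Lemma lane_lt i v : i < g -> v < n -> i * n + v < L.
Proof.
move=> Hi Hv; have : i.+1 * n <= g * n by rewrite leq_mul2r Hi orbT.
by rewrite mulSn /L; lia.
Qed.

Lemma lane_div i v : v < n -> (i * n + v) %/ n = i.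
Proof. by move=> Hv; rewrite divnMDl ?(ltnW n2) // divn_small ?addn0. Qed.

Lemma lane_mod i v : v < n -> (i * n + v) %% n = v.
Proof. by move=> Hv; rewrite modnMDl modn_small. Qed.

Lemma lane_last i v : v < n -> ((i * n + v).+1 %% n == 0) = (v.+1 == n).
Proof.
move=> Hv; rewrite -addnS modnMDl; case: (ltngtP v.+1 n) => [Hlt|Hgt|->].
- by rewrite modn_small.
- by move: Hgt; rewrite ltnNge Hv.
- by rewrite modnn.
Qed.

Lemma man_row_bound t l : l < L -> t <= T -> all (fun x => x < N.+1) (man_row t l).
Proof.
move=> Hl Ht; rewrite /man_row; case: eqP => [_|/eqP t0].
  by case: eqP => // /eqP Hn; rewrite /= !pid_ltS // succ_lt.
have Ht' : t.-1 <= T by apply: leq_trans Ht; apply: leq_pred.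
rewrite /= all_cat /= !pid_ltS //= !andbT.
apply/allP => x /mapP[e]; rewrite mem_filter => /andP[_ /evl_mem[_ _ He _ _]] ->.
by rewrite pid_ltS.
Qed.

Lemma woman_row_bound t l : l < L -> t <= T -> all (fun x => x < N.+1) (woman_row t l).
Proof.
move=> Hl Ht; rewrite /woman_row; case: eqP => [_|/eqP t0].
  rewrite all_cat /= (pid_ltS Hl) //=; apply/andP; split.
    by case: eqP => //= _; rewrite pid_ltS // pred_lt.
  by rewrite andbT; case: ifP => _ //; rewrite pid_ltS.
case: eqP => [_|/eqP tT].
  by rewrite /= pid_ltS //=; case: eqP => //=; rewrite ltnS leqnn.
have Ht' : t < T by rewrite ltn_neqAle tT.
rewrite /= all_cat /= !pid_ltS //= !andbT.
apply/allP => x /mapP[e]; rewrite mem_filter => /andP[_ /evl_mem[_ He _ _ _]] ->.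
by rewrite pid_ltS.
Qed.

Lemma group_last i : i < g -> i * n + n.-1 < L.
Proof. by move=> Hi; apply: lane_lt => //; rewrite prednK // ltnW. Qed.

Lemma lm_bound i : i < N.+1 -> all (fun x => x < N.+1) (lm i).
Proof.
rewrite ltnS leq_eqVlt => /orP[/eqP->|/pidP[t [l [Ht Hl ->]]]]; last first.
  by rewrite lm_pid // man_row_bound.
rewrite lmN all_cat /= (pid_ltS HL) // ltnS leqnn !andbT.
apply/allP => x /mapP[j]; rewrite mem_iota => /andP[_ Hj] ->.
by rewrite pid_ltS // group_last.
Qed.

Lemma lw_bound i : i < N.+1 -> all (fun x => x < N.+1) (lw i).
Proof.
rewrite ltnS leq_eqVlt => /orP[/eqP->|/pidP[t [l [Ht Hl ->]]]]; last first.
  by rewrite lw_pid // woman_row_bound.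
by rewrite lwN /= ltnS leqnn.
Qed.

Lemma lm_uniq i : uniq (lm i).
Proof.
rewrite /lm; case: ltnP => [/pidP[t [l [Ht Hl ->]]]|_].
  rewrite pid_div // pid_mod // /man_row; case: eqP => [_|/eqP t0].
    case: eqP => // /eqP /(succ_lt Hl) Hl' /=.
    by rewrite inE pid_eq // [l == _]ltn_eqF ?andbF.
  case: (evlP t.-1) => [->|[e /EL[H1 H2 H3] [-> _ _]]] /=.
    by rewrite inE pid_eq // andbT; case: t t0 {Ht} => // t _; rewrite /= ltn_eqF.
  have tt : t.-1 == t = false by case: t t0 {Ht} => // t _; rewrite /= ltn_eqF.
  case: eqP => [E1|_] /=; rewrite ?inE !pid_eq // ?tt ?eqxx ?andbF //=.
  by rewrite -E1 (negbTE H3).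
case: eqP => // _; rewrite cat_uniq /= inE pid_neqN // andbT orbF.
rewrite map_inj_in_uniq ?iota_uniq /=.
  rewrite andbT; apply/norP; split; apply/mapP => -[j]; rewrite mem_iota => /andP[_ Hj] /eqP.
    by rewrite pid_eq ?group_last.
  by rewrite eq_sym pid_neqN ?group_last.
move=> j k; rewrite !mem_iota => /andP[_ Hj] /andP[_ Hk].
move=> /(pid_inj (group_last Hj) (group_last Hk))[_ /addIn /eqP].
by rewrite eqn_pmul2r ?(ltnW n2) // => /eqP.
Qed.

Lemma lw_uniq i : uniq (lw i).
Proof.
rewrite /lw; case: ltnP => [/pidP[t [l [Ht Hl ->]]]|_]; last by case: eqP.
rewrite pid_div // pid_mod // /woman_row; case: eqP => [_|/eqP t0].
  have U2 : uniq [:: if l.+1 %% n == 0 then N else pid 0 l; pid 1 l].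
    rewrite /= inE andbT; case: ifP => _; last by rewrite pid_eq.
    by rewrite eq_sym pid_neqN.
  case: eqP => // /eqP l0; rewrite cat_uniq U2 andbT /= orbF.
  have l_gt0 : 0 < l by rewrite lt0n; apply: contra l0 => /eqP ->; rewrite mod0n.
  have l1 : l.-1 == l = false by rewrite ltn_eqF // prednK.
  rewrite !mem_seq1 negb_or; apply/andP; split; last by rewrite pid_eq // pred_lt.
  case: ifP => _; first by rewrite eq_sym pid_neqN ?pred_lt.
  by rewrite eq_sym pid_eq ?pred_lt // l1.
case: (eqVneq t T) => [_|tT].
  by case: eqP => //= _; rewrite inE pid_neqN.
have t1 : t == t.+1 = false by rewrite ltn_eqF.
case: (evlP t) => [->|[e /EL[H1 H2 H3] [-> _ _]]] /=.
  by rewrite inE pid_eq // t1.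
case: eqP => [E1|_] /=; rewrite ?inE !pid_eq // ?t1 ?andbF //= andbT.
by rewrite eqxx /= -E1 H3.
Qed.

Definition ms : 'I_N.+1 := Ordinal (ltnSn N).

Definition net_smc : smc := @mk_smc N.+1 lm lw ms lm_uniq lw_uniq.

(** * Positions of the tokens over time *)

Section Choice.
Variable c : nat -> nat.

Fixpoint nval (t : nat) : nat -> bool :=
  if t is t'.+1 then run (evl t') (nval t') else choice_state n c.

Lemma evl_cat t : t <= size E -> nval t.+1 = run (take t E) (choice_state n c).
Proof.
elim: t => [|t IH] Ht; first by rewrite take0.
rewrite (take_nth (0, 0)) // -cats1 run_cat -(IH (ltnW Ht)).
by rewrite [LHS]/= {1}/evl /= (nth_map (0, 0)).
Qed.

Lemma val_final : nval T = run E (choice_state n c).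
Proof. by rewrite evl_cat // take_size. Qed.

Lemma valS_none t l : evl t = [::] -> nval t.+1 l = nval t l.
Proof. by move=> /= ->. Qed.

Lemma valS_hi t e : evl t = [:: e] -> nval t.+1 e.1 = nval t e.1 || nval t e.2.
Proof. by move=> /= -> /=; rewrite /step eqxx. Qed.

Lemma valS_lo t e : evl t = [:: e] -> e.1 != e.2 -> nval t.+1 e.2 = nval t e.1 && nval t e.2.
Proof. by move=> /= -> /= N12; rewrite /step eqxx eq_sym (negbTE N12). Qed.

Lemma valS_other t e l : evl t = [:: e] -> l != e.1 -> l != e.2 -> nval t.+1 l = nval t l.
Proof. by move=> /= -> /= /negbTE N1 /negbTE N2; rewrite /step N1 N2. Qed.

End Choice.

Lemma man_row_S t l : man_row t.+1 l =
  pid t l :: [seq pid t p.2 | p <- evl t & p.1 == l] ++ [:: pid t.+1 l].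
Proof. by []. Qed.

Lemma woman_row_pos t l : 0 < t < T -> woman_row t l =
  pid t l :: [seq pid t.+1 p.1 | p <- evl t & p.2 == l] ++ [:: pid t.+1 l].
Proof. by case/andP; rewrite /woman_row; case: eqP => [->|] // _ _ /ltn_eqF ->. Qed.

Lemma man_row_hi t e : evl t = [:: e] ->
  man_row t.+1 e.1 = [:: pid t e.1; pid t e.2; pid t.+1 e.1].
Proof. by move=> Ee; rewrite man_row_S Ee /= eqxx. Qed.

Lemma woman_row_lo t e : evl t = [:: e] -> 0 < t < T ->
  woman_row t e.2 = [:: pid t e.2; pid t.+1 e.1; pid t.+1 e.2].
Proof. by move=> Ee Ht; rewrite woman_row_pos // Ee /= eqxx. Qed.

Lemma woman_row_T l : woman_row T l = pid T l :: (if l == H then [:: N] else [::]).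
Proof. by rewrite /woman_row eqxx. Qed.

Lemma woman_row_head t l : 0 < t -> exists s, woman_row t l = pid t l :: s.
Proof.
rewrite /woman_row; case: eqP => [->//|_] _; case: eqP => [->|_]; by eexists.
Qed.

(** * From a harmless choice to a matching *)

Section Forward.
Variable c : nat -> nat.
Hypothesis Hc : forall i, i < g -> c i < n.
Hypothesis HH : ~~ nval c T H.
Notation nval := (nval c).

(** In a chain the men before the chosen position keep their own woman and the others move on by
    one, which leaves the chosen woman to the man of time [1]. Later, a man whose lane carries a
    token takes the woman that brought it; if his own lane did not, a comparator did ([nval_new]),
    so the default of [head] is never reached. *)
Definition wf0 (t l : nat) : option nat :=
  if t == 0 then
    if l.+1 %% n == 0 then None
    else Some (if l %% n < c (l %/ n) then pid 0 l else pid 0 l.+1)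
  else Some (if ~~ nval t l then pid t l else if nval t.-1 l then pid t.-1 l
             else pid t.-1 (head (0, 0) (evl t.-1)).2).

Definition hinv0 (t l : nat) : nat :=
  if t == 0 then
    if l %% n < c (l %/ n) then pid 0 l
    else if c (l %/ n) == l %% n then pid 1 l else pid 0 l.-1
  else if ~~ nval t l then pid t l else if nval t.+1 l then pid t.+1 l
       else pid t.+1 (head (0, 0) (evl t)).1.

Definition wf (i : nat) : option nat :=
  if i < N then wf0 (i %/ L) (i %% L) else if i == N then Some N else None.

Definition hinv (i : nat) : nat := if i < N then hinv0 (i %/ L) (i %% L) else N.

Lemma wf_pid t l : l < L -> t <= T -> wf (pid t l) = wf0 t l.
Proof. by move=> H1 H2; rewrite /wf pid_lt // pid_div // pid_mod. Qed.

Lemma hinv_pid t l : l < L -> t <= T -> hinv (pid t l) = hinv0 t l.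
Proof. by move=> H1 H2; rewrite /hinv pid_lt // pid_div // pid_mod. Qed.

Lemma wfN : wf N = Some N. Proof. by rewrite /wf ltnn eqxx. Qed.

Lemma nval_new t l : nval t.+1 l -> ~~ nval t l ->
  exists2 e, evl t = [:: e] & l = e.1 /\ nval t e.2.
Proof.
case: (evlP t) => [E0|[e /EL[H1 H2 H3] [Ee _ _]]].
  by rewrite valS_none // => ->.
have [->|N1] := eqVneq l e.1.
  by rewrite (valS_hi _ Ee) => /orP[->//|V2] _; exists e.
have [->|N2] := eqVneq l e.2.
  by rewrite (valS_lo _ Ee) // => /andP[_ ->].
by rewrite (valS_other _ Ee) // => ->.
Qed.

Lemma mem_woman_last t l : t < T -> pid t.+1 l \in woman_row t l.
Proof.
case: t => [|t] Ht; first by rewrite mem_cat !inE eqxx !orbT.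
by rewrite woman_row_pos // inE mem_cat mem_seq1 eqxx !orbT.
Qed.

Lemma wf_ok m w : wf m = Some w ->
  [/\ m < N.+1, w < N.+1, acc lm lw m w & hinv w = m].
Proof.
case: (ltngtP m N) => [/pidP[t [l [Ht Hl ->]]]|Hm|->]; last 1 first.
- by rewrite wfN => -[<-]; rewrite /acc lmN lwN /last_man mem_cat !inE eqxx !orbT
    /hinv ltnn ltnS leqnn.
- rewrite wf_pid // /wf0; case: t Ht => [|t] Ht /=.
    case: eqP => // /eqP Hn [<-]; have Hl' := succ_lt Hl Hn.
    have Hm : pid 0 l < N.+1 by rewrite pid_ltS.
    case: ifP => Hp.
      split=> //; last by rewrite hinv_pid // /hinv0 /= Hp.
      rewrite /acc lm_pid // lw_pid // /man_row /woman_row /= (negbTE Hn) /=.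
      by apply/andP; split; rewrite ?mem_cat ?inE ?eqxx ?orbT.
    split=> //; first by rewrite pid_ltS.
      rewrite /acc lm_pid // lw_pid // /man_row /woman_row /= (negbTE Hn) /=.
      by apply/andP; split; rewrite ?mem_cat ?inE ?eqxx ?orbT.
    have nd : n %| l.+1 = false by apply/negbTE.
    rewrite hinv_pid // /hinv0 /= divnS ?(ltnW n2) // modnS nd add0n.
    have Hp' : c (l %/ n) < (l %% n).+1 by rewrite ltnS leqNgt Hp.
    by rewrite ltnNge (ltnW Hp') /= ltn_eqF.
  have Hm : pid t.+1 l < N.+1 by rewrite pid_ltS.
  have Ht' := ltnW Ht.
  have Hs (w' : nat) : Some w' = Some w -> w' = w by case.
  move=> /Hs <- {Hs}; case: ifP => V1.
    split=> //; last by rewrite hinv_pid // /hinv0 V1.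
    rewrite /acc lm_pid // lw_pid // man_row_S inE mem_cat mem_seq1 eqxx !orbT /=.
    by have [s ->] := @woman_row_head t.+1 l isT; rewrite mem_head.
  have {}V1 : nval t.+1 l by apply/negPn; rewrite V1.
  case: ifP => V2.
    split=> //; first by rewrite pid_ltS.
      by rewrite /acc lm_pid // lw_pid // man_row_S mem_head mem_woman_last.
    rewrite hinv_pid // /hinv0 V1 V2; case: eqP => // t0; move: V2; rewrite t0 /= /choice_state.
    by move=> /eqP ->; rewrite ltnn eqxx.
  have [e Ee [El V3]] := nval_new V1 (negbT V2).
  have [_ H1 H2 H3 /andP[t0 tT]] : [/\ evl t = [:: e], e.1 < L, e.2 < L, e.1 != e.2 & 0 < t < T].
    by apply: evl_mem; rewrite Ee mem_head.
  rewrite Ee /=; split=> //; first by rewrite pid_ltS.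
    rewrite /acc lm_pid // lw_pid // man_row_S Ee /= El eqxx /= !inE eqxx orbT /=.
    by rewrite woman_row_pos ?t0 // Ee /= eqxx /= !inE eqxx orbT.
  rewrite hinv_pid // /hinv0 eqn0Ngt t0 V3 (valS_lo _ Ee) // -El V2 /= Ee /= El.
  by [].
by rewrite /wf ltnNge (ltnW Hm) /= gtn_eqF.
Qed.

(** The chosen woman and the man who moved on from her; at the end of a chain this man is [N], who
    is with the distinguished woman. *)
Definition faults : seq (nat * nat) :=
  [seq (if (c i).+1 == n then N else pid 0 (i * n + c i), pid 0 (i * n + c i)) | i <- iota 0 g].

Lemma index_le1 (x y : nat) s : index y (x :: y :: s) <= 1.
Proof. by rewrite /= eqxx; case: eqP. Qed.

Lemma index_gt0 (x y : nat) s : y != x -> 0 < index y (x :: s).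
Proof. by rewrite /= eq_sym => /negbTE ->. Qed.

Lemma nval_lost t l : nval t l -> ~~ nval t.+1 l ->
  exists2 e, evl t = [:: e] & l = e.2 /\ ~~ nval t e.1.
Proof.
case: (evlP t) => [E0|[e /EL[H1 H2 H3] [Ee _ _]]].
  by rewrite valS_none // => ->.
have [->|N1] := eqVneq l e.1.
  by rewrite (valS_hi _ Ee) => ->.
have [->|N2] := eqVneq l e.2.
  by rewrite (valS_lo _ Ee) // => -> ; rewrite andbT => V1; exists e.
by rewrite (valS_other _ Ee) // => ->.
Qed.

Lemma shifted_husband l : l < L -> c (l %/ n) < l %% n ->
  wf (pid 0 l.-1) = Some (pid 0 l) /\ index (pid 0 l.-1) (woman_row 0 l) = 0.
Proof.
move=> Hl Hp; rewrite wf_pid ?pred_lt // /wf0 /woman_row /=.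
have l0 : l %% n == 0 = false by apply: gtn_eqF; apply: leq_trans Hp.
have El : l.-1.+1 = l by case: l l0 {Hp Hl} => //; rewrite mod0n.
rewrite El l0 /= eqxx; split=> //.
have nd : n %| l.-1.+1 = false by rewrite El.
move: Hp; rewrite -El divnS ?(ltnW n2) // modnS nd add0n ltnS => Hp.
by rewrite ltnNge Hp.
Qed.

Lemma last_pos l : l < L -> (l.+1 %% n == 0) = ((l %% n).+1 == n).
Proof.
move=> Hl; rewrite {1}(divn_eq l n) lane_last // ltn_pmod // ltnW //.
Qed.

Lemma default_husband t l : l < L -> t <= T -> 0 < t -> ~~ nval t l ->
  wf (pid t l) = Some (pid t l) /\ index (pid t l) (woman_row t l) = 0.
Proof.
move=> Hl Ht t0 V; rewrite wf_pid // /wf0 eqn0Ngt t0 V; split=> //.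
by have [s ->] := woman_row_head l t0; rewrite /= eqxx.
Qed.

(** If no token arrives, the woman was never free, or the upper man of a comparator took her, or at
    time [0] her chain serves her. *)
Lemma good_husband t l : l < L -> t < T -> ~~ nval t.+1 l ->
  exists2 m', wf m' = Some (pid t l) &
    index m' (woman_row t l) <= index (pid t.+1 l) (woman_row t l).
Proof.
move=> Hl Ht V1; have Ht' := ltnW Ht; case: (boolP (nval t l)) => V0.
  have [e Ee [El V2]] := nval_lost V0 V1.
  have [_ H1 H2 H3 /andP[t0 tT]] : [/\ evl t = [:: e], e.1 < L, e.2 < L, e.1 != e.2 & 0 < t < T].
    by apply: evl_mem; rewrite Ee mem_head.
  exists (pid t.+1 e.1).
    rewrite wf_pid // /wf0 (valS_hi _ Ee) (negbTE V2) -El V0 /= Ee /= El.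
    by [].
  rewrite El (woman_row_lo Ee) ?t0 //.
  apply: leq_trans (index_le1 _ _ _) (index_gt0 _ _).
  by rewrite pid_eq // gtn_eqF.
case: (posnP t) => [t0|t0]; last first.
  have [W1 W2] := default_husband Hl Ht' t0 V0.
  by exists (pid t l) => //; rewrite W2.
rewrite t0 in V0 *; move: V0; rewrite /= /choice_state neq_ltn => /orP[Hp|Hp].
  by have [W1 W2] := shifted_husband Hl Hp; exists (pid 0 l.-1) => //; rewrite W2.
have Hi : l %/ n < g by rewrite ltn_divLR // ltnW.
have Hn : l.+1 %% n == 0 = false.
  by rewrite last_pos // ltn_eqF // (leq_ltn_trans Hp) // Hc.
exists (pid 0 l); first by rewrite wf_pid // /wf0 /= Hn Hp.
have -> : woman_row 0 l =
    (if l %% n == 0 then [::] else [:: pid 0 l.-1]) ++ [:: pid 0 l; pid 1 l].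
  by rewrite /woman_row /= Hn.
case: ifP => _; first by rewrite /= eqxx.
apply: leq_trans (index_le1 _ _ _) (index_gt0 _ _).
by rewrite pid_eq // pred_lt.
Qed.

(** A man without a token has his last choice, so all women before it must be content. A man with a
    token has his first choice, or his second while the first is with her own man. *)
Lemma forward_nonblocking m w : m < N.+1 -> w < N.+1 -> w \in lm m -> m \in lw w ->
  (m, w) \in faults \/
     (exists2 w', wf m = Some w' & index w' (lm m) <= index w (lm m)) \/
     (exists2 m', wf m' = Some w & index m' (lw w) <= index m (lw w)).
Proof.
move=> Hm _; move: Hm; rewrite ltnS leq_eqVlt => /orP[/eqP->|/pidP[t [l [Ht Hl ->]]]].
  rewrite lmN mem_cat !inE => /orP[/mapP[i]|/orP[/eqP->|/eqP->]].
  - rewrite mem_iota => /andP[_ Hi] -> _; have HlL := group_last Hi.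
    have np : n.-1.+1 = n by rewrite prednK // ltnW.
    have ln : n.-1 < n by rewrite np.
    have [Ec|Nc] := eqVneq (c i) n.-1.
      left; apply/mapP; exists i; first by rewrite mem_iota.
      by rewrite Ec np eqxx.
    right; right; have Hp : c ((i * n + n.-1) %/ n) < (i * n + n.-1) %% n.
      by rewrite lane_div // lane_mod // ltn_neqAle Nc -ltnS np Hc.
    have [W1 W2] := shifted_husband HlL Hp.
    by exists (pid 0 (i * n + n.-1).-1) => //; rewrite lw_pid // W2.
  - move=> _; right; right; have [W1 W2] := @default_husband T H HL (leqnn T) isT HH.
    by exists (pid T H) => //; rewrite lw_pid // W2.
  - by move=> _; right; left; exists N; first exact: wfN.
rewrite lm_pid //; case: t Ht => [|t] Ht.
  rewrite /man_row /=; case: ifP => // Hn; rewrite !inE => Hw _.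
  have := wf_pid Hl Ht; rewrite /wf0 /= Hn; case: ltnP => Hp Wm.
    by right; left; exists (pid 0 l) => //; rewrite eqxx.
  case/orP: Hw => /eqP ->; last by right; left; exists (pid 0 l.+1).
  move: Hp; rewrite leq_eqVlt => /orP[/eqP Ep|Hp].
    left; apply/mapP; exists (l %/ n).
      by rewrite mem_iota /= ltn_divLR // ltnW.
    by rewrite Ep -last_pos // Hn -divn_eq.
  right; right; have [W1 W2] := shifted_husband Hl Hp.
  by exists (pid 0 l.-1) => //; rewrite lw_pid // W2.
have Ht' := ltnW Ht.
have Wm : wf (pid t.+1 l) = Some (if ~~ nval t.+1 l then pid t.+1 l
    else if nval t l then pid t l else pid t (head (0, 0) (evl t)).2) by exact: wf_pid.
rewrite man_row_S; case: (boolP (nval t.+1 l)) Wm => V1 Wm; last first.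
  rewrite inE mem_cat mem_seq1 => /or3P[/eqP->|/mapP[e He ->]|/eqP->] _.
  - right; right; have [m' W1 W2] := good_husband Hl Ht V1.
    by exists m' => //; rewrite lw_pid.
  - right; right; move: He; rewrite mem_filter => /andP[/eqP E1 /evl_mem[Ee H1 H2 H3 /andP[t0 tT]]].
    have V2 : ~~ nval t e.2 by move: V1; rewrite -E1 (valS_hi _ Ee) negb_or => /andP[].
    have [W1 W2] := default_husband H2 Ht' t0 V2.
    by exists (pid t e.2) => //; rewrite lw_pid // W2.
  - by right; left; exists (pid t.+1 l).
rewrite [~~ true]/= in Wm; case: (boolP (nval t l)) Wm => V0 Wm.
  by move=> _ _; right; left; exists (pid t l) => //; rewrite /= eqxx.
have [e Ee [El V2]] := nval_new V1 V0.
have [_ H1 H2 H3 /andP[t0 tT]] : [/\ evl t = [:: e], e.1 < L, e.2 < L, e.1 != e.2 & 0 < t < T].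
  by apply: evl_mem; rewrite Ee mem_head.
rewrite Ee /= in Wm.
have -> : pid t l :: [seq pid t p.2 | p <- evl t & p.1 == l] ++ [:: pid t.+1 l] =
    [:: pid t l; pid t e.2; pid t.+1 l] by rewrite Ee /= -El eqxx.
rewrite !inE => /or3P[] /eqP -> _.
- right; right; have [W1 W2] := default_husband Hl Ht' t0 V0.
  by exists (pid t l) => //; rewrite lw_pid // W2.
- by right; left; exists (pid t e.2).
- right; left; exists (pid t e.2) => //.
  apply: leq_trans (index_le1 _ _ _) (index_gt0 _ _).
  by rewrite pid_eq // gtn_eqF.
Qed.

Lemma net_smc_sat : smc_solvable net_smc g.
Proof.
apply: (@smc_solvable_of _ _ _ _ _ _ lm_bound lw_bound wf hinv faults).
- exact: wf_ok.
- by exists N; exact: wfN.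
- exact: forward_nonblocking.
- by rewrite size_map size_iota.
Qed.

End Forward.

Lemma index_succ (x y : nat) s r : uniq (s ++ x :: y :: r) ->
  index x (s ++ x :: y :: r) < index y (s ++ x :: y :: r).
Proof.
rewrite cat_uniq => /and3P[_ /hasPn Hn /andP[]]; rewrite inE => /norP[/negbTE Nxy _] _.
have /negbTE Nx : x \notin s by apply: Hn; rewrite inE eqxx.
have /negbTE Ny : y \notin s by apply: Hn; rewrite !inE eqxx orbT.
by rewrite !index_cat Nx Ny /= eqxx Nxy eqxx addn0 addn1.
Qed.

(** * From a matching to a harmless choice *)

Section Backward.
Variables wf hf : nat -> option nat.
Hypothesis Hwf : forall m w, wf m = Some w ->
  [/\ m < N.+1, w < N.+1, acc lm lw m w & hf w = Some m].
Hypothesis Hhf : forall m w, hf w = Some m -> wf m = Some w.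
Hypothesis Hs : hf N != None.
Hypothesis HB : forall F : seq (nat * nat), uniq F ->
  (forall p, p \in F -> p.1 < N.+1 /\ p.2 < N.+1 /\ nblock lm lw wf hf p.1 p.2) -> size F <= g.

Definition chain_man (i v : nat) : nat := if v.+1 == n then N else pid 0 (i * n + v).

Lemma wfN_back : wf N = Some N.
Proof.
move: Hs; case Eh: (hf N) => [m|] // _; have Em := Hhf Eh.
have [_ _ /andP[_ A] _] := Hwf Em; move: A; rewrite lwN inE => /eqP E1.
by rewrite -{1}E1.
Qed.

Lemma woman_row0 i v : v < n -> woman_row 0 (i * n + v) =
  (if v == 0 then [::] else [:: pid 0 (i * n + v).-1]) ++
  [:: chain_man i v; pid 1 (i * n + v)].
Proof. by move=> Hv; rewrite /woman_row lane_mod // lane_last. Qed.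

Lemma chain_man_lt i v : i < g -> v < n -> chain_man i v < N.+1.
Proof.
by move=> Hi Hv; rewrite /chain_man; case: eqP => // _; rewrite pid_ltS // lane_lt.
Qed.

Lemma chain_man_acc i v : i < g -> v < n -> acc lm lw (chain_man i v) (pid 0 (i * n + v)).
Proof.
move=> Hi Hv; have Hl := lane_lt Hi Hv;
  rewrite /acc lw_pid // woman_row0 // mem_cat !inE eqxx /= orbT andbT.
rewrite /chain_man; case: eqP => [E1|/eqP N1].
  rewrite lmN mem_cat; apply/orP; left; apply/mapP; exists i; first by rewrite mem_iota.
  by rewrite -E1.
by rewrite lm_pid // /man_row /= lane_last // (negbTE N1) mem_head.
Qed.

Lemma nonblocking_cases m w : acc lm lw m w -> ~~ nblock lm lw wf hf m w ->
  (exists2 w', wf m = Some w' & index w' (lm m) <= index w (lm m)) \/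
  (exists2 m', wf m' = Some w & index m' (lw w) <= index m (lw w)).
Proof.
rewrite /nblock => -> /=; rewrite negb_and => /orP[].
  by case: (wf m) => // w'; rewrite -leqNgt; left; exists w'.
by case E1: (hf w) => [m'|] //; rewrite -leqNgt; right; exists m' => //; apply: Hhf.
Qed.

Lemma index_last_group i : i < g -> index (pid 0 (i * n + n.-1)) last_man < index N last_man.
Proof.
move=> Hi; rewrite /last_man !index_cat.
have -> : pid 0 (i * n + n.-1) \in [seq pid 0 (j * n + n.-1) | j <- iota 0 g].
  by apply/mapP; exists i => //; rewrite mem_iota.
case: ifP => [/mapP[j]|_].
  rewrite mem_iota => /andP[_ Hj] /eqP; rewrite eq_sym.
  by rewrite pid_neqN // group_last.
apply: leq_trans (leq_addr _ _); rewrite index_mem.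
by apply/mapP; exists i => //; rewrite mem_iota.
Qed.

(** If no pair of the chain blocked, dissatisfaction would travel from its end to its start: [N] is
    bound to the distinguished woman, and whenever the chain man of a woman is worse off than with
    her, she must have the man before him, who thereby misses his first choice. The first woman has
    no man before her chain man. *)
Lemma chain_blocking i : i < g ->
  has (fun v => nblock lm lw wf hf (chain_man i v) (pid 0 (i * n + v))) (iota 0 n).
Proof.
move=> Hi; apply: contraT => /hasPn NB.
pose Q v := exists2 y, wf (chain_man i v) = Some y &
  index (pid 0 (i * n + v)) (lm (chain_man i v)) < index y (lm (chain_man i v)).
have Q0 : forall k, k < n -> Q (n.-1 - k).
  elim=> [|k IH] Hk.
    rewrite subn0 /Q /chain_man prednK ?(ltnW n2) // eqxx; exists N; first exact: wfN_back.
    by rewrite lmN index_last_group.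
  have [y Ey Ly] := IH (ltnW Hk); set v := n.-1 - k in Ey Ly *.
  have Hv : v < n by rewrite /v; lia.
  have v0 : 0 < v by rewrite /v; lia.
  have -> : n.-1 - k.+1 = v.-1 by rewrite /v; lia.
  have Hv' : v.-1.+1 == n = false by rewrite prednK // ltn_eqF.
  have /NB : v \in iota 0 n by rewrite mem_iota.
  case/(nonblocking_cases (chain_man_acc Hi Hv)) => [[w']|[m' Em HI]].
    by rewrite Ey => -[<-]; rewrite leqNgt Ly.
  have [_ _ /andP[_ Hm] _] := Hwf Em; have Hl := lane_lt Hi Hv.
  have Hp : (i * n + v).-1 = i * n + v.-1 by rewrite -subn1 -addnBA // subn1.
  have Er : lw (pid 0 (i * n + v)) =
      [:: pid 0 (i * n + v.-1)] ++ [:: chain_man i v; pid 1 (i * n + v)].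
    by rewrite lw_pid // woman_row0 // (gtn_eqF v0) Hp.
  have U := lw_uniq (pid 0 (i * n + v)); rewrite Er in Hm HI U.
  move: Hm; rewrite !inE => /or3P[] /eqP E1; first 1 last.
  - by move: Ly; rewrite E1 in Em; move: Em; rewrite Ey => -[->]; rewrite ltnn.
  - by move: HI; rewrite E1 leqNgt index_succ.
  exists (pid 0 (i * n + v)); first by rewrite /chain_man Hv' -E1.
  have Hl' : i * n + v.-1 < L by apply: lane_lt => //; lia.
  have Er' : lm (chain_man i v.-1) = [::] ++ [:: pid 0 (i * n + v.-1); pid 0 (i * n + v)].
    have Hv2 : v.-1 < n by lia.
    rewrite /chain_man Hv' lm_pid // /man_row /= lane_last // Hv' -addnS prednK //.
  by have := lm_uniq (chain_man i v.-1); rewrite Er'; apply: index_succ.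
have [y Ey Ly] : Q 0.
  by have := Q0 n.-1; rewrite subnn; apply; rewrite prednK // ltnW.
have n0 : 0 < n by exact: ltnW.
have /NB : 0 \in iota 0 n by rewrite mem_iota.
case/(nonblocking_cases (chain_man_acc Hi n0)) => [[w']|[m' Em HI]].
  by rewrite Ey => -[<-]; rewrite leqNgt Ly.
have Hl := lane_lt Hi n0; have [_ _ /andP[_ Hm] _] := Hwf Em.
have Er : lw (pid 0 (i * n + 0)) = [::] ++ [:: chain_man i 0; pid 1 (i * n + 0)].
  by rewrite lw_pid // woman_row0.
have U := lw_uniq (pid 0 (i * n + 0)); rewrite Er in Hm HI U.
move: Hm; rewrite !inE => /orP[] /eqP E1.
  by move: Ly; rewrite E1 in Em; move: Em; rewrite Ey => -[->]; rewrite ltnn.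
by move: HI; rewrite E1 leqNgt index_succ.
Qed.

Definition fault_pos (i : nat) : nat :=
  find (fun v => nblock lm lw wf hf (chain_man i v) (pid 0 (i * n + v))) (iota 0 n).

Lemma fault_posP i : i < g -> fault_pos i < n /\
  nblock lm lw wf hf (chain_man i (fault_pos i)) (pid 0 (i * n + fault_pos i)).
Proof.
move=> Hi; have := chain_blocking Hi; have Hh := Hi; rewrite has_find size_iota => Hf.
split=> //; have := nth_find 0 (chain_blocking Hi).
by rewrite nth_iota // add0n.
Qed.

(** The [g] chains already exhaust the budget; a further blocking pair would give a list of length
    [g.+1]. *)
Lemma other_nonblocking m w : acc lm lw m w -> m < N.+1 -> w < N.+1 ->
  (forall i, i < g -> m != chain_man i (fault_pos i) \/ w != pid 0 (i * n + fault_pos i)) ->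
  ~~ nblock lm lw wf hf m w.
Proof.
move=> A Hm Hw Hne; apply/negP => B.
pose F := [seq (chain_man i (fault_pos i), pid 0 (i * n + fault_pos i)) | i <- iota 0 g].
have nF : (m, w) \notin F.
  apply/mapP => -[i]; rewrite mem_iota => /andP[_ Hi] [E1 E2].
  by case: (Hne _ Hi); rewrite ?E1 ?E2 eqxx.
have := @HB ((m, w) :: F); rewrite /= size_map size_iota ltnn => K.
suff : false by []. apply: K.
  rewrite nF map_inj_in_uniq ?iota_uniq // => i j;
    rewrite !mem_iota => /andP[_ Hi] /andP[_ Hj] [_ EE].
  have [Fi _] := fault_posP Hi; have [Fj _] := fault_posP Hj.
  have [_] := pid_inj (lane_lt Hi Fi) (lane_lt Hj Fj) EE.
  by move/(congr1 (divn^~ n)); rewrite !lane_div.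
move=> p; rewrite inE => /orP[/eqP->//|/mapP[i]].
rewrite mem_iota => /andP[_ Hi] -> /=; have [Fi Bi] := fault_posP Hi.
split; first exact: chain_man_lt.
by split=> //; rewrite pid_ltS // lane_lt.
Qed.

Notation nval := (nval fault_pos).

Definition downstream (t l : nat) : seq nat :=
  [seq pid t.+1 p.1 | p <- evl t & p.2 == l] ++ [:: pid t.+1 l].

(** An unmatched woman counts as vacated: what matters is that no man above the downstream ones
    holds her. *)
Definition vacated (t l : nat) : Prop :=
  forall m, wf m = Some (pid t l) -> m \in downstream t l.

(** As the pair at the fault blocks, the woman's husband, if any, comes after her chain man, and
    only the man of time [1] does. *)
Lemma vacated0 l : l < L -> nval 0 l -> vacated 0 l.
Proof.
move=> Hl /eqP Ef m Em.
have Hi : l %/ n < g by rewrite ltn_divLR // ltnW.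
have [Hv /and3P[_ _]] := fault_posP Hi; set i := l %/ n in Hi Ef Hv *;
  set v := fault_pos i in Ef Hv *.
have El : i * n + v = l by rewrite Ef -divn_eq.
rewrite El; have [_ _ /andP[_ A] ->] := Hwf Em; rewrite lw_pid // in A *.
move: A; rewrite -El woman_row0 // mem_cat => /orP[|].
  by case: eqP => // v0; rewrite inE => /eqP ->; rewrite [index (pid 0 _.-1) _]/= eqxx ltn0.
rewrite !inE => /orP[/eqP->|/eqP-> _]; first by rewrite ltnn.
by [].
Qed.

(** The men in the faults are [N] or belong to time [0]. *)
Lemma row_nonblocking t l w : l < L -> 0 < t <= T -> w < N.+1 -> acc lm lw (pid t l) w ->
  (exists2 w', wf (pid t l) = Some w' & index w' (lm (pid t l)) <= index w (lm (pid t l))) \/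
  (exists2 m', wf m' = Some w & index m' (lw w) <= index (pid t l) (lw w)).
Proof.
move=> Hl /andP[t0 tT] Hw A; apply: nonblocking_cases => //; apply: other_nonblocking => //.
  by rewrite pid_ltS.
move=> i Hi; left; have [Fi _] := fault_posP Hi; rewrite /chain_man; case: ifP => _.
  by rewrite pid_neqN.
by rewrite pid_eq ?lane_lt // gtn_eqF.
Qed.

Lemma index0_head (x y : nat) s : index y (x :: s) = 0 -> y = x.
Proof. by rewrite /=; case: eqP. Qed.

(** She is his first choice. If he did not have her, she would have a husband at least as good as
    him, but he is her only downstream man. *)
Lemma pass_on t l : l < L -> t < T -> vacated t l -> (forall e, e \in evl t -> e.2 != l) ->
  wf (pid t.+1 l) = Some (pid t l).
Proof.
move=> Hl Ht V Nlo; have Ht' := ltnW Ht.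
have Dn : downstream t l = [:: pid t.+1 l].
  rewrite /downstream; have -> : [seq p <- evl t | p.2 == l] = [::]; last by [].
  by apply/eqP; rewrite -(negbK (_ == _)) -has_filter; apply/hasPn => e /Nlo.
have A : acc lm lw (pid t.+1 l) (pid t l).
  by rewrite /acc lm_pid // lw_pid // man_row_S mem_head mem_woman_last.
have Hw : pid t l < N.+1 by rewrite pid_ltS.
case: (row_nonblocking Hl _ Hw A); rewrite ?Ht //.
  move=> [w' Ew]; rewrite lm_pid // man_row_S [index (pid t l) _]/= eqxx leqn0 => /eqP /index0_head E1.
  by rewrite Ew E1.
by move=> [m' Em] _; have := V _ Em; rewrite Dn inE => /eqP <-.
Qed.

Lemma vacated_pos t l : l < L -> 0 < t < T -> wf (pid t l) <> Some (pid t l) -> vacated t l.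
Proof.
move=> Hl Ht Hn m Em; have [_ _ /andP[_ A] _] := Hwf Em; case/andP: (Ht) => t0 /ltnW tT.
move: A; rewrite lw_pid // woman_row_pos // inE => /orP[/eqP E1|//].
by case: Hn; rewrite -{1}E1.
Qed.

(** Induction on time. If only the lower lane of a comparator has a token, the upper man cannot stay
    with his own woman: he prefers the free lower woman, and she prefers him to the man of her lane.
    If both lanes have one, the upper man is taken by his own lane, and the lower woman is left to
    the lower man. *)
Lemma vacancy t l : l < L -> t <= T -> nval t l ->
  (t = 0 \/ wf (pid t l) <> Some (pid t l)) /\ (t < T -> vacated t l).
Proof.
elim: t l => [|t IH] l Hl Ht V.
  by split; [left|move=> _; exact: vacated0].
suff W : wf (pid t.+1 l) <> Some (pid t.+1 l).
  by split; [right|move=> HtT; apply: vacated_pos].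
have Ht' := ltnW Ht.
have Pass l' : l' < L -> nval t l' -> (forall e, e \in evl t -> e.2 != l') ->
    wf (pid t.+1 l') <> Some (pid t.+1 l').
  move=> Hl' V' Nlo; have [_ Vac] := IH l' Hl' Ht' V'.
  rewrite (pass_on Hl' Ht (Vac Ht) Nlo) => -[] /(pid_inj Hl' Hl')[E1 _].
  by move: E1; lia.
case: (evlP t) => [E0|[e He [Ee t0 tT]]].
  by apply: Pass => //; [move: V; rewrite valS_none|rewrite E0].
have [H1 H2 H3] := EL He.
have E1lo : forall e', e' \in evl t -> e'.2 != e.1.
  by move=> e'; rewrite Ee inE => /eqP ->; rewrite eq_sym.
have Hw : pid t e.2 < N.+1 by rewrite pid_ltS.
have [E1|N1] := eqVneq l e.1.
  move: V; rewrite E1 (valS_hi _ Ee) => /orP[V|V]; first by apply: Pass.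
  have A : acc lm lw (pid t.+1 e.1) (pid t e.2).
    rewrite /acc lm_pid // lw_pid // man_row_S woman_row_pos ?t0 // Ee /= !eqxx /= !inE eqxx orbT /=.
    by rewrite eqxx orbT.
  have [_ /(_ Ht) Vac] := IH e.2 H2 Ht' V.
  have Em1 : lm (pid t.+1 e.1) = [:: pid t e.1] ++ [:: pid t e.2; pid t.+1 e.1].
    by rewrite lm_pid // (man_row_hi Ee).
  have Ew1 : lw (pid t e.2) = [:: pid t e.2] ++ [:: pid t.+1 e.1; pid t.+1 e.2].
    by rewrite lw_pid // (woman_row_lo Ee) ?t0.
  have Um := lm_uniq (pid t.+1 e.1); have Uw := lw_uniq (pid t e.2).
  rewrite Em1 in Um; rewrite Ew1 in Uw.
  case: (row_nonblocking H1 _ Hw A); rewrite ?Ht //.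
    move=> [w' Ew]; rewrite Em1 => + Ew'.
    by rewrite Ew' in Ew; case: Ew => <-; rewrite leqNgt index_succ.
  move=> [m' Em HI]; rewrite Ew1 in HI.
  have := Vac _ Em; rewrite /downstream Ee /= eqxx !inE => /orP[] /eqP Em'.
    move: Em; rewrite Em' => -> -[] /eqP; rewrite pid_eq //.
    by rewrite ltn_eqF.
  by move: HI; rewrite Em' leqNgt index_succ.
have [E2|N2] := eqVneq l e.2; last first.
  apply: Pass => //; first by move: V; rewrite (valS_other _ Ee).
  by move=> e'; rewrite Ee inE => /eqP ->; rewrite eq_sym.
move: V; rewrite E2 (valS_lo _ Ee) // => /andP[V1 V2].
have [_ /(_ Ht) Vac1] := IH e.1 H1 Ht' V1.
have [_ /(_ Ht) Vac2] := IH e.2 H2 Ht' V2.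
have W1 := pass_on H1 Ht Vac1 E1lo.
have A : acc lm lw (pid t.+1 e.2) (pid t e.2).
  by rewrite /acc lm_pid // lw_pid // man_row_S mem_head mem_woman_last.
suff -> : wf (pid t.+1 e.2) = Some (pid t e.2).
  by move=> [] /(pid_inj H2 H2)[]; lia.
case: (row_nonblocking H2 _ Hw A); rewrite ?Ht //.
  move=> [w' Ew]; rewrite lm_pid // man_row_S [index (pid t e.2) _]/= eqxx leqn0 => /eqP /index0_head E3.
  by rewrite Ew E3.
move=> [m' Em] _; have := Vac2 _ Em; rewrite /downstream Ee /= eqxx /= !inE => /orP[] /eqP E3.
  move: Em; rewrite E3 W1 => -[] /(pid_inj H1 H2)[_ E4].
  by move: H3; rewrite E4 eqxx.
by rewrite -E3.
Qed.

(** A vacant woman at the end of lane [H] has no other man than [N], who is bound to the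
    distinguished woman and prefers her; the two would block outside the chains. *)
Lemma harm_free : ~~ nval T H.
Proof.
apply/negP => V; have [[//|W] _] := vacancy HL (leqnn T) V.
have A : acc lm lw N (pid T H).
  by rewrite /acc lmN lw_pid // woman_row_T eqxx mem_cat !inE !eqxx !orbT.
have Hw : pid T H < N.+1 by rewrite pid_ltS.
have NB : ~~ nblock lm lw wf hf N (pid T H).
  apply: other_nonblocking => // i Hi; right; have [Fi _] := fault_posP Hi.
  by rewrite pid_eq ?lane_lt.
case: (nonblocking_cases A NB) => [[w']|[m' Em]].
  rewrite wfN_back => -[<-]; rewrite lmN /last_man !index_cat.
  have -> : N \in [seq pid 0 (i * n + n.-1) | i <- iota 0 g] = false.
    apply/mapP => -[j]; rewrite mem_iota => /andP[_ Hj] /eqP; rewrite eq_sym.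
    by rewrite pid_neqN // group_last.
  have -> : pid T H \in [seq pid 0 (i * n + n.-1) | i <- iota 0 g] = false.
    apply/mapP => -[j]; rewrite mem_iota => /andP[_ Hj] /eqP.
    by rewrite pid_eq ?group_last.
  by rewrite leq_add2l /= eqxx pid_neqN // eqxx.
have [_ _ /andP[_]] := Hwf Em; rewrite lw_pid // woman_row_T eqxx !inE => /orP[] /eqP E1 _ _.
  by apply: W; rewrite -{1}E1.
by move: Em; rewrite E1 wfN_back => -[] /eqP; rewrite eq_sym pid_neqN.
Qed.

End Backward.

Theorem net_smcP : smc_solvable net_smc g <->
  exists2 c : nat -> nat, forall i, i < g -> c i < n & ~~ run E (choice_state n c) H.
Proof.
split=> [/(smc_solvableP _ lm_bound lw_bound)|[c Hc]]; last first.
  by rewrite -val_final => HH; exact: net_smc_sat Hc HH.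
move=> [wf [hf [Hwf Hhf Hs HB]]]; exists (fault_pos wf hf).
  by move=> i Hi; have [] := fault_posP Hwf Hhf Hs Hi.
by rewrite -val_final; apply: harm_free.
Qed.

End Network.

(** * Invariants of comparator sequences *)

Section Events.
Implicit Types (s : nat -> bool) (e : nat * nat) (es : seq (nat * nat)).

Lemma step_mono l e s : e.2 != l -> s l -> step s e l.
Proof.
move=> /negbTE N2 Hs; rewrite /step; case: eqP => [<-|_]; first by rewrite Hs.
by rewrite eq_sym N2.
Qed.

Lemma run_mono l es s : all (fun e => e.2 != l) es -> s l -> run es s l.
Proof.
elim: es s => //= e es IH s /andP[He Hes] Hs; apply: IH => //.
exact: step_mono.
Qed.

Lemma step_ext s s' e : s =1 s' -> step s e =1 step s' e.
Proof. by move=> Es l; rewrite /step !Es. Qed.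

Lemma run_ext es s s' : s =1 s' -> run es s =1 run es s'.
Proof. by elim: es s s' => //= e es IH s s' Es; apply: IH; apply: step_ext. Qed.

Lemma run_idle es s : {in es, forall e, s e.1 || ~~ s e.2} -> run es s =1 s.
Proof.
elim: es s => //= e es IH s Hes.
have Es : step s e =1 s.
  move=> l; have := Hes e (mem_head _ _); rewrite /step.
  case: eqP => [->|_]; first by case: (s e.1); case: (s e.2).
  by case: eqP => [->|//]; case: (s e.1); case: (s e.2).
move=> l; rewrite IH ?Es // => e' He'; rewrite !Es; apply: Hes.
by rewrite inE He' orbT.
Qed.

(** The token waits on [l] for the first comparator having [l] below; after it [h] carries a token
    in any case, and never loses it. *)
Lemma run_harm es s l h : s l -> l != h -> has (fun e => e.2 == l) es ->
  {in es, forall e, e.2 == l -> e.1 = h} -> all (fun e => e.2 != h) es -> run es s h.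
Proof.
move=> + Nl; elim: es s => //= e es IH s Hs.
case: (eqVneq e.2 l) => /= [E2 _|N2 Hes] Hh /andP[Nh Nes].
  apply: run_mono => //; rewrite /step -(Hh e (mem_head _ _)) ?E2 // eqxx.
  by rewrite Hs orbT.
apply: IH => //; first exact: step_mono.
by move=> e' He'; apply: Hh; rewrite inE He' orbT.
Qed.

(** A comparator meeting an empty upper lane would move the token of [l] there, where it would
    remain to the end, against the last hypothesis. So the token never leaves [l], and every upper
    lane read was occupied from the start. *)
Lemma run_reads es s l : s l ->
  {in es, forall e, e.2 == l -> all (fun e' => e'.2 != e.1) es} ->
  {in es, forall e, e.2 == l -> run es s e.1 -> s e.1} ->
  {in es, forall e, e.2 == l -> s e.1}.
Proof.
elim: es s => // e es IH s Hs H1 H2.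
have Mono e' : e' \in e :: es -> e'.2 == l -> s e'.1 -> run es (step s e) e'.1.
  move=> He' El Hs'; have /andP[N1 N2] := H1 _ He' El.
  by apply: run_mono => //; apply: step_mono.
have Mono2 e' : e' \in e :: es -> e'.2 == l -> step s e e'.1 -> s e'.1.
  move=> He' El Hs'; have /andP[N1 N2] := H1 _ He' El.
  by apply: (H2 _ He' El); apply: (@run_mono _ es).
have Head : e.2 == l -> s e.1.
  move=> El; apply: (Mono2 e (mem_head _ _) El).
  by rewrite /step eqxx (eqP El) Hs orbT.
have Hs' : step s e l.
  case: (eqVneq e.2 l) => [E2|N2]; last exact: step_mono.
  by rewrite /step E2 eqxx Hs orbT andbT Head ?E2 //; case: ifP.
move=> e' He' El; move: (He'); rewrite inE => /orP[/eqP Ee|Hes].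
  by rewrite Ee; apply: Head; rewrite -Ee.
apply: (Mono2 _ He' El).
apply: (IH _ Hs' _ _ e' Hes El) => e1 He1 El1.
  by have /andP[] : all (fun e' => e'.2 != e1.1) (e :: es) by apply: H1 => //; rewrite inE He1 orbT.
move=> R; have He1' : e1 \in e :: es by rewrite inE He1 orbT.
have /andP[N1 _] := H1 _ He1' El1.
by apply: step_mono => //; apply: (H2 _ He1' El1).
Qed.

(** The first token met is parked on [acc]; any further one finds [acc] occupied, stays, and is
    offered to [h] by the next comparator. *)
Definition scan (acc h : nat) (f : nat -> nat) (us : seq nat) : seq (nat * nat) :=
  flatten [seq [:: (acc, f u); (h, f u)] | u <- us].

Lemma scan_two acc h f us s : acc != h -> uniq us -> injective f ->
  all (fun u => (f u != acc) && (f u != h)) us ->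
  1 < s acc + count (fun u => s (f u)) us -> run (scan acc h f us) s h.
Proof.
move=> Nah + Inj; elim: us s => [|u us IH] s /=; first by case: (s acc).
move=> /andP[Nu Uu] /andP[/andP[Na Nh] /allP Nus] Hc.
have Lo : all (fun e => e.2 != h) (scan acc h f us).
  apply/allP => e /flattenP[x /mapP[y /Nus/andP[_ N2] ->]].
  by rewrite !inE => /orP[] /eqP -> /=.
have Ea : step (step s (acc, f u)) (h, f u) acc = s acc || s (f u).
  by rewrite /step /= (negbTE Nah) [acc == f u]eq_sym (negbTE Na) eqxx.
have Eh : step (step s (acc, f u)) (h, f u) h = s h || s acc && s (f u).
  by rewrite /step /= !eqxx (negbTE Na) ![h == _]eq_sym (negbTE Nah) (negbTE Nh).
have Eo v : v \in us -> step (step s (acc, f u)) (h, f u) (f v) = s (f v).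
  move=> Hv; have /andP[Na' Nh'] := Nus _ Hv.
  have Nv : v != u by apply: contraNneq Nu => <-.
  by rewrite /step /= (negbTE Na') (negbTE Nh') (inj_eq Inj) (negbTE Nv).
(* Either a second token is met here and [h] is reached for good, or the number of tokens on [acc]
   and the remaining lanes is unchanged. *)
rewrite /scan /= -/(scan _ _ _ _); case: (boolP (s acc && s (f u))) => B.
  by apply: run_mono => //; rewrite Eh B orbT.
apply: IH => //; first exact/allP.
rewrite Ea (eq_in_count Eo).
by move: Hc B; case: (s acc); case: (s (f u)).
Qed.

End Events.

(** * Constraints as networks *)

(* A constraint lists its options; an option lists the values it requires. *)
Definition csp_sat (cons : seq (seq (seq (nat * nat)))) : Prop :=
  exists a : nat -> nat, forall C, C \in cons ->
    exists2 p, p \in C & all (fun r => a r.1 == r.2) p.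

Section Csp.
Variables (nv n0 : nat) (cons : seq (seq (seq (nat * nat)))).

Let n := n0.+2.
Let nc := size cons.
Let g := nv + nc.

Definition lane (j u : nat) : nat := j * n0.+2 + u.
Definition harm : nat := lane 0 n0.+1.
Definition copt (k : nat) : seq (seq (nat * nat)) := nth [::] cons k.

(* The lanes [u < n0] of a group are the values of its variable; [n0] serves as
   an accumulator and [n0.+1] is unused, except in group [0], where it is the
   lane [harm] collecting the violations. *)
Definition trash_events : seq (nat * nat) :=
  [seq (harm, lane j n0) | j <- iota 0 (nv + size cons)] ++
  [seq (harm, lane j n0.+1) | j <- iota 1 (nv + size cons).-1] ++
  flatten [seq [seq (harm, lane (nv + k) p) | p <- iota (size (copt k)) (n0 - size (copt k))]
          | k <- iota 0 (size cons)].

Definition read_events : seq (nat * nat) :=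
  flatten [seq flatten [seq [seq (lane r.1 r.2, lane (nv + k) p) | r <- nth [::] (copt k) p]
                       | p <- iota 0 (size (copt k))]
          | k <- iota 0 (size cons)].

(** [amo] stands for at most one: a second token in the group of a variable is reported to
    [harm]. *)
Definition amo_events : seq (nat * nat) :=
  flatten [seq scan (lane i n0) harm (lane i) (iota 0 n0) | i <- iota 0 nv].

Definition csp_events : seq (nat * nat) := trash_events ++ read_events ++ amo_events.

Hypothesis nv0 : 0 < nv.
Hypothesis n00 : 0 < n0.
Hypothesis Hopt : forall C, C \in cons -> size C <= n0.
Hypothesis Hread : forall C p r, C \in cons -> p \in C -> r \in p -> r.1 < nv /\ r.2 < n0.

Lemma lane_inj j j' u u' : u < n -> u' < n -> lane j u = lane j' u' -> j = j' /\ u = u'.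
Proof.
move=> Hu Hu' E.
have E1 : lane j u %/ n = lane j' u' %/ n by rewrite E.
have E2 : lane j u %% n = lane j' u' %% n by rewrite E.
by move: E1 E2; rewrite /lane !divnMDl // !modnMDl !divn_small // !addn0 !modn_small.
Qed.

Lemma lane_eq j j' u u' : u < n -> u' < n -> (lane j u == lane j' u') = (j == j') && (u == u').
Proof.
by move=> Hu Hu'; apply/eqP/andP => [/(lane_inj Hu Hu')[-> ->]|[/eqP-> /eqP->]].
Qed.

Lemma choice_state_lane c j u : u < n -> choice_state n c (lane j u) = (c j == u).
Proof.
by move=> Hu; rewrite /choice_state /lane divnMDl // modnMDl divn_small // modn_small // addn0.
Qed.

Lemma copt_mem k : k < nc -> copt k \in cons.
Proof. exact: mem_nth. Qed.

Lemma copt_size k : size (copt k) <= n0.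
Proof.
rewrite /copt; case: (ltnP k nc) => Hk; first by apply: Hopt; apply: mem_nth.
by rewrite nth_default.
Qed.

Lemma trash_eventsP e : e \in trash_events -> e.1 = harm /\
  exists j u, [/\ e.2 = lane j u, j < g, u < n, (j, u) != (0, n0.+1) &
    u < n0 -> nv <= j /\ size (copt (j - nv)) <= u].
Proof.
rewrite mem_cat => /orP[/mapP[j]|]; last rewrite mem_cat => /orP[/mapP[j]|/flattenP[x /mapP[k]]].
- rewrite mem_iota => /andP[_ Hj] ->; split=> //; exists j, n0; split=> //.
    by rewrite xpair_eqE [n0 == _]ltn_eqF ?andbF.
  by rewrite ltnn.
- rewrite mem_iota => /andP[j1 Hj] ->; split=> //; exists j, n0.+1; split=> //.
  + by rewrite /g /nc; lia.
  + by rewrite xpair_eqE gtn_eqF.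
  + by rewrite ltnNge leqnSn.
- rewrite mem_iota => /andP[_ Hk] -> /mapP[p]; rewrite mem_iota => /andP[p1 p2] ->.
  split=> //; exists (nv + k), p; have Hp : p < n0 by have := copt_size k; lia.
  split=> //; first by rewrite ltn_add2l.
  + by rewrite /n; lia.
  + by rewrite xpair_eqE gtn_eqF // addn_gt0 nv0.
  + by rewrite leq_addr addKn.
Qed.

Lemma read_eventsP e : e \in read_events ->
  exists k p r, [/\ k < nc, p < size (copt k), r \in nth [::] (copt k) p &
    e = (lane r.1 r.2, lane (nv + k) p)].
Proof.
move=> /flattenP[x /mapP[k]]; rewrite mem_iota => /andP[_ Hk] -> /flattenP[y /mapP[p]].
rewrite mem_iota => /andP[_ Hp] -> /mapP[r Hr ->].
by exists k, p, r.
Qed.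

Lemma read_bound k p r : k < nc -> p < size (copt k) -> r \in nth [::] (copt k) p ->
  r.1 < nv /\ r.2 < n0.
Proof. by move=> Hk Hp; apply: Hread; [apply: copt_mem|apply: mem_nth]. Qed.

Lemma amo_eventsP e : e \in amo_events ->
  exists i u, [/\ i < nv, u < n0, e.1 = lane i n0 \/ e.1 = harm & e.2 = lane i u].
Proof.
move=> /flattenP[x /mapP[i]]; rewrite mem_iota => /andP[_ Hi] -> /flattenP[y /mapP[u]].
rewrite mem_iota => /andP[_ Hu] ->.
by rewrite !inE => /orP[] /eqP ->; exists i, u; split=> //; [left|right].
Qed.

Lemma csp_events_cases e : e \in csp_events ->
  [\/ e \in trash_events, e \in read_events | e \in amo_events].
Proof.
rewrite /csp_events mem_cat => /orP[H|]; first by constructor 1.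
by rewrite mem_cat => /orP[H|H]; [constructor 2|constructor 3].
Qed.

Lemma lane_bound j u : j < g -> u < n -> lane j u < g * n.
Proof.
move=> Hj Hu; have : j.+1 * n <= g * n by rewrite leq_mul2r Hj orbT.
by rewrite mulSn /lane /n; lia.
Qed.

Lemma g_gt0 : 0 < g. Proof. by rewrite addn_gt0 nv0. Qed.

Lemma harm_bound : harm < g * n.
Proof. exact: lane_bound g_gt0 _. Qed.

Lemma csp_events_bound e : e \in csp_events -> [/\ e.1 < g * n, e.2 < g * n & e.1 != e.2].
Proof.
case/csp_events_cases => [/trash_eventsP[-> [j [u [-> Hj Hu Hne _]]]]||].
- split; [exact: harm_bound|exact: lane_bound|].
  rewrite /harm lane_eq // -[_ && _]/(( 0, n0.+1) == (j, u)).
  by rewrite eq_sym.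
- move=> /read_eventsP[k [p [r [Hk Hp Hr ->]]]] /=.
  have [R1 R2] := read_bound Hk Hp Hr; have := copt_size k => Hs.
  have Hp' : p < n by rewrite /n; lia.
  have Hr' : r.2 < n by rewrite /n; lia.
  split; [apply: lane_bound => //; exact: ltn_addr|by apply: lane_bound; rewrite ?ltn_add2l|].
  by rewrite lane_eq // ltn_eqF // (leq_trans R1) // leq_addr.
- move=> /amo_eventsP[i [u [Hi Hu He ->]]].
  have Hi' : i < g by exact: ltn_addr.
  have Hu' : u < n by rewrite /n; lia.
  have Hn : n0 < n by rewrite /n; lia.
  case: He => ->; split; try exact: harm_bound; try exact: lane_bound.
    by rewrite lane_eq // [n0 == _]gtn_eqF ?andbF.
  by rewrite lane_eq // [n0.+1 == _]gtn_eqF ?andbF //; lia.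
Qed.

(** By [run_mono], a token that reaches [harm] at any moment is still there at the end. *)
Lemma harm_not_lo : all (fun e => e.2 != harm) csp_events.
Proof.
apply/allP => e /csp_events_cases[/trash_eventsP[_ [j [u [-> Hj Hu Hne _]]]]||].
- by rewrite lane_eq.
- move=> /read_eventsP[k [p [r [Hk Hp Hr ->]]]] /=; have := copt_size k => Hs.
  by rewrite lane_eq //; [rewrite [_ == n0.+1]ltn_eqF ?andbF //|rewrite /n]; lia.
- move=> /amo_eventsP[i [u [Hi Hu _ ->]]].
  by rewrite lane_eq //; [rewrite [_ == n0.+1]ltn_eqF ?andbF //|rewrite /n]; lia.
Qed.

(** * A harmless choice satisfies the constraints *)

Section Sound.
Variable c : nat -> nat.
Hypothesis Hc : forall j, j < g -> c j < n.
Hypothesis Hh : ~~ run csp_events (choice_state n c) harm.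
Let s0 := choice_state n c.

Lemma chosen_harmless l : s0 l -> l != harm -> has (fun e => e.2 == l) csp_events ->
  ~ {in csp_events, forall e, e.2 == l -> e.1 = harm}.
Proof.
move=> Hl Nl Hs Ha; move/negP: Hh; apply.
by apply: (run_harm Hl Nl Hs Ha); exact: harm_not_lo.
Qed.

Lemma not_trash j : j < g -> c j < n0.
Proof.
move=> Hj; rewrite ltnNge; apply/negP => Hge.
have Hcj := Hc Hj; have Hl : s0 (lane j (c j)) by rewrite /s0 choice_state_lane.
case: (eqVneq (lane j (c j)) harm) => [E|Nh].
  by move/negP: Hh; apply; apply: run_mono harm_not_lo _; rewrite -E.
apply: (chosen_harmless Hl Nh).
  apply/hasP; exists (harm, lane j (c j)) => //.
  rewrite /csp_events mem_cat; apply/orP; left; rewrite mem_cat.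
  have : c j = n0 \/ c j = n0.+1 by move: Hcj Hge; rewrite /n; lia.
  case=> E; [apply/orP; left|apply/orP; right; rewrite mem_cat; apply/orP; left].
    by apply/mapP; exists j; rewrite ?E // mem_iota.
  apply/mapP; exists j; rewrite ?E // mem_iota add1n prednK ?g_gt0 // Hj andbT lt0n.
  by apply: contraNneq Nh => j0; rewrite E j0.
move=> e /csp_events_cases[/trash_eventsP[-> _]//||].
  move=> /read_eventsP[k [p [r [Hk Hp Hr ->]]]] /=; have := copt_size k => Hs.
  by rewrite lane_eq //; [move=> /andP[_ /eqP]|rewrite /n]; lia.
move=> /amo_eventsP[i [u [Hi Hu _ ->]]].
by rewrite lane_eq //; [move=> /andP[_ /eqP]|rewrite /n]; lia.
Qed.

Lemma valid_option k : k < nc -> c (nv + k) < size (copt k).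
Proof.
move=> Hk; have Hj : nv + k < g by rewrite ltn_add2l.
have Hp := not_trash Hj; have Hcj := Hc Hj; rewrite ltnNge; apply/negP => Hge.
have Hl : s0 (lane (nv + k) (c (nv + k))) by rewrite /s0 choice_state_lane.
apply: (chosen_harmless Hl).
- by rewrite lane_eq // gtn_eqF // addn_gt0 nv0.
- apply/hasP; exists (harm, lane (nv + k) (c (nv + k))) => //.
  rewrite /csp_events mem_cat; apply/orP; left; rewrite mem_cat; apply/orP; right.
  rewrite mem_cat; apply/orP; right; apply/flattenP.
  exists [seq (harm, lane (nv + k) p) | p <- iota (size (copt k)) (n0 - size (copt k))].
    by apply/mapP; exists k => //; rewrite mem_iota.
  by apply/mapP; exists (c (nv + k)) => //; rewrite mem_iota; lia.
move=> e /csp_events_cases[/trash_eventsP[-> _]//||].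
  move=> /read_eventsP[k' [p [r [Hk' Hp' Hr ->]]]] /=; have := copt_size k' => Hs.
  rewrite lane_eq //; last by rewrite /n; lia.
  by rewrite eqn_add2l => /andP[/eqP E1 /eqP E2]; move: Hp'; rewrite E1 E2 ltnNge Hge.
move=> /amo_eventsP[i [u [Hi Hu _ ->]]].
by rewrite lane_eq //; [move=> /andP[/eqP]|rewrite /n]; lia.
Qed.

Let s1 := run trash_events s0.
Let s2 := run read_events s1.

Lemma run_s2 : run csp_events s0 = run amo_events s2.
Proof. by rewrite /csp_events (run_cat trash_events) (run_cat read_events). Qed.

(** The scans of earlier groups take no token from group [i], so its own scan meets both; later
    scans cannot empty [harm]. *)
Lemma amo_two i u1 u2 : i < nv -> u1 < n0 -> u2 < n0 -> s2 (lane i u1) -> s2 (lane i u2) -> u1 = u2.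
Proof.
move=> Hi H1 H2 S1 S2; apply/eqP; apply: contraT => Nu; case/negP: Hh.
rewrite -/s0 run_s2 /amo_events.
have -> : iota 0 nv = iota 0 i ++ i :: iota i.+1 (nv - i.+1).
  by rewrite -[i :: _]/(iota i (nv - i.+1).+1) -{1}[i]add0n -iotaD; congr iota; lia.
rewrite map_cat flatten_cat run_cat /= run_cat.
set post := flatten _; set pre := flatten _.
have Hu12 u : u < n0 -> u < n by rewrite /n; lia.
have nn : n0 < n by rewrite /n; lia.
apply: run_mono.
  apply/allP => e /flattenP[y /mapP[j _ ->]] /flattenP[z /mapP[u]];
    rewrite mem_iota => /andP[_ Hu] ->.
  by rewrite !inE => /orP[] /eqP -> /=; (rewrite lane_eq //;
    [rewrite [_ == n0.+1]ltn_eqF ?andbF //|rewrite /n]; lia).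
have Hpre u : u < n -> s2 (lane i u) -> run pre s2 (lane i u).
  move=> Hu; apply: run_mono; apply/allP => e /flattenP[y /mapP[j]];
    rewrite mem_iota => /andP[_ Hj] ->.
  move=> /flattenP[z /mapP[v]]; rewrite mem_iota => /andP[_ Hv] ->.
  have Hv' : v < n by rewrite /n; lia.
  by rewrite !inE => /orP[] /eqP -> /=; rewrite lane_eq // ltn_eqF.
apply: scan_two.
- by rewrite lane_eq // [n0 == _]ltn_eqF ?andbF.
- exact: iota_uniq.
- by move=> v w /addnI.
- apply/allP => u; rewrite mem_iota => /andP[_ Hu].
  by apply/andP; split; apply/eqP => /(lane_inj _ _)[||_]; rewrite /n; lia.
rewrite (@leq_trans (count (fun u => run pre s2 (lane i u)) (iota 0 n0))) ?leq_addl //.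
have -> : 2 = size [:: u1; u2] by [].
rewrite -size_filter; apply: uniq_leq_size; first by rewrite /= inE Nu.
by move=> u; rewrite !inE mem_filter mem_iota => /orP[] /eqP ->; rewrite Hpre ?Hu12.
Qed.

(** The choice itself is the assignment. Since after reading a variable has no token besides its
    own, reading moved no token away from the chosen option; [run_reads] then says that the required
    lanes were occupied beforehand, that is, by the chosen values. *)
Lemma csp_sound : csp_sat cons.
Proof.
exists c => C HC; pose k := index C cons.
have Hk : k < nc by rewrite index_mem.
have EC : copt k = C by rewrite /copt nth_index.
have Hv := valid_option Hk; set q := c (nv + k) in Hv.
exists (nth [::] (copt k) q); first by rewrite -EC mem_nth.
have Hj : nv + k < g by rewrite ltn_add2l.
have qn : q < n by rewrite Hc.
have qn0 : q < n0 by apply: not_trash.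
have lo_trash j u : u < n0 -> j < nv \/ (nv <= j /\ u < size (copt (j - nv))) ->
    all (fun e => e.2 != lane j u) trash_events.
  move=> Hu Hju; apply/allP => e /trash_eventsP[_ [j' [u' [-> Hj' Hu' _ H3]]]].
  rewrite lane_eq //; last by rewrite /n; lia.
  apply/negP => /andP[/eqP E1 /eqP E2]; subst j' u'.
  by have [] := H3 Hu; case: Hju; lia.
have Hl : s1 (lane (nv + k) q).
  apply: run_mono; last by rewrite /s0 choice_state_lane.
  by apply: lo_trash => //; right; rewrite leq_addr addKn.
have var_true i : i < nv -> s1 (lane i (c i)) /\ s2 (lane i (c i)).
  move=> Hi; have Hi' : i < g by rewrite ltn_addr.
  have Hci := not_trash Hi'.
  have S1 : s1 (lane i (c i)).
    by apply: run_mono; [apply: lo_trash => //; left|rewrite /s0 choice_state_lane // Hc].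
  split=> //; apply: run_mono S1; apply/allP => e /read_eventsP[k' [p [r [Hk' Hp Hr ->]]]] /=.
  have := copt_size k' => Hs; rewrite lane_eq ?Hc //; last by rewrite /n; lia.
  by rewrite gtn_eqF // (leq_trans Hi) // leq_addr.
have hi_event r : r \in nth [::] (copt k) q -> (lane r.1 r.2, lane (nv + k) q) \in read_events.
  move=> Hr; apply/flattenP.
  exists (flatten [seq [seq (lane r.1 r.2, lane (nv + k) p) | r <- nth [::] (copt k) p]
                       | p <- iota 0 (size (copt k))]).
    by apply/mapP; exists k; rewrite ?mem_iota.
  apply/flattenP; exists [seq (lane r.1 r.2, lane (nv + k) q) | r <- nth [::] (copt k) q].
    by apply/mapP; exists q; rewrite ?mem_iota.
  by apply/mapP; exists r.
have uniq_val i u : i < nv -> u < n0 -> s2 (lane i u) -> u = c i.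
  move=> Hi Hu Hs; have [_ S2] := var_true _ Hi.
  by apply: (amo_two Hi Hu _ Hs S2); apply: not_trash; rewrite ltn_addr.
have reads := @run_reads read_events s1 (lane (nv + k) q) Hl.
apply/allP => r Hr; have [R1 R2] := read_bound Hk Hv Hr.
have Hlo e : e \in read_events -> e.2 == lane (nv + k) q ->
    exists r', [/\ r' \in nth [::] (copt k) q, r'.1 < nv, r'.2 < n0 & e.1 = lane r'.1 r'.2].
  move=> /read_eventsP[k' [p [r' [Hk' Hp Hr' ->]]]] /=; have := copt_size k' => Hs.
  rewrite lane_eq //; last by rewrite /n; lia.
  rewrite eqn_add2l => /andP[/eqP E1 /eqP E2]; subst k' p.
  by exists r'; have [? ?] := read_bound Hk Hv Hr'.
rewrite eq_sym; apply/eqP; apply: (uniq_val _ _ R1 R2).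
have S1 : s1 (lane r.1 r.2).
  apply: (reads _ _ (lane r.1 r.2, lane (nv + k) q)); rewrite ?hi_event //=.
  - move=> e He E2; have [r' [_ R1' R2' ->]] := Hlo e He E2.
    apply/allP => e' /read_eventsP[k' [p [r2 [Hk' Hp _ ->]]]] /=; have := copt_size k' => Hs.
    have R2n : r'.2 < n by apply: leq_trans R2' _; rewrite /n; lia.
    rewrite lane_eq //; last by rewrite /n; lia.
    by rewrite gtn_eqF // (leq_trans R1') // leq_addr.
  - move=> e He E2; have [r' [_ R1' R2' ->]] := Hlo e He E2.
    by move=> /(uniq_val _ _ R1' R2') ->; have [] := var_true _ R1'.
apply: run_mono S1; apply/allP => e' /read_eventsP[k' [p [r2 [Hk' Hp _ ->]]]] /=;
  have := copt_size k' => Hs.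
have R2n : r.2 < n by apply: leq_trans R2 _; rewrite /n; lia.
rewrite lane_eq //; last by rewrite /n; lia.
by rewrite gtn_eqF // (leq_trans R1) // leq_addr.
Qed.

End Sound.

(** * A satisfying assignment gives a harmless choice *)

Section Complete.
Variable a : nat -> nat.
Hypothesis Ha : forall C, C \in cons -> exists2 p, p \in C & all (fun r => a r.1 == r.2) p.

(** Options only require values below [n0], so a larger value may be replaced by [0]. A constraint
    chooses its first fulfilled option. *)
Definition csp_choice (j : nat) : nat :=
  if j < nv then if a j < n0 then a j else 0
  else find (fun p => all (fun r => a r.1 == r.2) p) (copt (j - nv)).

Lemma csp_choice_opt k : k < nc -> csp_choice (nv + k) < size (copt k) /\
  all (fun r => a r.1 == r.2) (nth [::] (copt k) (csp_choice (nv + k))).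
Proof.
move=> Hk; rewrite /csp_choice [nv + k < nv]ltnNge leq_addr /= addKn.
have Hh : has (fun p => all (fun r => a r.1 == r.2) p) (copt k).
  by have [p Hp Hr] := Ha (copt_mem Hk); apply/hasP; exists p.
by rewrite -has_find Hh (nth_find [::] Hh).
Qed.

Lemma csp_choice_bound j : j < g -> csp_choice j < n0.
Proof.
move=> Hj; case: (ltnP j nv) => H.
  by rewrite /csp_choice H; case: ifP.
have Hk : j - nv < nc by move: Hj; rewrite /g; lia.
have [H1 _] := csp_choice_opt Hk; rewrite subnKC // in H1.
exact: leq_trans H1 (copt_size _).
Qed.

Let s0 := choice_state n csp_choice.

Lemma idle_prefix : run read_events (run trash_events s0) =1 s0.
Proof.
move=> l; rewrite -run_cat; apply: run_idle => e; rewrite mem_cat => /orP[].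
  move=> /trash_eventsP[_ [j [u [-> Hj Hu _ H3]]]].
  rewrite /s0 choice_state_lane //; apply/orP; right; apply/eqP => Ec.
  have Hb := csp_choice_bound Hj; have [H1 H2] := H3 (ltac:(by rewrite -Ec)).
  have Hk : j - nv < nc by move: Hj; rewrite /g; lia.
  have [H4 _] := csp_choice_opt Hk; rewrite subnKC // Ec in H4.
  by rewrite leqNgt H4 in H2.
move=> /read_eventsP[k [p [r [Hk Hp Hr ->]]]] /=.
have [R1 R2] := read_bound Hk Hp Hr; have := copt_size k => Hs.
have R2n : r.2 < n by apply: leq_trans R2 _; rewrite /n; lia.
have pn : p < n by rewrite /n; lia.
rewrite /s0 !choice_state_lane //.
case: eqP => //= Nr; apply/eqP => Ec; apply: Nr.
have [_ /allP/(_ r)] := csp_choice_opt Hk; rewrite Ec => /(_ Hr) /eqP Er.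
by rewrite /csp_choice R1 Er R2.
Qed.

(** The accumulator [n0] is counted among the lanes, so parking a token there preserves the
    property. *)
Definition one_hot (s : nat -> bool) : Prop := ~~ s harm /\
  forall i u v, i < nv -> u <= n0 -> v <= n0 -> s (lane i u) -> s (lane i v) -> u = v.

Lemma scan_one_hot i us s : i < nv -> all (fun u => u < n0) us -> one_hot s ->
  one_hot (run (scan (lane i n0) harm (lane i) us) s).
Proof.
move=> Hi; elim: us s => // u us IH s /andP[Hu Hus] [Hh H1].
rewrite /scan /= -/(scan _ _ _ _); apply: IH => //.
have nn : n0 < n by rewrite /n; lia.
have un : u < n by rewrite /n; lia.
have Nah : (lane i n0 == harm) = false by rewrite lane_eq // [n0 == _]ltn_eqF ?andbF.
have Nu : (lane i u == harm) = false by rewrite lane_eq // [u == _]ltn_eqF ?andbF //; lia.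
have Nau : (lane i u == lane i n0) = false by rewrite lane_eq // [u == _]ltn_eqF ?andbF.
have B : s (lane i n0) && s (lane i u) = false.
  apply/negP => /andP[S1 S2]; have := H1 i _ _ Hi (leqnn _) (ltnW Hu) S1 S2.
  by lia.
have Eh : step (step s (lane i n0, lane i u)) (harm, lane i u) harm = s harm.
  by rewrite /step /= !eqxx Nau ![harm == _]eq_sym Nah Nu B orbF.
have El j v : v < n -> step (step s (lane i n0, lane i u)) (harm, lane i u) (lane j v) =
    if lane j v == harm then s harm
    else if (j == i) && (v == u) then false
    else if (j == i) && (v == n0) then s (lane i n0) || s (lane i u) else s (lane j v).
  move=> Hv; case: (eqVneq (lane j v) harm) => [->|N1]; first exact: Eh.
  rewrite -!lane_eq //; case: (eqVneq (lane j v) (lane i u)) => [->|N2].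
    by rewrite /step /= Nu eqxx !Nau ![harm == _]eq_sym Nah Nu (negbTE Hh).
  case: (eqVneq (lane j v) (lane i n0)) => [->|N3].
    by rewrite /step /= Nah [lane i n0 == _]eq_sym Nau eqxx.
  by rewrite /step /= (negbTE N1) (negbTE N2) (negbTE N3).
split; first by rewrite Eh.
move=> j v w Hj Hv Hw.
have vn : v < n by rewrite /n; lia.
have wn : w < n by rewrite /n; lia.
rewrite !El // !lane_eq // [v == n0.+1]ltn_eqF // [w == n0.+1]ltn_eqF // !andbF.
case: (eqVneq j i) => [->|_] /=; last exact: H1.
case: (eqVneq v u) => // Nvu; case: (eqVneq w u) => // Nwu.
case: (eqVneq v n0) => [->|Nv]; case: (eqVneq w n0) => [->|Nw] //.
- move=> /orP[S1|S1] S2; first exact: (H1 i n0 w Hi).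
  by have Ew := H1 i u w Hi (ltnW Hu) Hw S1 S2; rewrite Ew eqxx in Nwu.
- move=> S2 /orP[S1|S1]; first exact: (H1 i v n0 Hi).
  by have Ew := H1 i u v Hi (ltnW Hu) Hv S1 S2; rewrite Ew eqxx in Nvu.
- exact: H1.
Qed.

Lemma csp_complete : exists2 c : nat -> nat, forall j, j < g -> c j < n &
  ~~ run csp_events (choice_state n c) harm.
Proof.
exists csp_choice; first by move=> j /csp_choice_bound; rewrite /n; lia.
rewrite -/s0 /csp_events (run_cat trash_events) (run_cat read_events).
rewrite (run_ext _ idle_prefix) /amo_events.
have O0 : one_hot s0.
  split.
    rewrite /s0 choice_state_lane //; have := csp_choice_bound g_gt0.
    by case: eqP => // ->; lia.
  move=> i u v Hi Hu Hv.
  have un : u < n by rewrite /n; lia.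
  have vn : v < n by rewrite /n; lia.
  rewrite /s0 !choice_state_lane //.
  by move=> /eqP -> /eqP.
have : all (fun i => i < nv) (iota 0 nv) by apply/allP => i; rewrite mem_iota.
elim: (iota 0 nv) s0 O0 => [|i r IH] s [O1 O2] //= /andP[Hi Hr].
rewrite run_cat; apply: IH => //; apply: scan_one_hot => //.
by apply/allP => u; rewrite mem_iota.
Qed.

End Complete.

Theorem csp_networkP : csp_sat cons <->
  exists2 c : nat -> nat, forall j, j < g -> c j < n & ~~ run csp_events (choice_state n c) harm.
Proof.
split=> [[a Ha]|[c Hc Hh]]; first exact: csp_complete Ha.
exact: csp_sound Hc Hh.
Qed.

End Csp.

(** * Truncated Moebius inversion *)

(** The sublists of length at most [j]. Recursion on [j] alone makes each fixed [j] a composition of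
    list operations, which [polyf_comb] relies on; [comb_cons] recovers recursion on the list. *)
Fixpoint comb (j : nat) (l : seq nat) : seq (seq nat) :=
  if j is j'.+1 then
    [::] :: flatten [seq [seq nth 0 l i :: A | A <- comb j' (drop i.+1 l)] | i <- iota 0 (size l)]
  else [:: [::]].

Lemma comb_cons j x l :
  comb j.+1 (x :: l) = [::] :: [seq x :: A | A <- comb j l] ++ behead (comb j.+1 l).
Proof.
by rewrite [LHS]/= drop0 (iotaDl 1 0) -map_comp; congr (_ :: _ ++ flatten _).
Qed.

Lemma comb_nil j : comb j [::] = [:: [::]].
Proof. by case: j. Qed.

Lemma sum_comb_cons j x l (g : seq nat -> nat) :
  \sum_(A <- comb j.+1 (x :: l)) g A =
  \sum_(A <- comb j l) g (x :: A) + \sum_(A <- comb j.+1 l) g A.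
Proof.
rewrite comb_cons big_cons big_cat big_map /=.
by rewrite [in RHS]/= [in RHS]big_cons addnCA.
Qed.

Lemma comb_map j (f : nat -> nat) l : comb j (map f l) = map (map f) (comb j l).
Proof.
elim: j l => // j IH; elim=> [|x l IHl]; first by rewrite !comb_nil.
rewrite map_cons !comb_cons IH IHl /= map_cat -!map_comp; congr (_ :: _ ++ _).
Qed.

Lemma mem_comb j l A : (A \in comb j l) = subseq A l && (size A <= j).
Proof.
elim: j l A => [|j IH]; first by move=> l [|x A]; rewrite /= ?inE ?andbF ?sub0seq.
elim=> [|x l IHl] A; first by rewrite comb_nil inE; case: A => // y A; rewrite /= andbF.
rewrite comb_cons inE mem_cat; case: A => [|y A] //.
have -> : ((y :: A) \in behead (comb j.+1 l)) = ((y :: A) \in comb j.+1 l).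
  by rewrite [comb j.+1 l]/= inE.
rewrite IHl /=; case: (eqVneq y x) => [->|Nyx].
  have -> : (x :: A \in [seq x :: B | B <- comb j l]) = (A \in comb j l).
    by rewrite mem_map // => ? ? [].
  rewrite IH ltnS andbC; case: (size A <= j) => //=; rewrite ?andbF //= !andbT.
  by rewrite orb_idr // => /(subseq_trans (subseq_cons A x)).
suff -> : (y :: A \in [seq x :: B | B <- comb j l]) = false by [].
by apply/mapP => -[B _ [E1]]; rewrite E1 eqxx in Nyx.
Qed.

Lemma sum_comb_trunc j k l (g : seq nat -> nat) : j <= k ->
  \sum_(A <- comb j l) g A = \sum_(A <- comb k l | size A <= j) g A.
Proof.
rewrite [RHS]big_mkcond /=; elim: l j k g => [|x l IH] j k g jk.
  by rewrite !comb_nil !big_cons !big_nil.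
case: k jk => [|k] jk; first by move: jk; rewrite leqn0 => /eqP ->; rewrite /= !big_cons !big_nil.
case: j jk => [|j] jk.
  by rewrite sum_comb_cons [X in _ = X + _]big1 // add0n -(IH 0 k.+1).
by rewrite !sum_comb_cons (IH j.+1 k.+1) // (IH j k).
Qed.

(** The sums of [F B] over the sublists [B] of [A] for which the sizes of [A] and [B] differ by an
    even, respectively odd, number. Their difference is the Moebius transform of [F] at [A]; keeping
    them apart avoids signs. *)
Fixpoint even_sum (F : seq nat -> nat) (A : seq nat) : nat :=
  if A is x :: A' then even_sum (fun B => F (x :: B)) A' + odd_sum F A' else F [::]
with odd_sum (F : seq nat -> nat) (A : seq nat) : nat :=
  if A is x :: A' then odd_sum (fun B => F (x :: B)) A' + even_sum F A' else 0.

Lemma parity_sum F A j : size A <= j ->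
  even_sum F A = \sum_(B <- comb j A) (if odd (size A + size B) then 0 else F B) /\
  odd_sum F A = \sum_(B <- comb j A) (if odd (size A + size B) then F B else 0).
Proof.
elim: A F j => [|x A IH] F j Hj.
  by rewrite comb_nil !big_cons !big_nil /= addn0.
case: j Hj => // j Hj; have [E1 O1] := IH (fun B => F (x :: B)) j Hj.
have [E2 O2] := IH F j.+1 (ltnW Hj).
rewrite /= {}E1 {}O1 {}E2 {}O2 !sum_comb_cons.
split; congr (_ + _); apply: eq_bigr => B _; rewrite /= ?addnS ?addSn /= ?negbK //;
  by case: (odd _).
Qed.

Lemma parity_ext F G A : F =1 G -> even_sum F A = even_sum G A /\ odd_sum F A = odd_sum G A.
Proof.
elim: A F G => [|x A IH] F G E /=; first by rewrite E.
have [-> ->] := IH _ _ E.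
have Ex : (fun B => F (x :: B)) =1 (fun B => G (x :: B)) by move=> B; apply: E.
by have [-> ->] := IH _ _ Ex.
Qed.

(* Inclusion-exclusion, with the negative terms moved to the other side. *)
Lemma moebius F S j : size S <= j ->
  \sum_(A <- comb j S) even_sum F A = F S + \sum_(A <- comb j S) odd_sum F A.
Proof.
elim: S F j => [|x S IH] F j Hj; first by rewrite comb_nil !big_cons !big_nil /= addn0.
case: j Hj => // j Hj; rewrite !sum_comb_cons.
have -> : \sum_(A <- comb j S) even_sum F (x :: A) =
  \sum_(A <- comb j S) even_sum (fun B => F (x :: B)) A + \sum_(A <- comb j S) odd_sum F A.
  by rewrite -big_split.
have -> : \sum_(A <- comb j S) odd_sum F (x :: A) =
  \sum_(A <- comb j S) odd_sum (fun B => F (x :: B)) A + \sum_(A <- comb j S) even_sum F A.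
  by rewrite -big_split.
have := IH (fun B => F (x :: B)) j Hj; have := IH F j.+1 (ltnW Hj).
have := IH F j Hj; lia.
Qed.

(** * Functions depending on few elements *)

Section Dependence.
Implicit Types (V A B ps : seq nat).

Definition depends_on (V : seq nat) (F : seq nat -> nat) : Prop :=
  forall A B, {in V, forall v, (v \in A) = (v \in B)} -> F A = F B.

(** Adding or removing [x] pairs off sublists with the same value of [F] and opposite parity. *)
Lemma parity_cancel V F A x : depends_on V F -> x \in A -> x \notin V ->
  even_sum F A = odd_sum F A.
Proof.
move=> + + Nx; elim: A F => // y A IH F HF; rewrite inE => Hx /=.
have HFy : depends_on V (fun B => F (y :: B)).
  by move=> B C HBC; apply: HF => v Hv; rewrite !inE HBC.
case: (boolP (y \in V)) => Hy.
  have Hx' : x \in A.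
    by case: (eqVneq x y) Hx => // E; rewrite E Hy in Nx.
  by rewrite (IH _ HFy Hx') (IH _ HF Hx').
have Ey : (fun B => F (y :: B)) =1 F.
  move=> B; apply: HF => v Hv; rewrite inE.
  by case: eqP => // E; rewrite -E Hv in Hy.
by have [-> ->] := parity_ext A Ey; rewrite addnC.
Qed.

Lemma parity_big (ps : seq nat) (F : nat -> seq nat -> nat) A :
  even_sum (fun B => \sum_(p <- ps) F p B) A = \sum_(p <- ps) even_sum (F p) A /\
  odd_sum (fun B => \sum_(p <- ps) F p B) A = \sum_(p <- ps) odd_sum (F p) A.
Proof.
elim: A F => [|x A IH] F /=; first by rewrite big1_eq.
have [-> ->] := IH F; have [-> ->] := IH (fun p B => F p (x :: B)).
by rewrite -!big_split.
Qed.

(** By linearity each summand may have its own [V]; as [A] has more than [D] elements, one of them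
    lies outside it. *)
Lemma parity_cancel_big D (ps : seq nat) (F : nat -> seq nat -> nat) A :
  {in ps, forall p, exists2 V, size V <= D & depends_on V (F p)} ->
  uniq A -> D < size A ->
  even_sum (fun B => \sum_(p <- ps) F p B) A = odd_sum (fun B => \sum_(p <- ps) F p B) A.
Proof.
move=> HF UA HA; have [-> ->] := parity_big ps F A.
rewrite big_seq_cond [RHS]big_seq_cond; apply: eq_bigr => p; rewrite andbT => Hp.
have [V HV dV] := HF p Hp.
have /allPn[x Hx Nx] : ~~ all (mem V) A.
  by apply: contraL HA => /allP HAV; rewrite -leqNgt (leq_trans _ HV) // uniq_leq_size.
exact: parity_cancel dV Hx Nx.
Qed.

Lemma moebius_trunc D F S : uniq S ->
  (forall A, uniq A -> D < size A -> even_sum F A = odd_sum F A) ->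
  \sum_(A <- comb D S) even_sum F A = F S + \sum_(A <- comb D S) odd_sum F A.
Proof.
move=> US HF; pose k := D + size S.
have := @moebius F S k (leq_addl _ _).
rewrite !(@sum_comb_trunc D k) ?leq_addr //.
rewrite (bigID (fun A => size A <= D)) [in RHS](bigID (fun A => size A <= D)) /=.
have -> : \sum_(A <- comb k S | ~~ (size A <= D)) even_sum F A =
          \sum_(A <- comb k S | ~~ (size A <= D)) odd_sum F A.
  rewrite big_seq_cond [RHS]big_seq_cond; apply: eq_bigr => A.
  rewrite mem_comb -ltnNge => /andP[/andP[sA _] HA]; apply: HF => //.
  exact: subseq_uniq sA US.
lia.
Qed.

End Dependence.

Lemma sweep_rcons (A : Type) (x0 : A) f gs g :
  sweep x0 f (rcons gs g) =
  rcons (sweep x0 f gs) (f (size (sweep x0 f gs)) g [seq nth x0 (sweep x0 f gs) j | j <- preds g]).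
Proof. by rewrite /sweep -cats1 foldl_cat. Qed.

Lemma size_sweep (A : Type) (x0 : A) f gs : size (sweep x0 f gs) = size gs.
Proof. by elim/last_ind: gs => // gs g IH; rewrite sweep_rcons !size_rcons IH. Qed.

(** An entry never changes once it is appended, so the equation of a gate may refer to the finished
    list. *)
Lemma nth_sweep (A : Type) (x0 : A) f gs i :
  (forall i p, i < size gs -> p \in preds (nth InputGate gs i) -> p < i) -> i < size gs ->
  nth x0 (sweep x0 f gs) i =
  f i (nth InputGate gs i) [seq nth x0 (sweep x0 f gs) p | p <- preds (nth InputGate gs i)].
Proof.
elim/last_ind: gs i => // gs g IH i Hp; rewrite size_rcons ltnS => Hi.
have Hp' : forall i p, i < size gs -> p \in preds (nth InputGate gs i) -> p < i.
  by move=> j p Hj; have := Hp j p; rewrite size_rcons nth_rcons Hj ltnS (ltnW Hj); apply.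
have Hm : [seq nth x0 (sweep x0 f (rcons gs g)) p | p <- preds (nth InputGate (rcons gs g) i)] =
          [seq nth x0 (sweep x0 f gs) p | p <- preds (nth InputGate (rcons gs g) i)].
  apply/eq_in_map => p Hpi; rewrite sweep_rcons nth_rcons size_sweep.
  have Hlt : p < i by apply: Hp Hpi; rewrite size_rcons ltnS.
  by rewrite (leq_trans Hlt Hi).
rewrite Hm sweep_rcons !nth_rcons size_sweep.
move: Hi; rewrite leq_eqVlt => /orP[/eqP->|Hi]; first by rewrite ltnn eqxx.
by rewrite Hi IH.
Qed.

Lemma leq_bigmax_mem (s : seq nat) x : x \in s -> x <= \max_(d <- s) d.
Proof.
elim: s => // y s IH; rewrite inE big_cons leq_max => /orP[/eqP->|/IH->];
  by rewrite ?leqnn ?orbT.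
Qed.

(** * Circuits of weft one *)

Definition gate_tag (g : gate) : nat :=
  match g with InputGate => 0 | NotGate _ => 1 | AndGate _ => 2 | OrGate _ => 3 end.

Definition gate_pair (g : gate) : nat * seq nat := (gate_tag g, preds g).

Definition tag_of (gs : seq (nat * seq nat)) (i : nat) : nat := nth 0 [seq x.1 | x <- gs] i.

Definition preds_of (gs : seq (nat * seq nat)) (i : nat) : seq nat :=
  nth [::] [seq x.2 | x <- gs] i.

Definition gate_op (tag : nat) (vs : seq bool) : bool :=
  if tag == 1 then ~~ head false vs else if tag == 2 then all id vs else has id vs.

(* [X]: gates where the evaluation stops; [Y]: those of them that are true. *)
Fixpoint eval_to (gs : seq (nat * seq nat)) (j : nat) (X Y : seq nat) (i : nat) : bool :=
  if j is j'.+1 then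
    if i \in X then i \in Y
    else gate_op (tag_of gs i) [seq eval_to gs j' X Y p | p <- preds_of gs i]
  else i \in Y.

Definition leafy (gs : seq (nat * seq nat)) (i : nat) : bool :=
  (tag_of gs i == 0) || (2 < size (preds_of gs i)).

Fixpoint leaves (gs : seq (nat * seq nat)) (j i : nat) : seq nat :=
  if j is j'.+1 then
    if leafy gs i then [:: i] else flatten [seq leaves gs j' p | p <- preds_of gs i]
  else [:: i].

Definition inputs (gs : seq (nat * seq nat)) : seq nat :=
  [seq i <- iota 0 (size gs) | tag_of gs i == 0].

(** An input has no in-neighbours; its own value replaces the count, so that [gate_true] can treat
    it like a disjunction. *)
Definition true_preds gs (d : nat) (i : nat) (A : seq nat) : nat :=
  if tag_of gs i == 0 then nat_of_bool (i \in A) else count (eval_to gs d (inputs gs) A) (preds_of gs i).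

(** Applied to relevant gates only; negations, having one in-neighbour, are not among them. *)
Definition gate_true gs (i s : nat) : bool :=
  if tag_of gs i == 2 then s == size (preds_of gs i) else 0 < s.

Section Circuit.
Variables (c : circuit) (d : nat).
Hypothesis wfc : circuit_wf c.
Let gs := map gate_pair (gates c).
Let G := gate_at c.
Let o := output c.

Lemma tag_ofE i : tag_of gs i = gate_tag (G i).
Proof.
rewrite /tag_of -map_comp; case: (ltnP i (size (gates c))) => Hi.
  by rewrite (nth_map InputGate).
by rewrite /G /gate_at !nth_default ?size_map.
Qed.

Lemma preds_ofE i : preds_of gs i = preds (G i).
Proof.
rewrite /preds_of -map_comp; case: (ltnP i (size (gates c))) => Hi.
  by rewrite (nth_map InputGate).
by rewrite /G /gate_at !nth_default ?size_map.
Qed.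

Lemma tag0E i : (tag_of gs i == 0) = is_input (G i).
Proof. by rewrite tag_ofE; case: (G i). Qed.

Lemma size_gs : size gs = size (gates c). Proof. by rewrite size_map. Qed.

Lemma inputsE : inputs gs = circuit_inputs c.
Proof. by rewrite /inputs size_gs; apply: eq_filter => i; rewrite tag0E. Qed.

Lemma mem_inputs i : i < size (gates c) -> (i \in inputs gs) = is_input (G i).
Proof. by move=> Hi; rewrite mem_filter mem_iota /= add0n size_gs Hi andbT tag0E. Qed.

Lemma out_lt : o < size (gates c). Proof. by case/andP: wfc. Qed.

Lemma wf_gate i : i < size (gates c) ->
  [/\ {in preds (G i), forall p, p < i}, uniq (preds (G i)) & is_input (G i) || (preds (G i) != [::])].
Proof.
move=> Hi; case/andP: wfc => _ /allP/(_ i); rewrite mem_iota Hi => /(_ isT) /and3P[/allP H1 H2 H3].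
by split.
Qed.

Lemma gate_pred_lt i p : i < size (gates c) -> p \in preds (G i) -> p < i.
Proof. by move=> Hi; have [H _ _] := wf_gate Hi; apply: H. Qed.

Definition value (a : nat -> bool) (i : nat) : bool :=
  nth false (sweep false (gate_value a) (gates c)) i.

Lemma value_output a : circuit_value a c = value a o.
Proof. by []. Qed.

Lemma valueE a i : i < size (gates c) ->
  value a i = if is_input (G i) then a i
              else gate_op (gate_tag (G i)) [seq value a p | p <- preds (G i)].
Proof.
move=> Hi; rewrite {1}/value nth_sweep //; last by move=> j p; apply: gate_pred_lt.
by rewrite -[nth InputGate (gates c) i]/(G i); case: (G i).
Qed.

Definition depth (i : nat) : nat :=
  nth 0 (sweep 0 (fun _ g ds => if is_input g then 0 else (\max_(d <- ds) d).+1) (gates c)) i.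

Definition weft (i : nat) : nat :=
  nth 0 (sweep 0 (fun _ g ds => (2 < size (preds g)) + \max_(d <- ds) d) (gates c)) i.

Lemma depth_pred i p : i < size (gates c) -> p \in preds (G i) -> depth p < depth i.
Proof.
move=> Hi Hp; rewrite {2}/depth nth_sweep //; last by move=> j q; apply: gate_pred_lt.
rewrite -[nth InputGate (gates c) i]/(G i); case EG: (is_input (G i)).
  by move: Hp; case: (G i) EG.
by rewrite ltnS; apply: leq_bigmax_mem; apply/mapP; exists p.
Qed.

Lemma weft_pred i p : i < size (gates c) -> p \in preds (G i) ->
  (2 < size (preds (G i))) + weft p <= weft i.
Proof.
move=> Hi Hp; rewrite {2}/weft nth_sweep //; last by move=> j q; apply: gate_pred_lt.
by rewrite -[nth InputGate (gates c) i]/(G i) leq_add2l; apply: leq_bigmax_mem; apply/mapP;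
  exists p.
Qed.

Lemma weft_large i : i < size (gates c) -> (2 < size (preds (G i))) <= weft i.
Proof.
move=> Hi; rewrite {1}/weft nth_sweep //; last by move=> j q; apply: gate_pred_lt.
exact: leq_addr.
Qed.

Lemma eval_inputs j A i : i < size (gates c) -> depth i <= j ->
  eval_to gs j (inputs gs) A i = value (fun x => x \in A) i.
Proof.
elim: j i => [|j IH] i Hi Hd.
  rewrite /= valueE //; case E1: (is_input (G i)) => //.
  have [_ _] := wf_gate Hi; rewrite E1 /=; case E2: (preds (G i)) => [|p ps] // _.
  by have := @depth_pred i p Hi; rewrite E2 mem_head => /(_ isT); lia.
rewrite /= mem_inputs // valueE //; case: ifP => // _.
rewrite tag_ofE preds_ofE; congr gate_op; apply/eq_in_map => p Hp.
have Hlt := gate_pred_lt Hi Hp.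
by apply: IH; [exact: ltn_trans Hlt Hi|have := depth_pred Hi Hp; lia].
Qed.

(** All gates below have at most two in-neighbours, so the number of inputs that matter at most
    doubles per level. *)
Lemma eval_depends j i : i < size (gates c) -> weft i = 0 ->
  exists2 V, size V <= 2 ^ j & depends_on V (fun A => nat_of_bool (eval_to gs j (inputs gs) A i)).
Proof.
elim: j i => [|j IH] i Hi Hw.
  by exists [:: i] => // A B /(_ i (mem_head _ _)) /= ->.
case: (boolP (i \in inputs gs)) => Hin.
  exists [:: i]; first by rewrite expn_gt0.
  by move=> A B /(_ i (mem_head _ _)) /=; rewrite Hin => ->.
have S2 : size (preds (G i)) <= 2 by have := weft_large Hi; rewrite Hw; lia.
have HV p : p \in preds (G i) -> exists2 V, size V <= 2 ^ j &
    depends_on V (fun A => nat_of_bool (eval_to gs j (inputs gs) A p)).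
  move=> Hp; apply: IH; first exact: ltn_trans (gate_pred_lt Hi Hp) Hi.
  by have := weft_pred Hi Hp; rewrite Hw; lia.
have [V sV dV] : exists2 V, size V <= size (preds (G i)) * 2 ^ j &
    forall A B, {in V, forall v, (v \in A) = (v \in B)} ->
    {in preds (G i), forall p, eval_to gs j (inputs gs) A p = eval_to gs j (inputs gs) B p}.
  elim: (preds (G i)) HV => [|p ps IHp] HV; first by exists [::].
  have [V1 s1 d1] := HV p (mem_head _ _).
  have [q Hq|V2 s2 d2] := IHp; first by apply: HV; rewrite inE Hq orbT.
  exists (V1 ++ V2); first by rewrite size_cat mulSn leq_add.
  move=> A B HAB q; rewrite inE => /orP[/eqP->|Hq].
    have := d1 A B; rewrite /=; do 2!case: (eval_to _ _ _ _ p) => //=; move=> H; exfalso;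
      by have : 1 = 0 by [apply: H => v Hv; apply: HAB; rewrite mem_cat Hv|
                          symmetry; apply: H => v Hv; apply: HAB; rewrite mem_cat Hv].
  by apply: d2 => // v Hv; apply: HAB; rewrite mem_cat Hv orbT.
exists V; first by apply: leq_trans sV _; rewrite expnS leq_mul2r S2 orbT.
move=> A B HAB /=; rewrite (negbTE Hin) preds_ofE; congr (nat_of_bool (gate_op _ _)).
by apply/eq_in_map => p Hp; apply: dV.
Qed.

(** [X] stays fixed while [i] descends, hence it is only required to contain the leaves of [i]. *)
Lemma eval_leaves a j X i : i < size (gates c) -> depth i <= j ->
  {subset leaves gs j i <= X} -> {in X, forall r, leafy gs r} ->
  eval_to gs j X [seq r <- X | value a r] i = value a i.
Proof.
elim: j i => [|j IH] i Hi Hd HX HL.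
  by rewrite /= mem_filter HX ?mem_head // andbT.
rewrite /=; case: (boolP (leafy gs i)) => Li.
  have -> : i \in X by apply: HX; rewrite /= Li mem_head.
  by rewrite mem_filter HX ?andbT //= Li mem_head.
have -> : i \in X = false by apply: contraNF Li => /HL.
rewrite valueE //; move: (Li); rewrite {1}/leafy negb_or tag0E => /andP[/negbTE -> _].
rewrite tag_ofE preds_ofE; congr gate_op; apply/eq_in_map => p Hp.
have Hlt := gate_pred_lt Hi Hp.
apply: IH => //; [exact: ltn_trans Hlt Hi|by have := depth_pred Hi Hp; lia|].
move=> r Hr; apply: HX; rewrite /=.
rewrite (negbTE Li); apply/flattenP; exists (leaves gs j p) => //.
by apply/mapP; exists p; rewrite ?preds_ofE.
Qed.

Lemma leavesP j i : i < size (gates c) -> depth i <= j ->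
  [/\ leaves gs j i != [::], size (leaves gs j i) <= 2 ^ j &
    {in leaves gs j i, forall r, [/\ leafy gs r, r < size (gates c), depth r <= depth i & weft r <= weft i]}].
Proof.
elim: j i => [|j IH] i Hi Hd.
  split=> // r; rewrite inE => /eqP ->; split=> //.
  have [_ _] := wf_gate Hi; rewrite /leafy tag0E; case: (is_input (G i)) => //=.
  case E2: (preds (G i)) => [|p ps] // _.
  by have := @depth_pred i p Hi; rewrite E2 mem_head => /(_ isT); lia.
rewrite /=; case: (boolP (leafy gs i)) => Li.
  split=> //; first by rewrite expn_gt0.
  by move=> r; rewrite inE => /eqP ->.
rewrite preds_ofE.
have S2 : size (preds (G i)) <= 2.
  by move: Li; rewrite /leafy negb_or preds_ofE -leqNgt => /andP[].
have Hne : preds (G i) != [::].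
  have [_ _] := wf_gate Hi; move: Li; rewrite /leafy negb_or tag0E => /andP[/negbTE -> _].
  by [].
have HP p : p \in preds (G i) -> [/\ leaves gs j p != [::], size (leaves gs j p) <= 2 ^ j &
    {in leaves gs j p, forall r, [/\ leafy gs r, r < size (gates c), depth r <= depth i & weft r <= weft i]}].
  move=> Hp; have Hlt := gate_pred_lt Hi Hp; have Hdp := depth_pred Hi Hp;
    have Hwp := weft_pred Hi Hp.
  have [H1 H2 H3] := IH p (ltn_trans Hlt Hi) ltac:(lia).
  split=> // r /H3[R1 R2 R3 R4]; split=> //; lia.
split.
- case: (preds (G i)) Hne HP => // p ps _ HP /=.
  by have [H1 _ _] := HP p (mem_head _ _); case: (leaves gs j p) H1.
- apply: (@leq_trans (size (preds (G i)) * 2 ^ j)); last first.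
    by rewrite expnS leq_mul2r S2 orbT.
  elim: (preds (G i)) HP => //= p ps IHp HP; rewrite size_cat mulSn leq_add //.
    by have [_ H2 _] := HP p (mem_head _ _).
  by apply: IHp => q Hq; apply: HP; rewrite inE Hq orbT.
- by move=> r /flattenP[x /mapP[p Hp ->] Hr]; have [_ _ H3] := HP p Hp; apply: H3.
Qed.

Lemma gate_trueE A r : leafy gs r -> r < size (gates c) -> depth r <= d ->
  gate_true gs r (true_preds gs d r A) = value (fun x => x \in A) r.
Proof.
move=> Lr Hr Hd; rewrite /gate_true /true_preds valueE // tag0E preds_ofE tag_ofE.
have Ec : ~~ is_input (G r) -> count (eval_to gs d (inputs gs) A) (preds (G r)) =
    count (value (fun x => x \in A)) (preds (G r)).
  move=> _; apply: eq_in_count => p Hp; apply: eval_inputs.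
    exact: ltn_trans (gate_pred_lt Hr Hp) Hr.
  by have := depth_pred Hr Hp; lia.
move: Lr Ec; rewrite /leafy preds_ofE tag0E; case EG: (G r) => [|q|ps|ps] //=.
- by case: (r \in A).
- move=> _ ->//; rewrite /gate_op /=; elim: ps {EG} => //= p ps <-.
  move: (count_size (value (fun x => x \in A)) ps).
  case: (value _ p) => /= Hs; first by rewrite add1n eqSS.
  by rewrite add0n ltn_eqF.
- by move=> _ ->//; rewrite /gate_op /= -has_count has_map.
Qed.

Lemma true_preds_lt A r : r < size (gates c) -> true_preds gs d r A <= size (gates c).
Proof.
move=> Hr; rewrite /true_preds; case: ifP => _; first by case: (r \in A) => //=; lia.
apply: leq_trans (count_size _ _) _; rewrite preds_ofE.
have [H1 H2 _] := wf_gate Hr; rewrite -(size_iota 0 (size (gates c))).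
apply: uniq_leq_size => // p /H1; rewrite mem_iota; lia.
Qed.

(** A large gate uses up the weft, so its in-neighbours have weft [0] and each depends on at most
    [2 ^ d] inputs. *)
Lemma true_preds_cancel D r A : leafy gs r -> r < size (gates c) -> weft r <= 1 ->
  2 ^ d <= D -> uniq A -> D < size A ->
  even_sum (true_preds gs d r) A = odd_sum (true_preds gs d r) A.
Proof.
move=> Lr Hr Hw HD UA HA.
have HV : exists2 ps, forall B, true_preds gs d r B =
    \sum_(p <- ps) (if tag_of gs r == 0 then nat_of_bool (p \in B)
                     else nat_of_bool (eval_to gs d (inputs gs) B p)) &
    {in ps, forall p, if tag_of gs r == 0 then p = r else p \in preds (G r)}.
  rewrite /true_preds; case E0: (tag_of gs r == 0).
    exists [:: r]; first by move=> B; rewrite big_cons big_nil addn0.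
    by move=> p; rewrite inE => /eqP.
  exists (preds (G r)) => // B; rewrite preds_ofE.
  by elim: (preds (G r)) => [|p ps /= ->]; rewrite ?big_nil ?big_cons.
have [ps Eps Hps] := HV.
have [-> ->] := parity_ext A Eps.
apply: (@parity_cancel_big D) => // p /Hps; case: ifP => [_ ->|E0 Hp].
  exists [:: r]; first by apply: leq_trans HD; rewrite expn_gt0.
  by move=> B C /(_ r (mem_head _ _)) ->.
have [|V sV dV] := @eval_depends d p (ltn_trans (gate_pred_lt Hr Hp) Hr).
  have := weft_pred Hr Hp; move: Lr; rewrite /leafy E0 preds_ofE /= => ->; lia.
by exists V => //; apply: leq_trans HD.
Qed.

End Circuit.

(** * Circuits as constraints *)

(** [2 ^ d] bounds the inputs on which an in-neighbour of a large gate depends; the [2] guarantees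
    that pairs of indices are among the tuples, which makes the chosen inputs distinct
    ([uniq_sol]). *)
Definition degree (d : nat) : nat := maxn 2 (2 ^ d).

Definition parity_count (d : nat) gs (i : nat) (A : seq nat) (b : nat) : nat :=
  sumn [seq true_preds gs d i B | B <- [seq B <- comb (degree d) A | (size A + size B) %% 2 == b]].

Section Reduction.
Variables (d : nat) (gs : seq (nat * seq nat)) (o k : nat).

Definition modulus : nat := (size gs).+1.
Definition relevant : seq nat := leaves gs d o.
Definition patterns : seq (seq nat) := comb (2 ^ d) relevant.
Definition tuples : seq (seq nat) := comb (degree d) (iota 0 k).

(* The variables below [k] are the chosen inputs, the variable [k] is the set of
   true relevant gates as an index into [patterns], and [sum_var r j] is the sum
   of the first [j] terms for the [r]-th relevant gate. *)
Definition sum_var (r j : nat) : nat := k.+1 + (r * (size tuples).+1 + j).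

Definition reads_of (T A : seq nat) : seq (nat * nat) :=
  [seq (nth 0 T i, nth 0 A i) | i <- iota 0 (size T)].

Definition start_con (r : nat) : seq (seq (nat * nat)) := [:: [:: (sum_var r 0, 0)]].

(** The odd part stands on the side of the new partial sum, which avoids subtraction. That [A] is a
    sublist of [inputs] also forces the variables of the tuple to be inputs in increasing order. *)
Definition step_con (r j : nat) : seq (seq (nat * nat)) :=
  flatten [seq
    flatten [seq
      [seq reads_of (nth [::] tuples j) A ++ [:: (sum_var r j, s); (sum_var r j.+1, s')]
      | s' <- [seq s' <- iota 0 modulus |
                (s' + parity_count d gs (nth 0 relevant r) A 1) %% modulus ==
                (s + parity_count d gs (nth 0 relevant r) A 0) %% modulus]]
    | s <- iota 0 modulus]
  | A <- [seq A <- comb (degree d) (inputs gs) | size A == size (nth [::] tuples j)]].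

(** Ties the guess for the [r]-th relevant gate to its count; the variable [k] is shared, so all
    gates refer to the same guess. *)
Definition final_con (r : nat) : seq (seq (nat * nat)) :=
  flatten [seq
    [seq [:: (k, y); (sum_var r (size tuples), s)]
    | s <- [seq s <- iota 0 modulus |
             eval_to gs d relevant (nth [::] patterns y) o &&
             ((nth 0 relevant r \in nth [::] patterns y) == gate_true gs (nth 0 relevant r) s)]]
  | y <- iota 0 (size patterns)].

Definition circuit_cons : seq (seq (seq (nat * nat))) :=
  [seq start_con r | r <- iota 0 (size relevant)] ++
  flatten [seq [seq step_con r j | j <- iota 0 (size tuples)] | r <- iota 0 (size relevant)] ++
  [seq final_con r | r <- iota 0 (size relevant)].

Definition circuit_nvars : nat := k.+1 + size relevant * (size tuples).+1.

(** A common bound for residues, gate positions, patterns and options; the total size of all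
    constraints crudely bounds each of them. *)
Definition circuit_dom : nat :=
  modulus + (size patterns + sumn [seq size C | C <- circuit_cons]).

End Reduction.

Lemma telescope_mod (q m : nat) (s e f : nat -> nat) :
  (forall j, j < m -> (s j.+1 + f j) %% q = (s j + e j) %% q) ->
  (s m + \sum_(0 <= j < m) f j) %% q = (s 0 + \sum_(0 <= j < m) e j) %% q.
Proof.
elim: m => [|m IH] H; first by rewrite !big_geq.
rewrite !big_nat_recr //= addnA [_ + f m]addnAC -modnDml H // modnDml.
rewrite addnAC -modnDml IH; last by move=> j Hj; apply: H; exact: ltnW.
by rewrite modnDml addnA.
Qed.

Lemma eval_to_ext gs j X i (Y Z : seq nat) : Y =i Z -> eval_to gs j X Y i = eval_to gs j X Z i.
Proof.
move=> E; elim: j i => [|j IH] i /=; rewrite E //.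
by congr (if _ then _ else gate_op _ _); apply: eq_map.
Qed.

Section Correct.
Variables (c : circuit) (d k : nat).
Hypothesis wfc : circuit_wf c.
Hypothesis Hweft : circuit_weft c <= 1.
Hypothesis Hdepth : circuit_depth c <= d.
Let gs := map gate_pair (gates c).
Let o := output c.
Notation R := (relevant d gs o).
Notation Ts := (tuples d k).
Notation Pats := (patterns d gs o).
Notation Rm := (modulus gs).
Notation sv := (sum_var d k).
Notation pc := (parity_count d gs).
Notation cons := (circuit_cons d gs o k).

Lemma relevantP : [/\ R != [::], size R <= 2 ^ d &
  {in R, forall r, [/\ leafy gs r, r < size (gates c), depth c r <= d & weft c r <= 1]}].
Proof.
have [H1 H2 H3] := leavesP wfc (out_lt wfc) Hdepth.
split=> // r /H3[? ? Hd Hw]; split=> //; [exact: leq_trans Hd Hdepth|exact: leq_trans Hw Hweft].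
Qed.

Lemma nth_relevant r : r < size R -> [/\ leafy gs (nth 0 R r), nth 0 R r < size (gates c),
  depth c (nth 0 R r) <= d & weft c (nth 0 R r) <= 1].
Proof. by move=> Hr; have [_ _] := relevantP; apply; apply: mem_nth. Qed.

Lemma sumn_filter (F : seq nat -> nat) (P : pred (seq nat)) s :
  sumn [seq F B | B <- [seq B <- s | P B]] = \sum_(B <- s) (if P B then F B else 0).
Proof. by rewrite sumnE big_map big_filter big_mkcond. Qed.

Lemma parity_countE i A : size A <= degree d ->
  pc i A 0 = even_sum (true_preds gs d i) A /\ pc i A 1 = odd_sum (true_preds gs d i) A.
Proof.
move=> HA; have [-> ->] := parity_sum (true_preds gs d i) HA; rewrite /parity_count !sumn_filter.
by split; apply: eq_bigr => B _; rewrite modn2; case: (odd _).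
Qed.

Lemma count_identity r S : r < size R -> uniq S ->
  \sum_(A <- comb (degree d) S) pc (nth 0 R r) A 0 =
  true_preds gs d (nth 0 R r) S + \sum_(A <- comb (degree d) S) pc (nth 0 R r) A 1.
Proof.
move=> Hr US; have [Lr Hlt Hd Hw] := nth_relevant Hr.
have -> : \sum_(A <- comb (degree d) S) pc (nth 0 R r) A 0 =
    \sum_(A <- comb (degree d) S) even_sum (true_preds gs d (nth 0 R r)) A.
  by apply: eq_big_seq => A; rewrite mem_comb => /andP[_ /(parity_countE (nth 0 R r))[]].
have -> : \sum_(A <- comb (degree d) S) pc (nth 0 R r) A 1 =
    \sum_(A <- comb (degree d) S) odd_sum (true_preds gs d (nth 0 R r)) A.
  by apply: eq_big_seq => A; rewrite mem_comb => /andP[_ /(parity_countE (nth 0 R r))[]].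
apply: moebius_trunc => // A UA HA; apply: true_preds_cancel HA => //.
exact: leq_maxr.
Qed.

Lemma true_preds_mod r S : r < size R -> true_preds gs d (nth 0 R r) S < Rm.
Proof.
move=> Hr; have [_ Hlt _ _] := nth_relevant Hr.
by rewrite /modulus size_map ltnS; apply: true_preds_lt.
Qed.

Lemma tuple_sub T : T \in Ts -> {in T, forall t, t < k} /\ size T <= degree d.
Proof.
rewrite mem_comb => /andP[/mem_subseq sT ->]; split=> // t /sT.
by rewrite mem_iota.
Qed.

(** * A satisfying set of inputs solves the constraints *)

Section Sound.
Variable a : nat -> bool.
Hypothesis Hk : count a (circuit_inputs c) = k.
Hypothesis Ha : circuit_value a c.
Let S := [seq i <- inputs gs | a i].

Lemma size_S : size S = k.
Proof. by rewrite size_filter inputsE Hk. Qed.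

Lemma uniq_inputs : uniq (inputs gs).
Proof. by rewrite filter_uniq ?iota_uniq. Qed.

Lemma uniq_S : uniq S. Proof. by rewrite filter_uniq ?uniq_inputs. Qed.

Lemma value_S i : i < size (gates c) -> value c (fun x => x \in S) i = value c a i.
Proof.
elim/ltn_ind: i => i IH Hi; rewrite !valueE //; case: ifP => E1.
  by rewrite mem_filter mem_inputs // E1 andbT.
congr gate_op; apply/eq_in_map => p Hp; have Hlt := gate_pred_lt wfc Hi Hp.
by apply: IH => //; exact: ltn_trans Hlt Hi.
Qed.

Let Y := [seq r <- R | value c a r].

(** Subtraction modulo [Rm] is written as addition of the complement. *)
Fixpoint partial (r j : nat) : nat :=
  if j is j'.+1 then
    (partial r j' + pc (nth 0 R r) [seq nth 0 S t | t <- nth [::] Ts j'] 0 +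
      (Rm - pc (nth 0 R r) [seq nth 0 S t | t <- nth [::] Ts j'] 1 %% Rm)) %% Rm
  else 0.

Definition assignment (v : nat) : nat :=
  if v < k then nth 0 S v
  else if v == k then index Y Pats
  else partial ((v - k.+1) %/ (size Ts).+1) ((v - k.+1) %% (size Ts).+1).

Lemma assignment_sum r j : j <= size Ts -> assignment (sv r j) = partial r j.
Proof.
move=> Hj; rewrite /assignment /sum_var ifF; last by apply/negbTE; lia.
rewrite ifF; last by apply/negbTE; lia.
by rewrite addKn divnMDl // divn_small // addn0 modnMDl modn_small.
Qed.

Lemma partial_lt r j : partial r j < Rm.
Proof. by case: j => //= j; rewrite ltn_mod. Qed.

Lemma partial_step r j :
  (partial r j.+1 + pc (nth 0 R r) [seq nth 0 S t | t <- nth [::] Ts j] 1) %% Rm =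
  (partial r j + pc (nth 0 R r) [seq nth 0 S t | t <- nth [::] Ts j] 0) %% Rm.
Proof.
rewrite /=; set e := pc _ _ 0; set f := pc _ _ 1.
rewrite modnDml -modnDmr -addnA subnK; last by apply: ltnW; rewrite ltn_mod.
by rewrite modnDr.
Qed.

Lemma S_map : S = [seq nth 0 S t | t <- iota 0 k].
Proof. by rewrite -size_S map_nth_iota0 // take_size. Qed.

Lemma sum_tuples (g : seq nat -> nat) :
  \sum_(0 <= j < size Ts) g [seq nth 0 S t | t <- nth [::] Ts j] =
  \sum_(A <- comb (degree d) S) g A.
Proof. by rewrite {2}S_map comb_map big_map [RHS](big_nth [::]). Qed.

(** The congruences only give equality modulo [Rm]; both sides are smaller than it. *)
Lemma partial_total r : r < size R -> partial r (size Ts) = true_preds gs d (nth 0 R r) S.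
Proof.
move=> Hr.
have := @telescope_mod Rm (size Ts) (partial r) _ _ (fun j _ => partial_step r j).
have E1 := sum_tuples (fun A => pc (nth 0 R r) A 1);
  have E0 := sum_tuples (fun A => pc (nth 0 R r) A 0).
cbv beta in E0, E1; rewrite E0 E1 (count_identity Hr uniq_S) add0n => /eqP.
rewrite eqn_modDr => /eqP; rewrite !modn_small ?partial_lt //.
exact: true_preds_mod.
Qed.

Lemma circuit_csp_sound : csp_sat cons.
Proof.
exists assignment => C; rewrite mem_cat => /orP[/mapP[r]|].
  move=> _ ->; exists [:: (sv r 0, 0)]; first by rewrite mem_head.
  by rewrite /= andbT assignment_sum.
rewrite mem_cat => /orP[/flattenP[x /mapP[r Hr ->] /mapP[j Hj ->]]|/mapP[r Hr ->]].
  rewrite mem_iota /= add0n in Hr; rewrite mem_iota /= add0n in Hj.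
  set T := nth [::] Ts j; pose A := [seq nth 0 S t | t <- T].
  have HT : T \in Ts by apply: mem_nth.
  have [T1 T2] := tuple_sub HT.
  have HA : A \in comb (degree d) (inputs gs).
    rewrite mem_comb size_map T2 andbT; apply: subseq_trans (filter_subseq a _).
    have : A \in comb (degree d) S by rewrite S_map comb_map; apply: map_f.
    by rewrite mem_comb => /andP[].
  exists (reads_of T A ++ [:: (sv r j, partial r j); (sv r j.+1, partial r j.+1)]).
    apply/flattenP; eexists.
      by apply/mapP; exists A; [rewrite mem_filter HA size_map eqxx|reflexivity].
    apply/flattenP; eexists.
      by apply/mapP; exists (partial r j); [rewrite mem_iota partial_lt|reflexivity].
    apply/mapP; exists (partial r j.+1) => //.
    rewrite mem_filter mem_iota partial_lt !andbT; apply/eqP; exact: partial_step.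
  rewrite all_cat /= !assignment_sum ?eqxx ?andbT //; last exact: ltnW.
  rewrite all_map; apply/allP => i; rewrite mem_iota /= add0n => Hi.
  by rewrite /assignment T1 ?mem_nth // (nth_map 0).
rewrite mem_iota /= add0n in Hr; have [Lr Hlt Hd Hw] := nth_relevant Hr.
have HY : Y \in Pats.
  rewrite mem_comb filter_subseq size_filter /=; apply: leq_trans (count_size _ _) _.
  by have [_ H _] := relevantP.
exists [:: (k, index Y Pats); (sv r (size Ts), partial r (size Ts))]; last first.
  by rewrite /= assignment_sum // eqxx /assignment ltnn eqxx eqxx.
apply/flattenP; eexists.
  by apply/mapP; exists (index Y Pats); [rewrite mem_iota /= index_mem|reflexivity].
apply/mapP; exists (partial r (size Ts)) => //.
rewrite mem_filter mem_iota partial_lt !andbT nth_index //.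
rewrite (eval_leaves wfc a (out_lt wfc) Hdepth) //; last by have [_ _ H] := relevantP;
  move=> x /H[].
rewrite -value_output Ha /= partial_total // (gate_trueE wfc) //.
by rewrite value_S // mem_filter mem_nth // andbT.
Qed.

End Sound.

(** * A solution yields a satisfying set of inputs *)

Section Complete.
Variable a : nat -> nat.
Hypothesis Ha : forall C, C \in cons -> exists2 p, p \in C & all (fun r => a r.1 == r.2) p.
Let S := [seq a t | t <- iota 0 k].

Lemma start_sol r : r < size R -> a (sv r 0) = 0.
Proof.
move=> Hr; have [|p] := Ha (C := start_con d k r).
  by rewrite mem_cat; apply/orP; left; apply/mapP; exists r; rewrite ?mem_iota.
by rewrite inE => /eqP -> /=; rewrite andbT => /eqP.
Qed.

Lemma step_sol r j : r < size R -> j < size Ts ->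
  let A := [seq a t | t <- nth [::] Ts j] in
  subseq A (inputs gs) /\
  (a (sv r j.+1) + pc (nth 0 R r) A 1) %% Rm = (a (sv r j) + pc (nth 0 R r) A 0) %% Rm.
Proof.
move=> Hr Hj A; have [|p] := Ha (C := step_con d gs o k r j).
  rewrite mem_cat; apply/orP; right; rewrite mem_cat; apply/orP; left; apply/flattenP.
  exists [seq step_con d gs o k r j | j <- iota 0 (size Ts)]; last by apply/mapP; exists j;
    rewrite ?mem_iota.
  by apply/mapP; exists r; rewrite ?mem_iota.
move=> /flattenP[x /mapP[B]]; rewrite mem_filter mem_comb => /andP[/eqP sB /andP[subB _]] ->.
move=> /flattenP[y /mapP[s Hs ->]] /mapP[s']; rewrite mem_filter => /andP[/eqP Hmod Hs'] ->.
rewrite all_cat /= andbT all_map => /andP[/allP H1 /andP[/eqP -> /eqP ->]].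
suff -> : A = B by [].
apply: (@eq_from_nth _ 0); first by rewrite size_map.
move=> i; rewrite size_map => Hi; rewrite (nth_map 0) //.
by have := H1 i; rewrite mem_iota /= => /(_ Hi) /eqP.
Qed.

(** The conditions on tuples are attached to relevant gates, so one must exist for them to restrict
    the chosen inputs. *)
Lemma relevant_gt0 : 0 < size R.
Proof. by have [H _ _] := relevantP; case: R H. Qed.

Lemma tuple_inputs T : T \in Ts -> subseq [seq a t | t <- T] (inputs gs).
Proof.
move=> HT; have Hj : index T Ts < size Ts by rewrite index_mem.
by have [] := step_sol relevant_gt0 Hj; rewrite nth_index.
Qed.

Lemma S_inputs : {subset S <= inputs gs}.
Proof.
move=> x /mapP[t]; rewrite mem_iota /= add0n => Ht ->.
have /tuple_inputs : [:: t] \in Ts.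
  by rewrite mem_comb sub1seq mem_iota Ht /= /degree leq_max.
by rewrite sub1seq.
Qed.

(** For [t < t'] the pair is a tuple, so its two values form a sublist of the duplicate-free list of
    inputs. *)
Lemma uniq_sol : uniq S.
Proof.
rewrite map_inj_in_uniq ?iota_uniq //.
have lt_neq t t' : t < t' -> t' < k -> a t != a t'.
  move=> Htt Ht'.
  have /tuple_inputs : [:: t; t'] \in Ts.
    rewrite mem_comb /= /degree leq_maxl andbT.
    have -> : iota 0 k = iota 0 t.+1 ++ iota t.+1 (k - t.+1).
      by rewrite -{1}[t.+1]add0n -iotaD; congr iota; lia.
    by apply: (@cat_subseq _ [:: t] [:: t']); rewrite sub1seq mem_iota; lia.
  move=> /subseq_uniq H; have := H (filter_uniq _ (iota_uniq _ _)).
  by rewrite /= inE andbT.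
move=> t t'; rewrite !mem_iota /= !add0n => Ht Ht' E.
case: (ltngtP t t') => // Htt; first by have := lt_neq _ _ Htt Ht'; rewrite E eqxx.
by have := lt_neq _ _ Htt Ht; rewrite E eqxx.
Qed.

Lemma sum_tuples_sol (g : seq nat -> nat) :
  \sum_(0 <= j < size Ts) g [seq a t | t <- nth [::] Ts j] = \sum_(A <- comb (degree d) S) g A.
Proof. by rewrite /S comb_map big_map [RHS](big_nth [::]). Qed.

Lemma total_sol r : r < size R -> a (sv r (size Ts)) < Rm ->
  a (sv r (size Ts)) = true_preds gs d (nth 0 R r) S.
Proof.
move=> Hr Hlt.
have := @telescope_mod Rm (size Ts) (fun j => a (sv r j)) _ _ (fun j Hj => (step_sol Hr Hj).2).
have E1 := sum_tuples_sol (fun A => pc (nth 0 R r) A 1);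
  have E0 := sum_tuples_sol (fun A => pc (nth 0 R r) A 0).
cbv beta in E0, E1; rewrite E0 E1 (count_identity Hr uniq_sol) start_sol // add0n => /eqP.
rewrite eqn_modDr => /eqP; rewrite !modn_small //.
exact: true_preds_mod.
Qed.

Lemma final_sol r : r < size R ->
  [/\ a k < size Pats, eval_to gs d R (nth [::] Pats (a k)) o &
    (nth 0 R r \in nth [::] Pats (a k)) = value c (fun x => x \in S) (nth 0 R r)].
Proof.
move=> Hr; have [Lr Hlt Hd Hw] := nth_relevant Hr; have [|p] := Ha (C := final_con d gs o k r).
  rewrite mem_cat; apply/orP; right; rewrite mem_cat; apply/orP; right.
  by apply/mapP; exists r; rewrite ?mem_iota.
move=> /flattenP[x /mapP[y]]; rewrite mem_iota add0n => /andP[_ Hy] -> /mapP[s].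
rewrite mem_filter mem_iota add0n => /andP[/andP[H1 /eqP H2] /andP[_ Hs]] ->.
rewrite /= andbT => /andP[/eqP -> /eqP Es].
split=> //; rewrite H2 -Es total_sol ?Es //; exact: gate_trueE.
Qed.

Lemma circuit_csp_complete : weighted_sat c k.
Proof.
exists (fun x => x \in S); split.
  rewrite -inputsE -size_filter.
  have /perm_size -> : perm_eq [seq x <- inputs gs | x \in S] S.
    apply: uniq_perm; rewrite ?filter_uniq ?uniq_sol ?iota_uniq //.
    by move=> x; rewrite mem_filter; case: (boolP (x \in S)) => // /S_inputs ->.
  by rewrite size_map size_iota.
have [Hk Hev _] := final_sol relevant_gt0.
set Y := nth [::] Pats (a k) in Hev.
have HY : Y \in Pats by apply: mem_nth.
have EY : Y =i [seq r <- R | value c (fun x => x \in S) r].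
  move=> r; rewrite mem_filter; case: (boolP (r \in R)) => Hr; last first.
    rewrite andbF; apply: contraNF Hr; move: HY; rewrite mem_comb => /andP[/mem_subseq sY _].
    exact: sY.
  have Hi : index r R < size R by rewrite index_mem.
  by have [_ _] := final_sol Hi; rewrite nth_index // andbT.
rewrite value_output -(eval_leaves wfc (fun x => x \in S) (out_lt wfc) Hdepth (X := R)) //;
  last first.
  by have [_ _ H] := relevantP; move=> x /H[].
by rewrite -(eval_to_ext gs d R o EY).
Qed.

End Complete.

Theorem circuit_cspP : weighted_sat c k <-> csp_sat cons.
Proof.
by split=> [[a [H1 H2]]|[a Ha]]; [exact: circuit_csp_sound H1 H2|exact: circuit_csp_complete Ha].
Qed.

End Correct.

(** * The reduction is computable in polynomial time *)

Lemma polyf_divn T {cT : coded T} (f g : T -> nat) :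
  polyf f -> polyf g -> polyf (fun x => f x %/ g x).
Proof.
move=> Pf Pg.
apply: (@polyf_ext _ _ _ _ (fun x => count (fun i => i.+1 %% g x == 0) (iota 0 (f x)))).
  move=> x; have [->|g0] := posnP (g x).
    by rewrite divn0; apply/eqP; rewrite -leqn0 leqNgt -has_count; apply/hasPn => i _;
      rewrite modn0.
  elim: (f x) => [|m IH]; first by rewrite div0n.
  by rewrite -{1}[m.+1]addn1 iotaD count_cat IH /= addn0 divnS // addnC.
apply: (polyf_count (h := fun x i => i.+1 %% g x == 0)).
  exact: polyf_iota0.
apply: polyf_eqn; last exact: polyf_const.
apply: polyf_modn; first by apply/polyf_S/polyf_snd/polyf_id.
by apply: (polyf_comp Pg); apply/polyf_fst/polyf_id.
Qed.

Lemma polyf_nat_of_bool T {cT : coded T} (f : T -> bool) :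
  polyf f -> polyf (fun x => nat_of_bool (f x)).
Proof.
move=> Pf; apply: polyf_ext (polyf_if Pf (polyf_const 1) (polyf_const 0)).
by move=> x; case: (f x).
Qed.

(** [pf] follows the syntax of the function. [pf_extra] is a hook that is redefined as new functions
    are treated, so that later goals use their lemmas. *)
Ltac pf_extra := fail.

Ltac pf_step :=
  cbv beta;
  lazymatch goal with
  | |- polyf (fun x => x) => exact polyf_id
  | |- polyf fst => exact (polyf_fst polyf_id)
  | |- polyf snd => exact (polyf_snd polyf_id)
  | |- polyf S => exact (polyf_S polyf_id)
  | |- polyf (fun x => fst (@?f x)) => refine (polyf_fst (f := f) _)
  | |- polyf (fun x => snd (@?f x)) => refine (polyf_snd (f := f) _)
  | |- polyf (fun x => pair (@?f x) (@?g x)) => refine (polyf_pair (f := f) (g := g) _ _)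
  | |- polyf (fun x => cons (@?f x) (@?g x)) => refine (polyf_cons (f := f) (g := g) _ _)
  | |- polyf (fun x => S (@?f x)) => refine (polyf_S (f := f) _)
  | |- polyf (fun x => predn (@?f x)) => refine (polyf_pred (f := f) _)
  | |- polyf (fun x => addn (@?f x) (@?g x)) => refine (polyf_addn (f := f) (g := g) _ _)
  | |- polyf (fun x => muln (@?f x) (@?g x)) => refine (polyf_muln (f := f) (g := g) _ _)
  | |- polyf (fun x => subn (@?f x) (@?g x)) => refine (polyf_subn (f := f) (g := g) _ _)
  | |- polyf (fun x => modn (@?f x) (@?g x)) => refine (polyf_modn (f := f) (g := g) _ _)
  | |- polyf (fun x => divn (@?f x) (@?g x)) => refine (polyf_divn (f := f) (g := g) _ _)
  | |- polyf (fun x => leq (@?f x) (@?g x)) => refine (polyf_leq (f := f) (g := g) _ _)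
  | |- polyf (fun x => andb (@?f x) (@?g x)) => refine (polyf_andb (f := f) (g := g) _ _)
  | |- polyf (fun x => orb (@?f x) (@?g x)) => refine (polyf_orb (f := f) (g := g) _ _)
  | |- polyf (fun x => negb (@?f x)) => refine (polyf_negb (f := f) _)
  | |- polyf (fun x => nat_of_bool (@?f x)) => refine (polyf_nat_of_bool (f := f) _)
  | |- polyf (fun x => @eq_op Datatypes_nat__canonical__eqtype_Equality (@?f x) (@?g x)) =>
      refine (polyf_eqn (f := f) (g := g) _ _)
  | |- polyf (fun x => @eq_op _ (@?f x) (@?g x)) => refine (polyf_eqb (f := f) (g := g) _ _)
  | |- polyf (fun x => in_mem (@?f x) (mem (@?g x))) => refine (polyf_mem (f := f) (g := g) _ _)
  | |- polyf (fun x => cat (@?f x) (@?g x)) => refine (polyf_cat (f := f) (g := g) _ _)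
  | |- polyf (fun x => flatten (@?f x)) => refine (polyf_flatten (f := f) _)
  | |- polyf (fun x => map (@?h x) (@?f x)) => refine (polyf_map (h := h) (f := f) _ _)
  | |- polyf (fun x => filter (@?h x) (@?f x)) => refine (polyf_filter (h := h) (l := f) _ _)
  | |- polyf (fun x => has (@?h x) (@?f x)) => refine (polyf_has (h := h) (l := f) _ _)
  | |- polyf (fun x => all (@?h x) (@?f x)) => refine (polyf_all (h := h) (l := f) _ _)
  | |- polyf (fun x => count (@?h x) (@?f x)) => refine (polyf_count (h := h) (l := f) _ _)
  | |- polyf (fun x => size (@?f x)) => refine (polyf_size (l := f) _)
  | |- polyf (fun x => sumn (@?f x)) => refine (polyf_sumn (l := f) _)
  | |- polyf (fun x => iota (@?f x) (@?g x)) => refine (polyf_iota (f := f) (g := g) _ _)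
  | |- polyf (fun x => drop (@?f x) (@?g x)) => refine (polyf_drop (i := f) (l := g) _ _)
  | |- polyf (fun x => nth _ (@?f x) (@?g x)) =>
      refine (polyf_nth (l := f) (i := g) _ _ _); [reflexivity| |]
  | |- polyf (fun x => head _ (@?f x)) => refine (polyf_head (f := f) _ _); [reflexivity|]
  | |- polyf (fun _ => ?c) => exact (polyf_const c)
  | H : polyf ?f |- polyf ?f => exact H
  | H : polyf ?f |- polyf (fun x => ?f (@?g x)) => refine (polyf_comp (g := f) (f := g) H _)
  end.

Ltac pf_case :=
  lazymatch goal with
  | |- @polyf ?T _ _ _ ?F =>
      (* A test only: building [u] fails unless the body is a conditional. *)
      let u := constr:(fun x : T => ltac:(let b := eval cbv beta in (F x) in
        lazymatch b with if _ then _ else _ => exact tt end)) in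
      refine (polyf_if _ _ _)
  end.

Ltac pf := repeat (cbv beta; first [pf_step | pf_extra | pf_case]).

Lemma polyf_tag_of T {cT : coded T} (gs : T -> seq (nat * seq nat)) (i : T -> nat) :
  polyf gs -> polyf i ->
  polyf (fun x => tag_of (gs x) (i x)).
Proof. by move=> *; rewrite /tag_of; pf. Qed.

Lemma polyf_preds_of T {cT : coded T} (gs : T -> seq (nat * seq nat)) (i : T -> nat) :
  polyf gs -> polyf i ->
  polyf (fun x => preds_of (gs x) (i x)).
Proof. by move=> *; rewrite /preds_of; pf. Qed.

Lemma polyf_gate_op T {cT : coded T} (t : T -> nat) (vs : T -> seq bool) :
  polyf t -> polyf vs ->
  polyf (fun x => gate_op (t x) (vs x)).
Proof. by move=> *; rewrite /gate_op; pf. Qed.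

(** One program for each constant [j]; every level adds an index to the context, hence the induction
    generalises over [T]. *)
Lemma polyf_comb T {cT : coded T} {j : nat} (l : T -> seq nat) :
  polyf l ->
  polyf (fun x => comb j (l x)).
Proof.
elim: j T cT l => [|j IH] T cT l ? /=; pf.
by apply: (IH (T * nat)%type _ (fun p => drop p.2.+1 (l p.1))); pf.
Qed.

Ltac pf_gate :=
  lazymatch goal with
  | |- polyf (fun x => tag_of (@?gs x) (@?i x)) => refine (polyf_tag_of _ _)
  | |- polyf (fun x => preds_of (@?gs x) (@?i x)) => refine (polyf_preds_of _ _)
  | |- polyf (fun x => gate_op (@?t x) (@?vs x)) => refine (polyf_gate_op _ _)
  | |- polyf (fun x => comb ?j (@?l x)) => refine (polyf_comb _)
  end.
Ltac pf_extra ::= pf_gate.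

Lemma polyf_eval_to T {cT : coded T} {j : nat} (gs : T -> seq (nat * seq nat))
    (X Y : T -> seq nat) (i : T -> nat) :
  polyf gs -> polyf X -> polyf Y -> polyf i ->
  polyf (fun x => eval_to (gs x) j (X x) (Y x) (i x)).
Proof.
elim: j T cT gs X Y i => [|j IH] T cT gs X Y i ? ? ? ? /=; pf.
by apply: (IH (T * nat)%type _ (fun p => gs p.1) (fun p => X p.1) (fun p => Y p.1) (fun p => p.2)); pf.
Qed.

Lemma polyf_leaves T {cT : coded T} {j : nat} (gs : T -> seq (nat * seq nat)) (i : T -> nat) :
  polyf gs -> polyf i ->
  polyf (fun x => leaves (gs x) j (i x)).
Proof.
elim: j T cT gs i => [|j IH] T cT gs i ? ? /=; rewrite ?/leafy; pf.
by apply: (IH (T * nat)%type _ (fun p => gs p.1) (fun p => p.2)); pf.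
Qed.

Ltac pf_eval :=
  lazymatch goal with
  | |- polyf (fun x => eval_to (@?gs x) ?j (@?X x) (@?Y x) (@?i x)) =>
      refine (polyf_eval_to _ _ _ _)
  | |- polyf (fun x => leaves (@?gs x) ?j (@?i x)) => refine (polyf_leaves _ _)
  | _ => pf_gate
  end.
Ltac pf_extra ::= pf_eval.

Lemma polyf_true_preds T {cT : coded T} {d : nat} (gs : T -> seq (nat * seq nat)) (i : T -> nat)
    (A : T -> seq nat) :
  polyf gs -> polyf i -> polyf A ->
  polyf (fun x => true_preds (gs x) d (i x) (A x)).
Proof. by move=> *; rewrite /true_preds /inputs; pf. Qed.

Ltac pf_count :=
  lazymatch goal with
  | |- polyf (fun x => true_preds (@?gs x) ?d (@?i x) (@?A x)) => refine (polyf_true_preds _ _ _)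
  | _ => pf_eval
  end.
Ltac pf_extra ::= pf_count.

Lemma polyf_parity_count T {cT : coded T} {d : nat} (gs : T -> seq (nat * seq nat)) (i : T -> nat)
    (A : T -> seq nat) (b : T -> nat) :
  polyf gs -> polyf i -> polyf A -> polyf b ->
  polyf (fun x => parity_count d (gs x) (i x) (A x) (b x)).
Proof. by move=> *; rewrite /parity_count; pf. Qed.

Ltac pf_parity :=
  lazymatch goal with
  | |- polyf (fun x => parity_count ?d (@?gs x) (@?i x) (@?A x) (@?b x)) =>
      refine (polyf_parity_count _ _ _ _)
  | _ => pf_count
  end.
Ltac pf_extra ::= pf_parity.

Lemma polyf_step_con T {cT : coded T} {d : nat} (gs : T -> seq (nat * seq nat))
    (o k r j : T -> nat) :
  polyf gs -> polyf o -> polyf k -> polyf r -> polyf j ->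
  polyf (fun x => step_con d (gs x) (o x) (k x) (r x) (j x)).
Proof.
by move=> *; rewrite /step_con /inputs /modulus /relevant /reads_of /sum_var /tuples; pf.
Qed.

Lemma polyf_final_con T {cT : coded T} {d : nat} (gs : T -> seq (nat * seq nat))
    (o k r : T -> nat) :
  polyf gs -> polyf o -> polyf k -> polyf r ->
  polyf (fun x => final_con d (gs x) (o x) (k x) (r x)).
Proof.
by move=> *; rewrite /final_con /patterns /modulus /relevant /sum_var /tuples /gate_true; pf.
Qed.

Ltac pf_con :=
  lazymatch goal with
  | |- polyf (fun x => step_con ?d (@?gs x) (@?o x) (@?k x) (@?r x) (@?j x)) =>
      refine (polyf_step_con _ _ _ _ _)
  | |- polyf (fun x => final_con ?d (@?gs x) (@?o x) (@?k x) (@?r x)) =>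
      refine (polyf_final_con _ _ _ _)
  | _ => pf_parity
  end.
Ltac pf_extra ::= pf_con.

Lemma polyf_circuit_cons T {cT : coded T} {d : nat} (gs : T -> seq (nat * seq nat))
    (o k : T -> nat) :
  polyf gs -> polyf o -> polyf k ->
  polyf (fun x => circuit_cons d (gs x) (o x) (k x)).
Proof. by move=> *; rewrite /circuit_cons /start_con /sum_var /relevant /tuples; pf. Qed.

Ltac pf_cons :=
  lazymatch goal with
  | |- polyf (fun x => circuit_cons ?d (@?gs x) (@?o x) (@?k x)) =>
      refine (polyf_circuit_cons _ _ _)
  | _ => pf_con
  end.
Ltac pf_extra ::= pf_cons.

Lemma polyf_circuit_nvars T {cT : coded T} {d : nat} (gs : T -> seq (nat * seq nat))
    (o k : T -> nat) :
  polyf gs -> polyf o -> polyf k ->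
  polyf (fun x => circuit_nvars d (gs x) (o x) (k x)).
Proof. by move=> *; rewrite /circuit_nvars /relevant /tuples; pf. Qed.

Lemma polyf_circuit_dom T {cT : coded T} {d : nat} (gs : T -> seq (nat * seq nat))
    (o k : T -> nat) :
  polyf gs -> polyf o -> polyf k ->
  polyf (fun x => circuit_dom d (gs x) (o x) (k x)).
Proof. by move=> *; rewrite /circuit_dom /patterns /modulus /relevant; pf. Qed.

Lemma polyf_trash_events T {cT : coded T} (nv n0 : T -> nat) (cons : T -> seq (seq (seq
    (nat * nat)))) :
  polyf nv -> polyf n0 -> polyf cons ->
  polyf (fun x => trash_events (nv x) (n0 x) (cons x)).
Proof. by move=> *; rewrite /trash_events /copt /harm /lane; pf. Qed.

Lemma polyf_read_events T {cT : coded T} (nv n0 : T -> nat) (cons : T -> seq (seq (seq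
    (nat * nat)))) :
  polyf nv -> polyf n0 -> polyf cons ->
  polyf (fun x => read_events (nv x) (n0 x) (cons x)).
Proof. by move=> *; rewrite /read_events /copt /lane; pf. Qed.

Lemma polyf_amo_events T {cT : coded T} (nv n0 : T -> nat) :
  polyf nv -> polyf n0 ->
  polyf (fun x => amo_events (nv x) (n0 x)).
Proof. by move=> *; rewrite /amo_events /scan /harm /lane; pf. Qed.

Lemma polyf_man_row T {cT : coded T} (g n : T -> nat) (E : T -> seq (nat * nat)) (t l : T -> nat) :
  polyf g -> polyf n -> polyf E -> polyf t -> polyf l ->
  polyf (fun x => man_row (g x) (n x) (E x) (t x) (l x)).
Proof. by move=> *; rewrite /man_row /pid /evl; pf. Qed.

Lemma polyf_last_man T {cT : coded T} (g n : T -> nat) (E : T -> seq (nat * nat)) (H : T -> nat) :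
  polyf g -> polyf n -> polyf E -> polyf H ->
  polyf (fun x => last_man (g x) (n x) (E x) (H x)).
Proof. by move=> *; rewrite /last_man /pid; pf. Qed.

Lemma polyf_woman_row T {cT : coded T} (g n : T -> nat) (E : T -> seq (nat * nat))
    (H t l : T -> nat) :
  polyf g -> polyf n -> polyf E -> polyf H -> polyf t -> polyf l ->
  polyf (fun x => woman_row (g x) (n x) (E x) (H x) (t x) (l x)).
Proof. by move=> *; rewrite /woman_row /pid /evl; pf. Qed.

Ltac pf_net :=
  lazymatch goal with
  | |- polyf (fun x => circuit_nvars ?d (@?gs x) (@?o x) (@?k x)) =>
      refine (polyf_circuit_nvars _ _ _)
  | |- polyf (fun x => circuit_dom ?d (@?gs x) (@?o x) (@?k x)) => refine (polyf_circuit_dom _ _ _)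
  | |- polyf (fun x => trash_events (@?nv x) (@?n0 x) (@?cons x)) =>
      refine (polyf_trash_events _ _ _)
  | |- polyf (fun x => read_events (@?nv x) (@?n0 x) (@?cons x)) => refine (polyf_read_events _ _ _)
  | |- polyf (fun x => amo_events (@?nv x) (@?n0 x)) => refine (polyf_amo_events _ _)
  | |- polyf (fun x => man_row (@?g x) (@?n x) (@?E x) (@?t x) (@?l x)) =>
      refine (polyf_man_row _ _ _ _ _)
  | |- polyf (fun x => last_man (@?g x) (@?n x) (@?E x) (@?H x)) => refine (polyf_last_man _ _ _ _)
  | |- polyf (fun x => woman_row (@?g x) (@?n x) (@?E x) (@?H x) (@?t x) (@?l x)) =>
      refine (polyf_woman_row _ _ _ _ _ _)
  | _ => pf_cons
  end.
Ltac pf_extra ::= pf_net.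

Lemma polyf_csp_events T {cT : coded T} (nv n0 : T -> nat) (cons : T -> seq (seq (seq
    (nat * nat)))) :
  polyf nv -> polyf n0 -> polyf cons ->
  polyf (fun x => csp_events (nv x) (n0 x) (cons x)).
Proof. by move=> *; rewrite /csp_events; pf. Qed.

Lemma polyf_lm T {cT : coded T} (g n : T -> nat) (E : T -> seq (nat * nat)) (H i : T -> nat) :
  polyf g -> polyf n -> polyf E -> polyf H -> polyf i ->
  polyf (fun x => lm (g x) (n x) (E x) (H x) (i x)).
Proof. by move=> *; rewrite /lm; pf. Qed.

Lemma polyf_lw T {cT : coded T} (g n : T -> nat) (E : T -> seq (nat * nat)) (H i : T -> nat) :
  polyf g -> polyf n -> polyf E -> polyf H -> polyf i ->
  polyf (fun x => lw (g x) (n x) (E x) (H x) (i x)).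
Proof. by move=> *; rewrite /lw; pf. Qed.

Ltac pf_out :=
  lazymatch goal with
  | |- polyf (fun x => csp_events (@?nv x) (@?n0 x) (@?cons x)) => refine (polyf_csp_events _ _ _)
  | |- polyf (fun x => lm (@?g x) (@?n x) (@?E x) (@?H x) (@?i x)) => refine (polyf_lm _ _ _ _ _)
  | |- polyf (fun x => lw (@?g x) (@?n x) (@?E x) (@?H x) (@?i x)) => refine (polyf_lw _ _ _ _ _)
  | _ => pf_net
  end.
Ltac pf_extra ::= pf_out.

(** * Bounds on the instance *)

Lemma size_evl E t : size (evl E t) <= 1.
Proof.
case: t => [|t] //; rewrite /evl /=; case: (ltnP t (size E)) => Ht.
  by rewrite (nth_map (0, 0)).
by rewrite nth_default ?size_map.
Qed.

Section NetworkSizes.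
Variables (g n : nat) (E : seq (nat * nat)) (H : nat).
Hypothesis n2 : 1 < n.
Hypothesis g0 : 0 < g.
Hypothesis HL : H < g * n.
Hypothesis EL : forall e, e \in E -> [/\ e.1 < g * n, e.2 < g * n & e.1 != e.2].
Let I := net_smc n2 g0 HL EL.

Lemma size_man_row t l : size (man_row g n E t l) <= 3.
Proof.
rewrite /man_row; case: ifP => _; first by case: ifP.
rewrite /= size_cat size_map size_filter /=.
by rewrite addn1 !ltnS; apply: leq_trans (count_size _ _) (size_evl _ _).
Qed.

Lemma size_woman_row t l : size (woman_row g n E H t l) <= 3.
Proof.
rewrite /woman_row; case: ifP => _; first by rewrite size_cat; case: ifP.
case: ifP => _; first by rewrite /=; case: ifP.
rewrite /= size_cat size_map size_filter /=.
by rewrite addn1 !ltnS; apply: leq_trans (count_size _ _) (size_evl _ _).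
Qed.

Lemma size_listM (m : 'I_(nmen I)) : size (listM m) = size (lm g n E H m).
Proof. by rewrite -[RHS](congr1 size (val_ords (lm_bound n2 g0 HL EL (ltn_ord m)))) size_map. Qed.

Lemma size_listW (w : 'I_(nwomen I)) : size (listW w) = size (lw g n E H w).
Proof. by rewrite -[RHS](congr1 size (val_ords (lw_bound n2 g0 HL EL (ltn_ord w)))) size_map. Qed.

(** The man [N] lists one woman per chain and two more; every other man lists at most three. *)
Lemma DeltaM_net : DeltaM I <= g + 3.
Proof.
apply/bigmax_leqP => m _; rewrite size_listM /lm; case: ifP => _.
  by apply: leq_trans (size_man_row _ _) _; apply: leq_addl.
by case: ifP => //; rewrite /last_man size_cat size_map size_iota /=; lia.
Qed.

(** The second woman of the first chain has two men in the chain and one at time [1], so the value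
    three is attained. *)
Lemma lw_second : size (lw g n E H 1) = 3.
Proof.
have L1 : 1 < g * n by rewrite (leq_trans n2) // leq_pmull.
rewrite /lw (_ : 1 < _); last by rewrite (leq_trans L1) // leq_pmull.
rewrite divn_small // modn_small // /woman_row eqxx (modn_small n2) /=.
by [].
Qed.

Lemma DeltaW_net : DeltaW I = 3.
Proof.
apply/eqP; rewrite eqn_leq; apply/andP; split.
  apply/bigmax_leqP => w _; rewrite size_listW /lw; case: ifP => _; first exact: size_woman_row.
  by case: ifP.
have H1 : 1 < ((size E).+2 * (g * n)).+1 by nia.
by rewrite -lw_second -(size_listW (Ordinal H1)); apply: leq_bigmax.
Qed.

Lemma size_listW_star : size (listW (ms g n E : 'I_(nwomen I))) = 1.
Proof. by rewrite size_listW lwN. Qed.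

End NetworkSizes.

Lemma size_comb j l : size (comb j l) <= (size l).+1 ^ j.
Proof.
elim: j l => [|j IH] //; elim=> [|x l IHl]; first by rewrite comb_nil expn_gt0.
rewrite comb_cons -cat1s !size_cat size_map size_behead -[size [:: _]]/1 -[size (x :: l)]/(size l).+1.
have S1 : 0 < size (comb j.+1 l) by [].
have E1 : (size l).+1 ^ j <= (size l).+2 ^ j by case: (j) => // j'; rewrite leq_exp2r.
rewrite expnS in IHl; rewrite expnS; have H1 := IH l; nia.
Qed.

Lemma leq_sumn (x : nat) s : x \in s -> x <= sumn s.
Proof. by move=> Hx; rewrite sumnE (big_rem x) //= leq_addr. Qed.

Section ConstraintBounds.
Variables (d : nat) (gs : seq (nat * seq nat)) (o k : nat).
Notation cons := (circuit_cons d gs o k).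
Notation nv := (circuit_nvars d gs o k).
Notation n0 := (circuit_dom d gs o k).
Notation R := (relevant d gs o).
Notation Ts := (tuples d k).

Lemma circuit_dom_modulus s : s < modulus gs -> s < n0.
Proof. by move=> Hs; apply: leq_trans Hs _; apply: leq_addr. Qed.

Lemma circuit_dom_pattern y : y < size (patterns d gs o) -> y < n0.
Proof.
by move=> Hy; apply: leq_trans Hy _; rewrite /circuit_dom addnCA; apply: leq_addr.
Qed.

Lemma size_circuit_con C : C \in cons -> size C <= n0.
Proof.
move=> HC; apply: leq_trans (leq_sumn (map_f size HC)) _.
by rewrite /circuit_dom addnA; apply: leq_addl.
Qed.

Lemma sum_var_bound r j : r < size R -> j <= size Ts -> sum_var d k r j < nv.
Proof.
move=> Hr Hj; rewrite /sum_var /circuit_nvars ltn_add2l.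
apply: leq_trans (_ : r.+1 * (size Ts).+1 <= _); last by rewrite leq_mul2r Hr orbT.
by rewrite mulSn addnC ltn_add2r ltnS.
Qed.

Lemma pos_bound j : j <= k -> j < nv.
Proof. by move=> Hj; apply: leq_trans (leq_addr _ _). Qed.

Lemma circuit_read_bound C p r : C \in cons -> p \in C -> r \in p -> r.1 < nv /\ r.2 < n0.
Proof.
rewrite 2!mem_cat => /or3P[/mapP[r0 + ->]|/flatten_mapP[r0 + /mapP[j + ->]]|/mapP[r0 + ->]];
  rewrite !mem_iota add0n => /= Hr0.
- rewrite !inE => /eqP->; rewrite inE => /eqP-> /=; split; first exact: sum_var_bound.
  exact: circuit_dom_modulus.
- move=> Hj /flatten_mapP[A + /flatten_mapP[s + /mapP[s' + ->]]].
  rewrite !mem_filter !mem_iota /= => /andP[/eqP SA HA] Hs /andP[_ Hs'].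
  rewrite mem_cat => /orP[/mapP[i + ->]|]; last first.
    by rewrite !inE => /orP[/eqP->|/eqP->] /=; split;
      do ?[exact: circuit_dom_modulus]; apply: sum_var_bound => //; apply: ltnW.
  rewrite mem_iota /= => Hi; split.
    apply/pos_bound/ltnW.
    have : nth [::] Ts j \in Ts by apply: mem_nth.
    by case/tuple_sub => H _; apply: H; apply: mem_nth.
  apply: circuit_dom_modulus; move: HA; rewrite mem_comb => /andP[/mem_subseq HA _].
  have : nth 0 A i \in inputs gs by apply: HA; rewrite mem_nth // SA.
  by rewrite mem_filter mem_iota => /andP[_ /ltnW].
- move=> /flatten_mapP[y + /mapP[s + ->]].
  rewrite mem_filter !mem_iota /= => Hy /andP[_ Hs].
  rewrite !inE => /orP[/eqP->|/eqP->] /=; split.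
  + exact: pos_bound.
  + exact: circuit_dom_pattern.
  + exact: sum_var_bound.
  + exact: circuit_dom_modulus.
Qed.

(** The control of the parameter: the domain grows with the circuit, the number of groups only with
    [k] and [d]. *)
Lemma circuit_groups_bound : size R <= 2 ^ d ->
  nv + size cons <= k.+1 + 2 ^ d * (2 * k.+1 ^ degree d + 3).
Proof.
move=> HR; have := size_comb (degree d) (iota 0 k); rewrite size_iota -/(tuples d k) => HT.
have -> : size cons = size R * size Ts + 2 * size R.
  rewrite /circuit_cons !size_cat !size_map size_iota size_flatten /shape -map_comp.
  rewrite (eq_map (g := fun=> size Ts)) ?sumnE ?big_map ?big_const_seq ?count_predT ?size_iota ?iter_addn_0.
    by rewrite mulnC; lia.
  by move=> r /=; rewrite size_map size_iota.
rewrite /circuit_nvars; nia.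
Qed.

End ConstraintBounds.

(** * The theorem *)

Definition net_data (g n : nat) (E : seq (nat * nat)) (H : nat) :=
  let N := (size E).+2 * (g * n) in
  ([seq lm g n E H i | i <- iota 0 N.+1],
    ([seq lw g n E H i | i <- iota 0 N.+1], ([:: N], [::] : seq nat))).

Definition csp_data (nv n0 : nat) (cons : seq (seq (seq (nat * nat)))) :=
  (net_data (nv + size cons) n0.+2 (csp_events nv n0 cons) (harm n0), nv + size cons).

Definition reduction (d : nat) (x : (seq (nat * seq nat) * nat) * nat) :=
  csp_data (circuit_nvars d x.1.1 x.1.2 x.2) (circuit_dom d x.1.1 x.1.2 x.2)
    (circuit_cons d x.1.1 x.1.2 x.2).

Lemma polyf_net_data T {cT : coded T} (g n : T -> nat) (E : T -> seq (nat * nat)) (H : T -> nat) :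
  polyf g -> polyf n -> polyf E -> polyf H -> polyf (fun x => net_data (g x) (n x) (E x) (H x)).
Proof. by move=> *; rewrite /net_data; pf. Qed.

Lemma polyf_csp_data T {cT : coded T} (nv n0 : T -> nat) cons :
  polyf nv -> polyf n0 -> polyf cons -> polyf (fun x => csp_data (nv x) (n0 x) (cons x)).
Proof.
by move=> *; apply: polyf_pair; [apply: polyf_net_data|]; rewrite /harm /lane; pf.
Qed.

Lemma polyf_reduction d : polyf (reduction d).
Proof. by apply: polyf_csp_data; pf. Qed.

(** Gates were turned into pairs of a tag and a list so that this is an equality of trees and no
    conversion has to be programmed. *)
Lemma enc_WCS (x : inst WCS) :
  enc x = code ((map gate_pair (gates (sval x.1)), output (sval x.1)), x.2).
Proof.
congr (Node (Node _ _) _).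
exact: (enc_seq_map (@code (nat * seq nat) _) gate_pair).
Qed.

Lemma enc_net_smc g n E H (n2 : 1 < n) (g0 : 0 < g) (HL : H < g * n)
    (EL : forall e, e \in E -> [/\ e.1 < g * n, e.2 < g * n & e.1 != e.2]) :
  enc_smc (net_smc n2 g0 HL EL) = code (net_data g n E H).
Proof. exact: enc_mk_smc (lm_bound n2 g0 HL EL) (lw_bound n2 g0 HL EL) _ _. Qed.

Theorem theorem5 :
  W_hard 1
    (@restriction SMC1_b_DeltaM
       (fun x : inst SMC1_b_DeltaM =>
          let I : smc := (sval x).1 in
          exists s : 'I_(nwomen I),
            [/\ starW I = [set s], DeltaW I = 3 & size (listW s) = 1])).
Proof.
move=> P [d HP]; have [p [h [[b Hb] Hp]]] := polyf_reduction d.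
(* [G k] bounds the number of groups, which is the budget; [DeltaM] is at most three more, whence
   the parameter bound [G k + (G k + 3)]. *)
pose G := fun k => k.+1 + 2 ^ d * (2 * k.+1 ^ degree d + 3).
apply: (@fpt_reduces_poly _ _ _ p b (fun k => G k + (G k + 3)) HP).
- rewrite /G; pf; exact/polyf_expc/polyf_S/polyf_id.
- move=> k l Hkl; have HG : G k <= G l.
    rewrite /G leq_add ?ltnS // leq_mul2l leq_add2r leq_mul2l.
    suff -> : k.+1 ^ degree d <= l.+1 ^ degree d by rewrite !orbT.
    by rewrite leq_exp2r ?ltnS // /degree leq_max.
  lia.
move=> [y [Hweft Hdepth]]; have wfc := valP y.1;
  case: y wfc Hweft Hdepth => [[c wfc'] k] /= wfc Hweft Hdepth.
set gs := map gate_pair (gates c).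
pose cons := circuit_cons d gs (output c) k.
pose nv := circuit_nvars d gs (output c) k.
pose n0 := circuit_dom d gs (output c) k.
have nv0 : 0 < nv by [].
have n00 : 0 < n0 by [].
have Hopt C : C \in cons -> size C <= n0 by apply: size_circuit_con.
have Hread C q r : C \in cons -> q \in C -> r \in q -> r.1 < nv /\ r.2 < n0.
  exact: circuit_read_bound.
have g0 : 0 < nv + size cons by apply: g_gt0.
have HL := harm_bound cons nv0 n00.
have EL := csp_events_bound nv0 n00 Hopt Hread.
pose I := net_smc (isT : 1 < n0.+2) g0 HL EL.
have I1 : starM ((I, nv + size cons) : smc * nat).1 = set0 by [].
pose z : inst SMC1_b_DeltaM := exist _ (I, nv + size cons) I1.
have Hz : exists s : 'I_(nwomen (sval z).1), [/\ starW (sval z).1 = [set s],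
    DeltaW (sval z).1 = 3 & size (listW s) = 1].
  exists (ms (nv + size cons) n0.+2 (csp_events nv n0 cons)).
  by split; [|exact: DeltaW_net|exact: size_listW_star].
exists (exist _ z Hz); split.
- change (spec p (init (@enc WCS (exist _ c wfc', k)))
    (fun S => S 0 = Node (enc_smc I) (enc_nat (nv + size cons)))
    (b * tree_size (@enc WCS (exist _ c wfc', k)) ^ b)).
  by rewrite enc_WCS enc_net_smc; apply: spec_le (Hb ((gs, output c), k)); apply: Hp.
- have [H1 H2] := circuit_cspP k wfc Hweft Hdepth.
  have [H3 H4] := csp_networkP nv0 n00 Hopt Hread.
  have [H5 H6] := net_smcP (isT : 1 < n0.+2) g0 HL EL.
  by split=> /= [/H1/H3/H6|/H5/H4/H2].
have [_ HR _] := relevantP wfc Hweft Hdepth.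
have HG : nv + size cons <= G k by apply: circuit_groups_bound.
have := DeltaM_net (isT : 1 < n0.+2) g0 HL EL; rewrite /= -/I; lia.
Qed.
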